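(* Assume the min-of-linear structure with the fixed declaration described in the context, the standing model conditions and the shared-score perturbation conditions. Fix $P\in\mathcal P$ and suppose the active covariance block $\Sigma_{\mathcal A^*(x)}(x;P)$ is positive definite for $P_X$-a.e. $x$. (i) For $P_X$-a.e. $x$, $$V^{\min}(x;P)\ \ge\ \frac{1}{\mathbf 1_{\mathcal A^*(x)}^\top\,\Sigma_{\mathcal A^*(x)}(x;P)^{-1}\,\mathbf 1_{\mathcal A^*(x)}}.$$ (ii) Let $\lambda^*(x)=\Sigma_{\mathcal A^*(x)}^{-1}\mathbf 1/(\mathbf 1^\top\Sigma_{\mathcal A^*(x)}^{-1}\mathbf 1)$ on $\mathcal A^*(x)$ (zero off the active set) and $$\phi^*_{P,\mathrm{cov}}(x,W)=\min_l u_{P,l}(x)+\sum_{k\in\mathcal A^*(x)}\lambda_k^*(x)\,[h_k(x;W)-u_{P,k}(x)].$$ If there are $f^*\in\mathcal F_{\mathrm B}$ and a measurable $w_*$ with $(f^* )^P_{w_*}=\phi^*_{P,\mathrm{cov}}$ $P$-a.s. and with finite variance under $P$, then for $P_X$-a.e. $x$ $$V^{\min}(x;P)=\frac{1}{\mathbf 1_{\mathcal A^*(x)}^\top\,\Sigma_{\mathcal A^*(x)}(x;P)^{-1}\,\mathbf 1_{\mathcal A^*(x)}},$$ and $\phi^*_{P,\mathrm{cov}}$ attains the conditional floor $V^{\min}(x;P)$ and the total variance floor $V_{\mathrm{low}}(P)$.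
   Context: General framework. $\mathcal X,\mathcal W$ are Polish spaces and $\mathcal P$ is a fixed class of Borel probability measures on $\mathcal X\times\mathcal W$. For $P\in\mathcal P$, $P_X$ is the marginal on $\mathcal X$ and $Q_x^P$ the regular conditional law of $W$ given $X=x$. The target is $\Psi(P)=E_{P_X}[\psi(X,u_P(X))]$ with $\psi$, $u_P$ measurable, $\psi(\cdot,u_P(\cdot))\in L^1(P_X)$, and $u_P(x)=u_{\mathrm{loc}}(x,Q_x^P)$ for one rule $u_{\mathrm{loc}}$. A nuisance declaration consists of measurable maps $\eta_j(P):\mathcal X\to\mathcal N_{0,j}$ ($j\le d$; Polish spaces; $\mathcal N_0=\prod_j\mathcal N_{0,j}$), $\kappa(P):\mathcal X\to\mathcal K_0$ (Polish) with $\kappa(P)(x)=\kappa_\flat(x,\eta(P)(x))$ for a measurable $\kappa_\flat$, and a Polish space $\mathcal W_{\mathrm{aux}}$, such that $\psi(x,u_P(x))=\bar\psi(x,\eta(P)(x),\kappa(P)(x))$ $P_X$-a.s. for a measurable $\bar\psi$. The class $\mathcal F_{\mathrm B}$ consists of all measurable $f:\mathcal X\times\mathcal W\times\mathcal N_0\times\mathcal K_0\times\mathcal W_{\mathrm{aux}}\to\mathbb R$ such that for all $P,P'\in\mathcal P$ and measurable $w:\mathcal X\to\mathcal W_{\mathrm{aux}}$: if for some $j$, $\eta_l(P')=\eta_l(P)$ $P_X$-a.s. for all $l\ne j$, then $f(X,W,\eta(P')(X),\kappa(P)(X),w(X))\in L^1(P)$ with $P$-expectation $\Psi(P)$. Write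 $f_w^P(x,W)=f(x,W,\eta(P)(x),\kappa(P)(x),w(x))$. $V^{\min}(\cdot;P)$ is the essential infimum in $L^0(P_X)$ of $x\mapsto\mathrm{Var}_{Q_x^P}[f_w^P(x,\cdot)]$ over $f\in\mathcal F_{\mathrm B}$ with $\mathrm{Var}_P[f_w^P]<\infty$ ($+\infty$ if none), and $V_{\mathrm{low}}(P)=\mathrm{Var}_{P_X}[\psi(X,u_P(X))]+E_{P_X}[V^{\min}(X;P)]$; these do not depend on $w$. Standing model conditions. Fix a Borel graph $\{(x,Q):Q\in\mathfrak K_x\}$ of admissible conditional laws with Borel maps $\eta_{\mathrm{loc}}(x,Q),\kappa_{\mathrm{loc}}(x,Q)$ on it; $\mathfrak Q_x^P=\{Q\in\mathfrak K_x:\eta_{\mathrm{loc}}(x,Q)=\eta(P)(x),\kappa_{\mathrm{loc}}(x,Q)=\kappa(P)(x)\}$. (a) For $P\in\mathcal P$ and $P_X(A)>0$, the law with marginal $P_X(\cdot\cap A)/P_X(A)$ and the kernel of $P$ is in $\mathcal P$, with the same $\eta,\kappa$ values as $P$ on $A$. (b) There is a finite Borel cost $C(x,Q)\ge1$ on the graph with $|\psi(x,u_{\mathrm{loc}}(x,Q))|\le C(x,Q)$ (the integrand being Borel), also controlling the moments required by the model; each $P\in\mathcal P$ has $Q_x^P\in\mathfrak K_x$ a.s. and $\int C(x,Q_x^P)dP_X<\infty$; each universally measurable selection $R_x\in\mathfrak K_x$ with $\int C(x,R_x)dP_X<\infty$ defines, with marginal $P_X$, a law in $\mathcal P$. (c)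 $\eta(P)(x)=\eta_{\mathrm{loc}}(x,Q_x^P)$ and $\kappa(P)(x)=\kappa_{\mathrm{loc}}(x,Q_x^P)$ for $P_X$-a.e. $x$, and likewise for the integrand. Min-of-linear structure. $\psi(x,u)=\min_{k\le K}u_k$, and there are measurable $h_k:\mathcal X\times\mathcal W\to\mathbb R$ with $u_{P,k}(x)=E_{Q_x^P}[h_k(x;W)]$ and finite second moments under $Q_x^P$; $h=(h_1,\dots,h_K)^\top$. $\Sigma(x;P)=\mathrm{Cov}_{Q_x^P}(h(x;W))$, $\mathcal A^*(x;P)=\{k:u_{P,k}(x)=\min_lu_{P,l}(x)\}$ (abbreviated $\mathcal A^*(x)$), $\Sigma_{S}$ is the principal submatrix indexed by $S$, and $\mathbf 1_S$ the all-ones vector. The declaration (arbitrary $d$) is fixed and has one component $j_\circ$ determining the mean vector: there is a measurable $H_{j_\circ}:\mathcal N_{0,j_\circ}\to\mathbb R^K$ with $H_{j_\circ}\{\eta_{j_\circ}(P)(x)\}=u_P(x)$. Shared-score perturbation conditions. For every $P\in\mathcal P$ and $P_X$-a.e. $x$: (COV1) For every $\epsilon\in(0,1)$ and finitely supported probability $\nu$ on $\mathrm{supp}\,Q_x^P$ with $E_\nu[h(x;W)]=u_P(x)$, $(1-\epsilon)Q_x^P+\epsilon\nu\in\mathfrak Q_x^P$. (COV2) There is a Borel-graph correspondence $x\mapsto D_x\subseteq\mathrm{range}\,\Sigma(x;P)$ with $0\in D_x$, containing a relative neighbourhood of $0$ in $T_0(x)=\{\delta\in\mathrm{range}\,\Sigma(x;P):\delta_{\mathcal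 A^*(x;P)}=0\}$ and a relative neighbourhood of $0$ in $T_{\mathcal A^*}(x)=\{\delta\in\mathrm{range}\,\Sigma(x;P):\delta_i=\delta_j\ \forall i,j\in\mathcal A^*(x;P)\}$ on which the inactive coordinates remain strictly inactive. (COV3) For every $\delta\in D_x$ there are a law $Q_{x,\delta}\ll Q_x^P$ with $E_{Q_{x,\delta}}[h(x;W)]=u_P(x)+\delta$, $Q_{x,0}=Q_x^P$, and a value $e_{j_\circ}(x,\delta)\in\mathcal N_{0,j_\circ}$ with $H_{j_\circ}\{e_{j_\circ}(x,\delta)\}=u_P(x)+\delta$, $e_{j_\circ}(x,0)=\eta_{j_\circ}(P)(x)$. The correspondence $(x,\delta)\mapsto(Q_{x,\delta},e_{j_\circ}(x,\delta))$ has Borel graph and finite cost; each universally measurable selection with integrable cost defines a law $P_\delta\in\mathcal P$ with marginal $P_X$, with $\eta_{j_\circ}(P_\delta)(x)=e_{j_\circ}(x,\delta)$ and all other primary components and $\kappa$ equal to those under $P$. Selections of nonintegrable cost are first restricted to sets of bounded cost, with baseline kernel and value elsewhere; the kernels in (COV1) satisfy the same requirement. *)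

(* Defs.v *)
From HB Require Import structures.
From mathcomp Require Import all_boot all_order all_algebra.
From mathcomp Require Import all_classical all_reals all_analysis measurable_realfun.
Set Implicit Arguments.
Unset Strict Implicit.
Unset Printing Implicit Defensive.
Import Order.TTheory GRing.Theory Num.Theory.
Import numFieldNormedType.Exports.
Local Open Scope classical_set_scope.
Local Open Scope ring_scope.

Definition polish (R : realType) (T : topologicalType) : Prop :=
  (exists2 D : set T, countable D & dense D) /\
  (exists dist : T -> T -> R,
    [/\ forall x y, dist x y = 0 <-> x = y,
        forall x y, dist x y = dist y x,
        forall x y z, dist x z <= dist x y + dist y z,
        forall x (A : set T),
          nbhs x A <-> exists2 e : R, 0 < e & forall y, dist x y < e -> A y &
        forall s : nat -> T,
          (forall e : R, 0 < e -> exists n0, forall m n, (n0 <= m)%N -> (n0 <= n)%N ->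
             dist (s m) (s n) < e) ->
          exists l : T, s @ \oo --> l]).

Notation borel T := (g_sigma_algebraType (@open T)).

(* They generate the product sigma-algebra, which is the Borel one for a finite
   product of Polish spaces. *)
Definition cylinders (d : nat) (N : 'I_d -> ptopologicalType) :
    set (set (forall j, N j)) :=
  [set A | exists j (B : set (borel (N j))),
     measurable B /\ A = [set n | B (n j)]].

Notation pborel N := (g_sigma_algebraType (@cylinders _ N)).

HB.instance Definition _ d d' (T : measurableType d) (T' : measurableType d') :=
  isMeasurableFun.Build _ _ (T * T')%type T fst measurable_fst.

Section Laws.
Context (R : realType) (X W : ptopologicalType).
Local Notation kernel_to_W := (borel X -> pprobability (borel W) R).

Definition marginal (P : probability (borel X * borel W)%type R) :
    probability (borel X) R :=
  distribution P (@fst (borel X) (borel W)).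

(* Equal laws need not be Leibniz-equal as records of type [probability],
   which may differ on nonmeasurable sets. *)
Definition same_law (P Q : set (borel W) -> \bar R) : Prop :=
  forall B, measurable B -> P B = Q B.

(* [Q] need only be universally measurable: [\int] is then the integral with
   respect to the completion of [mu]. *)
Definition is_law_of (mu : probability (borel X) R) (Q : kernel_to_W)
    (P : probability (borel X * borel W)%type R) : Prop :=
  forall (A : set (borel X)) (B : set (borel W)),
    measurable A -> measurable B ->
    P (A `*` B) = (\int[mu]_(x in A) Q x B)%E.

Definition topological_support (Q : pprobability (borel W) R) : set W :=
  [set w | forall U : set W, open U -> U w -> (0 < Q U)%E].

Definition finitely_supported_on (S : set W) (nu : pprobability (borel W) R) :
    Prop :=
  exists F : set W, [/\ finite_set F, F `<=` S & nu F = 1%E].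

End Laws.

Definition universally_measurable (R : realType) d d' (T : measurableType d)
    (U : measurableType d') (f : T -> U) : Prop :=
  forall (mu : probability T R) (B : set U), measurable B ->
    exists2 A, measurable A & mu.-negligible (A `+` f @^-1` B).

(* Greatest lower bound of [F] in the lattice of measurable extended real
   functions modulo null sets; when [F] is empty it is [+oo]. *)
Definition is_ess_infimum (R : realType) d (T : measurableType d)
    (mu : probability T R) (F : set (T -> \bar R)) (V : T -> \bar R) : Prop :=
  [/\ measurable_fun [set: T] V,
      forall g, F g -> \forall x \ae mu, (V x <= g x)%E &
      forall V', measurable_fun [set: T] V' ->
        (forall g, F g -> \forall x \ae mu, (V' x <= g x)%E) ->
        \forall x \ae mu, (V' x <= V x)%E].

Definition posdefmx (R : realType) (n : nat) (A : 'M[R]_n) : Prop :=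
  A^T = A /\ forall v : 'cV[R]_n, v != 0 -> 0 < (v^T *m A *m v) 0 0.

Definition principal_submx (R : realType) (n : nat) (S : {set 'I_n})
    (A : 'M[R]_n) : 'M[R]_#|S| :=
  \matrix_(i, j) A (enum_val i) (enum_val j).

Definition min_coord (R : realType) (n : nat) (v : 'cV[R]_n.+1) : R :=
  \big[Num.min/v ord0 0]_(k < n.+1) v k 0.

Definition argmin (R : realType) (n : nat) (v : 'cV[R]_n.+1) :
    {set 'I_n.+1} := [set k | v k 0 == min_coord v]%SET.

(* 1_S^T A_S^-1 1_S *)
Definition ones_inv_ones (R : realType) (n : nat) (S : {set 'I_n})
    (A : 'M[R]_n) : R :=
  ((const_mx 1 : 'rV[R]_#|S|) *m invmx (principal_submx S A)
     *m (const_mx 1 : 'cV[R]_#|S|)) 0 0.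

(* A_S^-1 1_S / (1_S^T A_S^-1 1_S), extended by 0 off S. *)
Definition min_var_weights (R : realType) (n : nat) (S : {set 'I_n})
    (A : 'M[R]_n) : 'cV[R]_n :=
  \col_k \sum_(i < #|S| | enum_val i == k)
    (invmx (principal_submx S A) *m (const_mx 1 : 'cV[R]_#|S|)) i 0
      / ones_inv_ones S A.

(* [u P] takes its values in R^K with K = nK.+1. *)
Record framework (R : realType) := Framework {
  Xsp : ptopologicalType;
  Wsp : ptopologicalType;
  ncomp : nat;
  Nsp : 'I_ncomp -> ptopologicalType;
  Ksp : ptopologicalType;
  Auxsp : ptopologicalType;
  nK : nat;
  laws : set (probability (borel Xsp * borel Wsp)%type R);
  condlaw : probability (borel Xsp * borel Wsp)%type R ->
    borel Xsp -> pprobability (borel Wsp) R;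
  psi : borel Xsp * borel 'cV[R]_nK.+1 -> R;
  u : probability (borel Xsp * borel Wsp)%type R ->
    borel Xsp -> borel 'cV[R]_nK.+1;
  uloc : borel Xsp * pprobability (borel Wsp) R -> borel 'cV[R]_nK.+1;
  eta : probability (borel Xsp * borel Wsp)%type R ->
    borel Xsp -> pborel Nsp;
  kappa : probability (borel Xsp * borel Wsp)%type R ->
    borel Xsp -> borel Ksp
}.

Section Framework.
Context (R : realType) (F : framework R).
Implicit Types P : probability (borel (Xsp F) * borel (Wsp F))%type R.

Record framework_conditions : Prop := {
  Xsp_polish : polish R (Xsp F);
  Wsp_polish : polish R (Wsp F);
  Nsp_polish : forall j, polish R (@Nsp R F j);
  Ksp_polish : polish R (Ksp F);
  Auxsp_polish : polish R (Auxsp F);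
  condlaw_measurable : forall P, laws P -> measurable_fun setT (condlaw P);
  condlawP : forall P, laws P -> is_law_of (marginal P) (condlaw P) P;
  psi_measurable : measurable_fun setT (@psi R F);
  u_measurable : forall P, laws P -> measurable_fun setT (u P);
  psi_u_integrable : forall P, laws P ->
    (marginal P).-integrable setT (EFin \o (fun x => psi (x, u P x)));
  u_local : forall P, laws P ->
    \forall x \ae marginal P, u P x = uloc (x, condlaw P x);
  eta_measurable : forall P, laws P -> forall j,
    measurable_fun setT (fun x => eta P x j : borel (@Nsp R F j));
  kappa_measurable : forall P, laws P -> measurable_fun setT (kappa P);
  kappa_flat_ex :
    exists2 kflat : borel (Xsp F) * pborel (@Nsp R F) -> borel (Ksp F),
      measurable_fun setT kflat &
      forall P, laws P ->
        \forall x \ae marginal P, kappa P x = kflat (x, eta P x);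
  psi_bar_ex :
    exists2 psibar : borel (Xsp F) * pborel (@Nsp R F) * borel (Ksp F) -> R,
      measurable_fun setT psibar &
      forall P, laws P ->
        \forall x \ae marginal P, psi (x, u P x) = psibar (x, eta P x, kappa P x)
}.

Definition Psi P : \bar R := ('E_(marginal P)[fun x => psi (x, u P x)])%E.

Definition score_space : measurableType _ :=
  (borel (Xsp F) * borel (Wsp F) * pborel (@Nsp R F) * borel (Ksp F)
     * borel (Auxsp F))%type.

Definition score_at (f : score_space -> R)
    (n : borel (Xsp F) -> pborel (@Nsp R F))
    (k : borel (Xsp F) -> borel (Ksp F))
    (w : borel (Xsp F) -> borel (Auxsp F)) :
    borel (Xsp F) * borel (Wsp F) -> R :=
  fun t => f (t.1, t.2, n t.1, k t.1, w t.1).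

(* f_w^P *)
Definition score (f : score_space -> R) P w := score_at f (eta P) (kappa P) w.

Definition FB : set (score_space -> R) :=
  [set f | measurable_fun setT f /\
    forall P P' (w : borel (Xsp F) -> borel (Auxsp F)),
      laws P -> laws P' -> measurable_fun setT w ->
      (exists j, forall l, l != j ->
         \forall x \ae marginal P, eta P' x l = eta P x l) ->
      P.-integrable setT (EFin \o score_at f (eta P') (kappa P) w) /\
      ('E_P[score_at f (eta P') (kappa P) w] = Psi P)%E].

Definition cond_var P (g : borel (Xsp F) * borel (Wsp F) -> R) :
    borel (Xsp F) -> \bar R :=
  fun x => 'V_(condlaw P x)[fun y => g (x, y)].

(* [V] is a version of V^min(.;P), computed with the auxiliary map [w]. *)
Definition is_Vmin P w (V : borel (Xsp F) -> \bar R) : Prop :=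
  is_ess_infimum (marginal P)
    [set cond_var P (score f P w) | f in
       [set f | FB f /\ ('V_P[score f P w] < +oo)%E]] V.

(* V_low(P), for the version [V] of V^min(.;P). *)
Definition Vlow P (V : borel (Xsp F) -> \bar R) : \bar R :=
  ('V_(marginal P)[fun x => psi (x, u P x)] + \int[marginal P]_x V x)%E.

End Framework.

(* [admissible] is the graph {(x, Q) : Q \in K_x}; the three maps are only
   meaningful on it. *)
Record local_model (R : realType) (F : framework R) := LocalModel {
  admissible : set (borel (Xsp F) * pprobability (borel (Wsp F)) R);
  eta_loc : borel (Xsp F) * pprobability (borel (Wsp F)) R ->
    pborel (@Nsp R F);
  kappa_loc : borel (Xsp F) * pprobability (borel (Wsp F)) R ->
    borel (Ksp F);
  cost : borel (Xsp F) * pprobability (borel (Wsp F)) R -> R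
}.

Section Standing.
Context (R : realType) (F : framework R) (L : local_model F).
Implicit Types P : probability (borel (Xsp F) * borel (Wsp F))%type R.

(* The admissible laws at [x] with the local nuisance values of [P]. *)
Definition compatible P (x : borel (Xsp F)) :
    set (pprobability (borel (Wsp F)) R) :=
  [set Q | [/\ admissible L (x, Q), eta_loc L (x, Q) = eta P x &
              kappa_loc L (x, Q) = kappa P x]].

Definition integrated_cost P
    (Q : borel (Xsp F) -> pprobability (borel (Wsp F)) R) : \bar R :=
  (\int[marginal P]_x (cost L (x, Q x))%:E)%E.

Record standing_conditions : Prop := {
  admissible_measurable : measurable (admissible L);
  eta_loc_measurable : measurable_fun (admissible L) (eta_loc L);
  kappa_loc_measurable : measurable_fun (admissible L) (kappa_loc L);
  localization : forall P (A : set (borel (Xsp F))), laws P -> measurable A ->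
    (0 < marginal P A)%E ->
    exists2 P', laws P' &
      [/\ forall B, measurable B ->
            (marginal P A * marginal P' B = marginal P (B `&` A))%E,
          is_law_of (marginal P') (condlaw P) P',
          \forall x \ae marginal P, A x -> eta P' x = eta P x &
          \forall x \ae marginal P, A x -> kappa P' x = kappa P x];
  cost_measurable : measurable_fun (admissible L) (cost L);
  cost_ge1 : forall t, admissible L t -> 1 <= cost L t;
  integrand_measurable :
    measurable_fun (admissible L) (fun t => psi (t.1, uloc t));
  integrand_le_cost : forall t, admissible L t ->
    `|psi (t.1, uloc t)| <= cost L t;
  condlaw_admissible : forall P, laws P ->
    \forall x \ae marginal P, admissible L (x, condlaw P x);
  condlaw_cost : forall P, laws P -> (integrated_cost P (condlaw P) < +oo)%E;
  selection_law : forall P Q, laws P -> universally_measurable R Q ->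
    (\forall x \ae marginal P, admissible L (x, Q x)) ->
    (integrated_cost P Q < +oo)%E ->
    exists2 P', laws P' & is_law_of (marginal P) Q P';
  eta_local : forall P, laws P ->
    \forall x \ae marginal P, eta P x = eta_loc L (x, condlaw P x);
  kappa_local : forall P, laws P ->
    \forall x \ae marginal P, kappa P x = kappa_loc L (x, condlaw P x);
  integrand_local : forall P, laws P ->
    \forall x \ae marginal P, psi (x, u P x) = psi (x, uloc (x, condlaw P x))
}.

End Standing.

Record min_linear (R : realType) (F : framework R) := MinLinear {
  h : 'I_(nK F).+1 -> borel (Xsp F) * borel (Wsp F) -> R;
  jo : 'I_(ncomp F);
  Hjo : borel (@Nsp R F jo) -> borel 'cV[R]_(nK F).+1
}.

Section MinLinearStructure.
Context (R : realType) (F : framework R) (S : min_linear F).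
Implicit Types P : probability (borel (Xsp F) * borel (Wsp F))%type R.

Record min_linear_conditions (L : local_model F) : Prop := {
  psi_min : forall x v, @psi R F (x, v) = min_coord v;
  h_measurable : forall k, measurable_fun setT (h S k);
  h_square_integrable : forall P, laws P -> \forall x \ae marginal P,
    forall k, (condlaw P x).-integrable setT
      (EFin \o (fun y => h S k (x, y) ^+ 2));
  u_mean : forall P, laws P -> \forall x \ae marginal P,
    forall k, ('E_(condlaw P x)[fun y => h S k (x, y)] = (u P x k 0)%:E)%E;
  (* The weakest sense in which [cost] controls the second moments: they are
     bounded by a function of it. *)
  cost_controls_moments : exists b : R -> R,
    forall x Q, admissible L (x, Q) -> forall k,
      (\int[Q]_y ((h S k (x, y)) ^+ 2)%:E <= (b (cost L (x, Q)))%:E)%E;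
  Hjo_measurable : measurable_fun setT (@Hjo R F S);
  Hjo_eta : forall P, laws P ->
    \forall x \ae marginal P, Hjo (eta P x (jo S)) = u P x
}.

(* Sigma(x;P) *)
Definition Sigma P (x : borel (Xsp F)) : 'M[R]_((nK F).+1) :=
  \matrix_(k, l) fine (covariance (condlaw P x)
     (fun y => h S k (x, y)) (fun y => h S l (x, y))).

(* A^*(x;P) *)
Definition active P (x : borel (Xsp F)) : {set 'I_(nK F).+1} :=
  argmin (u P x).

Definition floor_var P (x : borel (Xsp F)) : R :=
  (ones_inv_ones (active P x) (Sigma P x))^-1.

(* phi^*_{P,cov} *)
Definition phi_cov P : borel (Xsp F) * borel (Wsp F) -> R :=
  fun t => min_coord (u P t.1) +
    \sum_(k in active P t.1)
      min_var_weights (active P t.1) (Sigma P t.1) k 0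
        * (h S k t - u P t.1 k 0).

End MinLinearStructure.

Section SharedScore.
Context (R : realType) (F : framework R) (L : local_model F)
  (S : min_linear F).
Implicit Types P : probability (borel (Xsp F) * borel (Wsp F))%type R.
Local Notation kernel_to_W :=
  (borel (Xsp F) -> pprobability (borel (Wsp F)) R).

(* The kernel [Q] and the value [e] of the component [jo] define, with the
   marginal of [P], a law of the class. *)
Definition defines_law P (Q : kernel_to_W)
    (e : borel (Xsp F) -> borel (@Nsp R F (jo S))) : Prop :=
  exists2 P', laws P' &
    [/\ is_law_of (marginal P) Q P',
        \forall x \ae marginal P, eta P' x (jo S) = e x,
        forall l, l != jo S ->
          \forall x \ae marginal P, eta P' x l = eta P x l &
        \forall x \ae marginal P, kappa P' x = kappa P x].

(* Requirement on a selection [x |-> (Q x, e x)]: if its cost is not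
   integrable it is first restricted to a set of bounded cost, with the
   baseline kernel and value elsewhere. *)
Definition selection_requirement P (Q : kernel_to_W)
    (e : borel (Xsp F) -> borel (@Nsp R F (jo S))) : Prop :=
  ((integrated_cost L P Q < +oo)%E -> defines_law P Q e) /\
  (integrated_cost L P Q = +oo%E -> forall M : R,
     defines_law P
       (fun x => if cost L (x, Q x) <= M then Q x else condlaw P x)
       (fun x => if cost L (x, Q x) <= M then e x else eta P x (jo S))).

Definition mean_preserving_mixture P (x : borel (Xsp F)) :
    set (pprobability (borel (Wsp F)) R) :=
  [set Q | exists (eps : R) (nu : pprobability (borel (Wsp F)) R),
    [/\ 0 < eps < 1,
        finitely_supported_on (topological_support (condlaw P x)) nu,
        forall k, ('E_nu[fun y => h S k (x, y)] = (u P x k 0)%:E)%E &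
        forall B, measurable B ->
          Q B = ((1 - eps)%:E * condlaw P x B + eps%:E * nu B)%E]].

Definition range_Sigma P (x : borel (Xsp F)) : set 'cV[R]_(nK F).+1 :=
  [set delta | exists v, delta = Sigma S P x *m v].

Definition T0 P (x : borel (Xsp F)) : set 'cV[R]_(nK F).+1 :=
  [set delta | range_Sigma P x delta /\
     forall k, k \in active P x -> delta k 0 = 0].

Definition TA P (x : borel (Xsp F)) : set 'cV[R]_(nK F).+1 :=
  [set delta | range_Sigma P x delta /\
     forall i j, i \in active P x -> j \in active P x ->
       delta i 0 = delta j 0].

Definition inactive_stay_inactive P (x : borel (Xsp F))
    (delta : 'cV[R]_(nK F).+1) : Prop :=
  forall k, k \notin active P x ->
    min_coord (u P x + delta) < (u P x + delta) k 0.

Definition COV1 : Prop := forall P, laws P ->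
  (\forall x \ae marginal P, mean_preserving_mixture P x `<=` compatible L P x)
  /\ (forall Q, universally_measurable R Q ->
        (\forall x \ae marginal P, mean_preserving_mixture P x (Q x)) ->
        selection_requirement P Q (fun x => eta P x (jo S))).

(* [D] is the graph of the correspondence x |-> D_x. *)
Definition COV2 P (D : set (borel (Xsp F) * borel 'cV[R]_(nK F).+1)) : Prop :=
  measurable D /\
  \forall x \ae marginal P,
    [/\ (forall delta, D (x, delta) -> range_Sigma P x delta),
        D (x, 0),
        (\forall delta \near (0 : 'cV[R]_(nK F).+1),
           T0 P x delta -> D (x, delta)) &
        (\forall delta \near (0 : 'cV[R]_(nK F).+1),
           TA P x delta ->
             D (x, delta) /\ inactive_stay_inactive P x delta)].

(* Finiteness of the cost of Q_{x,delta} is its membership in the domain of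
   the real-valued [cost].  A selection of (x, delta) |-> (Q_{x,delta},
   e(x,delta)) is given by a map x |-> delta x with delta x \in D_x; its
   measurability follows from the measurability of the graphs. *)
Definition COV3 P (D : set (borel (Xsp F) * borel 'cV[R]_(nK F).+1))
    (Qd : borel (Xsp F) * borel 'cV[R]_(nK F).+1 ->
          pprobability (borel (Wsp F)) R)
    (e : borel (Xsp F) * borel 'cV[R]_(nK F).+1 ->
         borel (@Nsp R F (jo S))) : Prop :=
  [/\ measurable
        [set t : borel (Xsp F) * borel 'cV[R]_(nK F).+1
               * pprobability (borel (Wsp F)) R * borel (@Nsp R F (jo S)) |
           [/\ D t.1.1, same_law t.1.2 (Qd t.1.1) & t.2 = e t.1.1]],
      \forall x \ae marginal P, forall delta, D (x, delta) ->
        [/\ Qd (x, delta) `<< condlaw P x,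
            forall k, ('E_(Qd (x, delta))[fun y => h S k (x, y)] =
              ((u P x + delta) k 0)%:E)%E,
            Hjo (e (x, delta)) = u P x + delta &
            admissible L (x, Qd (x, delta))],
      \forall x \ae marginal P,
        same_law (Qd (x, 0)) (condlaw P x) /\ e (x, 0) = eta P x (jo S) &
      forall delta : borel (Xsp F) -> borel 'cV[R]_(nK F).+1,
        universally_measurable R delta ->
        (\forall x \ae marginal P, D (x, delta x)) ->
        selection_requirement P (fun x => Qd (x, delta x))
          (fun x => e (x, delta x))].

Definition shared_score_conditions : Prop :=
  COV1 /\
  forall P, laws P -> exists D, COV2 P D /\ exists Qd e, COV3 P D Qd e.

End SharedScore.

(* Main.v *)
(* A score in F_B has the conditional mean [psi (x, u P x)] under the law of
   [P], by localization to sets of positive mass. By (COV1) its conditional mean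
   is not changed by mixing with a finitely supported law under which [h] keeps
   its mean; a measurable selection of support points and Fourier-Motzkin
   elimination then force the score to be affine in [h], say with slope [a].
   Perturbing along [Sigma lambda^*] via (COV3) gives
   [a^T Sigma lambda^* = floor_var], so that the conditional variance
   [a^T Sigma a] is at least [floor_var] by Cauchy-Schwarz, with equality for
   [a = lambda^*]. *)

Require Import Defs.
From HB Require Import structures.
From mathcomp Require Import all_boot all_order all_algebra.
From mathcomp Require Import all_classical all_reals all_analysis measurable_realfun.
From mathcomp Require Import ring lra.
Set Implicit Arguments.
Unset Strict Implicit.
Unset Printing Implicit Defensive.
Import Order.TTheory GRing.Theory Num.Theory.
Import numFieldNormedType.Exports.
Local Open Scope classical_set_scope.
Local Open Scope ring_scope.

(** The model conditions speak only of measurable selections and of almost every [x], whereas the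
    laws allowed by (COV1) at a single [x] form an uncountable family; a separate argument for each
    of them would accumulate null sets. Hence only countably many selectors are used, chosen so
    that, for almost every [x], a linear functional that is nonnegative at the selected values is
    almost surely nonnegative. A score is merely measurable, so its value at an arbitrary support
    point carries no information; the selected points must therefore also give essential values.
    Elimination takes the place of a separation argument because its coefficients are explicit and
    measurable in [x]: each vector it produces comes from one measurable mixture, to which (COV1)
    applies. The slope [a] need not be unique when [Sigma] is singular; the bound only uses its
    pairing with [Sigma lambda^*]. *)

Local Notation eta := Defs.eta.

(** * Disintegration of a law on a product *)

HB.instance Definition _ d d' (T : measurableType d) (T' : measurableType d')
    (x : T) :=
  isMeasurableFun.Build _ _ T' (T * T')%type (pair x) (pair1_measurable x).

Section Disintegration.
Context d d' (X : measurableType d) (Y : measurableType d') (R : realType).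
Context (mu : probability X R) (Q : X -> pprobability Y R).
Hypothesis mQ : measurable_fun setT Q.
Local Open Scope ereal_scope.

Lemma measurable_kernel_eval (B : set Y) : measurable B ->
  measurable_fun setT (fun x => Q x B).
Proof. by move=> mB; exact: (measurable_kernel (kprobability mQ)). Qed.

Lemma measurable_kernel_xsection (E : set (X * Y)) : measurable E ->
  measurable_fun setT (fun x => Q x (xsection E x)).
Proof.
move=> mE; apply: (measurable_fun_xsection_finite_kernel (kprobability mQ)).
by rewrite inE.
Qed.

Lemma measurable_kernel_integral (g : X * Y -> \bar R) :
  measurable_fun setT g -> (forall t, 0 <= g t) ->
  measurable_fun setT (fun x => \int[Q x]_y g (x, y)).
Proof.
move=> mg g0.
exact: (measurable_fun_integral_finite_kernel g (kprobability mQ)).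
Qed.

Let base_kernel : unit -> pprobability X R := fun=> mu.

Let mbase : measurable_fun setT base_kernel.
Proof. exact: measurable_cst. Qed.

(** The law of the pair [(x, y)] given [x]. Composed with [mu], seen as a kernel from [unit], it
    gives the joint law, and Fubini for [P] becomes the integral formula for composed kernels. *)
Definition graph_kernel (p : unit * X) : {measure set (X * Y) -> \bar R} :=
  distribution (Q p.2) (pair p.2 : {mfun Y >-> (X * Y)%type}).

Let graph_kernelE p U : graph_kernel p U = Q p.2 (xsection U p.2).
Proof. by rewrite /graph_kernel /distribution /pushforward/= xsectionE. Qed.

Let mgraph_kernel U : measurable U -> measurable_fun setT (graph_kernel ^~ U).
Proof.
move=> mU.
rewrite (_ : graph_kernel ^~ U = (fun x => Q x (xsection U x)) \o snd).
  exact: measurableT_comp (measurable_kernel_xsection mU) _.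
by apply/funext => p; rewrite graph_kernelE.
Qed.

HB.instance Definition _ := isKernel.Build _ _ _ _ _ graph_kernel mgraph_kernel.

Let graph_kernelT p : graph_kernel p setT = 1.
Proof. by rewrite graph_kernelE xsectionE preimage_setT probability_setT. Qed.

HB.instance Definition _ :=
  Kernel_isProbability.Build _ _ _ _ _ graph_kernel graph_kernelT.

Let joint : {measure set (X * Y) -> \bar R} :=
  mkcomp (kprobability mbase) graph_kernel tt.

Let jointE E : measurable E -> joint E = \int[mu]_x Q x (xsection E x).
Proof.
move=> mE; rewrite /joint/= /kcomp/=.
by apply: eq_integral => x _; exact: (graph_kernelE (tt, x)).
Qed.

Context (P : probability (X * Y)%type R).
Hypothesis HP : forall A B, measurable A -> measurable B ->
  P (A `*` B) = \int[mu]_(x in A) Q x B.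

Let P_joint E : measurable E -> P E = joint E.
Proof.
move=> mE.
apply: (@g_sigma_algebra_measure_unique _ R (X * Y)%type
  [set A `*` B | A in measurable & B in measurable] _ (fun=> setT)) => //.
- by move=> _ [A mA [B mB <-]]; exact: measurableX.
- by move=> _; exists setT => //; exists setT => //; rewrite setXTT.
- by rewrite bigcup_const//; exists 0%N.
- move=> _ _ [A mA [B mB <-]] [A' mA' [B' mB' <-]].
  exists (A `&` A'); first exact: measurableI.
  by exists (B `&` B'); [exact: measurableI|rewrite setXI].
- move=> _ [A mA [B mB <-]]; transitivity (\int[mu]_(x in A) Q x B).
    exact: HP.
  rewrite [RHS]jointE; last exact: measurableX.
  rewrite integral_mkcond; apply: eq_integral => x _; rewrite patchE.
  case: ifPn => xA; first by rewrite in_xsectionX.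
  by rewrite notin_xsectionX// measure0.
- by move=> _; rewrite (le_lt_trans (probability_le1 _ _))// ltry.
- by move: mE; rewrite -measurable_prod_measurableType.
Qed.

Lemma disintegration_xsection E : measurable E ->
  P E = \int[mu]_x Q x (xsection E x).
Proof. by move=> mE; rewrite P_joint// jointE. Qed.

Lemma ge0_disintegration (g : X * Y -> \bar R) :
  measurable_fun setT g -> (forall t, 0 <= g t) ->
  \int[P]_t g t = \int[mu]_x \int[Q x]_y g (x, y).
Proof.
move=> mg g0.
rewrite (eq_measure_integral joint); last by move=> A mA _; exact: P_joint.
rewrite integral_kcomp//=; apply: eq_integral => x _.
by rewrite ge0_integral_distribution.
Qed.

Lemma disintegration_integrable (g : X * Y -> \bar R) :
  P.-integrable setT g ->
  \forall x \ae mu, (Q x).-integrable setT (fun y => g (x, y)).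
Proof.
move=> /integrableP[mg].
rewrite ge0_disintegration//; last exact: measurableT_comp.
move=> ioo; have mi : measurable_fun setT (fun x => \int[Q x]_y `|g (x, y)|).
  apply: (measurable_kernel_integral (g := fun t => `|g t|)) => //.
  exact: measurableT_comp.
have : mu.-integrable setT (fun x => \int[Q x]_y `|g (x, y)|).
  apply/integrableP; split => //; under eq_integral do
    rewrite gee0_abs ?integral_ge0//; exact: ioo.
move=> /integrable_ae => /(_ measurableT); apply: filterS => x /(_ I) fx.
apply/integrableP; split; last by rewrite ltey_eq fx.
exact: measurable_fun_pair2.
Qed.

Lemma disintegration_integral (g : X * Y -> \bar R) :
  P.-integrable setT g ->
  [/\ measurable_fun setT (fun x => \int[Q x]_y g (x, y)),
     mu.-integrable setT (fun x => \int[Q x]_y g (x, y)) &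
   \int[P]_t g t = \int[mu]_x \int[Q x]_y g (x, y)].
Proof.
move=> ig.
have mg := measurable_int P ig.
have mp := measurable_kernel_integral (measurable_funepos mg)
  (funepos_ge0 g).
have mn := measurable_kernel_integral (measurable_funeneg mg)
  (funeneg_ge0 g).
(* This holds at every [x], integrable or not, since the integral is by definition this difference;
   measurability of the inner integral follows without removing a null set. *)
have E x : \int[Q x]_y g (x, y) =
  \int[Q x]_y (g^\+ (x, y)) - \int[Q x]_y (g^\- (x, y)).
  by rewrite [LHS]integralE; congr (_ - _); apply: eq_integral => y _;
    rewrite ?funeposE ?funenegE.
have ip : mu.-integrable setT (fun x => \int[Q x]_y (g^\+ (x, y))).
  apply/integrableP; split => //.
  under eq_integral do rewrite gee0_abs ?integral_ge0//.
  rewrite -ge0_disintegration//; last exact: measurable_funepos.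
  have /integrableP[_] := integrable_funepos measurableT ig.
  by under eq_integral do rewrite gee0_abs//.
have inn : mu.-integrable setT (fun x => \int[Q x]_y (g^\- (x, y))).
  apply/integrableP; split => //.
  under eq_integral do rewrite gee0_abs ?integral_ge0//.
  rewrite -ge0_disintegration//; last exact: measurable_funeneg.
  have /integrableP[_] := integrable_funeneg measurableT ig.
  by under eq_integral do rewrite gee0_abs//.
split.
- by under eq_fun do rewrite E; exact: emeasurable_funB.
- under eq_fun do rewrite E; exact: integrableB.
- under [RHS]eq_integral do rewrite E.
  rewrite integralB//= integralE ge0_disintegration//; last exact: measurable_funepos.
  by rewrite ge0_disintegration//; exact: measurable_funeneg.
Qed.

End Disintegration.

Lemma measurable_kernel_integral_real d d' (X : measurableType d)
    (Y : measurableType d') (R : realType) (Q : X -> pprobability Y R)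
    (g : X * Y -> R) : measurable_fun setT Q -> measurable_fun setT g ->
  measurable_fun setT (fun x => \int[Q x]_y (g (x, y))%:E)%E.
Proof.
move=> mQ mg; have mg' : measurable_fun setT (EFin \o g) by exact/measurable_EFinP.
rewrite (_ : (fun x => _) = fun x => \int[Q x]_y (EFin \o g)^\+ (x, y) -
    \int[Q x]_y (EFin \o g)^\- (x, y))%E.
  apply: emeasurable_funB.
    exact: (measurable_kernel_integral mQ (measurable_funepos mg')).
  exact: (measurable_kernel_integral mQ (measurable_funeneg mg')).
apply/funext => x; rewrite [LHS]integralE.
by congr (_ - _)%E; apply: eq_integral => y _; rewrite ?funeposE ?funenegE.
Qed.

Lemma disintegration_ae d d' (X : measurableType d) (Y : measurableType d')
    (R : realType) (mu : probability X R) (Q : X -> pprobability Y R)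
    (P : probability (X * Y)%type R) (p : set (X * Y)) :
  measurable_fun setT Q ->
  (forall A B, measurable A -> measurable B ->
    P (A `*` B) = (\int[mu]_(x in A) Q x B)%E) ->
  (\forall t \ae P, p t) -> \forall x \ae mu, \forall y \ae Q x, p (x, y).
Proof.
move=> mQ HP [N [mN N0 pN]].
have mk := measurable_kernel_xsection mQ mN.
have [+ _] := ae_eq_integral_abs mu measurableT mk.
under eq_integral do rewrite gee0_abs//.
rewrite -(disintegration_xsection mQ HP mN) => /(_ N0).
apply: filterS => x /(_ I) Nx; exists (xsection N x); split => //.
  exact: measurable_xsection.
by move=> y np; apply/xsectionP; exact: pN.
Qed.

(** * Almost-everywhere statements and comparison of integrals *)

Lemma ae_forall_count d (T : measurableType d) (R : realType)
    (mu : {measure set T -> \bar R}) (I : countType) (P : I -> T -> Prop) :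
  (forall i, \forall x \ae mu, P i x) -> \forall x \ae mu, forall i, P i x.
Proof.
move=> aeP.
have /ae_foralln : forall n, \forall x \ae mu,
    (if unpickle n is Some i then P i x else True).
  by move=> n; case: (unpickle n) => [i|]; [exact: aeP|exact: aeW].
by apply: filterS => x + i => /(_ (pickle i)); rewrite pickleK.
Qed.

Lemma ae_not_null d (T : measurableType d) (R : realType)
    (mu : {measure set T -> \bar R}) (A : set T) : measurable A -> mu A = 0%E ->
  \forall x \ae mu, ~ A x.
Proof.
move=> mA A0; exists A; split => //.
by move=> x /=; apply: contra_notP.
Qed.

Lemma measurable_set_bool d (T : measurableType d) (b : T -> bool) :
  measurable_fun setT b -> measurable [set x | b x].
Proof.
by move=> /(_ measurableT [set true] I); rewrite setTI.
Qed.

Lemma measurable_set_ltr d (T : measurableType d) (R : realType)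
    (f g : T -> R) : measurable_fun setT f -> measurable_fun setT g ->
  measurable [set x | f x < g x].
Proof.
by move=> mf mg; apply: measurable_set_bool; exact: measurable_fun_ltr.
Qed.

Section IntegralComparison.
Import HBNNSimple.
Context d (T : measurableType d) (R : realType) (mu : probability T R).
Local Open Scope ereal_scope.

Lemma measure0_integral_lt (A : set T) (f g : T -> \bar R) : measurable A ->
  mu.-integrable A f -> mu.-integrable A g ->
  (forall x, A x -> f x < g x) ->
  \int[mu]_(x in A) g x <= \int[mu]_(x in A) f x -> mu A = 0.
Proof.
move=> mA intf intg fg le_gf.
have intgf : mu.-integrable A (g \- f) by exact: integrableB.
have gf0 x : A x -> 0 < g x - f x by move=> /fg; rewrite sube_gt0.
have int0 : \int[mu]_(x in A) `|(g \- f) x| = 0.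
  apply/eqP; rewrite eq_le integral_ge0// andbT.
  under eq_integral => x /set_mem Ax do rewrite gee0_abs ?(ltW (gf0 _ Ax))//.
  by rewrite integralB//= sube_le0.
have [+ _] := ae_eq_integral_abs mu mA (measurable_int _ intgf).
move=> /(_ int0) ae0; apply/(@negligibleP _ _ _ mu A mA).
apply: negligibleS ae0 => x Ax /=; rewrite /= => /(_ Ax) e0.
by have := gf0 x Ax; rewrite e0 ltxx.
Qed.

Lemma ae_eq_le_integral (f g : T -> \bar R) :
  mu.-integrable setT f -> mu.-integrable setT g ->
  (\forall x \ae mu, f x <= g x) -> \int[mu]_x g x <= \int[mu]_x f x ->
  \forall x \ae mu, f x = g x.
Proof.
move=> intf intg fg le_gf.
have intgf : mu.-integrable setT (g \- f) by exact: integrableB.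
have mgf := measurable_int _ intgf.
have fg0 : \forall x \ae mu, f x <= g x /\ f x \is a fin_num.
  have := integrable_ae measurableT intf.
  by apply: filterS2 fg => x fgx /(_ I).
have int0 : \int[mu]_x `|(g \- f) x| = 0.
  apply/eqP; rewrite eq_le integral_ge0// andbT.
  rewrite (ae_eq_integral (g \- f))//=.
  - by rewrite integralB//= sube_le0.
  - exact: measurableT_comp.
  - apply: filterS fg0 => x [fgx ffin] _.
    by rewrite gee0_abs// sube_ge0 ?ffin.
have [+ _] := ae_eq_integral_abs mu measurableT mgf.
move=> /(_ int0); apply: filterS2 fg0 => x [_ ffin] /(_ I) e0.
by rewrite -[g x](@subeK _ _ (f x))// [_ - _]e0 add0e.
Qed.

(** With [q] possibly nonmeasurable, its integral is a supremum over the measurable simple functions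
    below it. Those nearly attaining it are almost everywhere below [k], by the hypothesis on the
    set where they exceed [k]. Their supremum is then below [k] with at least the same integral, so
    it equals [k] almost everywhere, and it is below [q] everywhere. Such a lower integral controls
    [q] from one side only. *)
Lemma ae_le_lower_integral (k q : T -> \bar R) : measurable_fun setT k ->
  (forall x, 0 <= k x <= 1) -> (forall x, 0 <= q x) ->
  (forall A, measurable A -> \int[mu]_(x in A) q x = \int[mu]_(x in A) k x) ->
  \forall x \ae mu, k x <= q x.
Proof.
move=> mk k01 q0 qk.
have intk A : measurable A -> mu.-integrable A k.
  move=> mA; apply: (@le_integrable _ _ _ mu A mA k (cst 1)) => //.
  - exact: measurable_funTS.
  - by move=> x _; case/andP: (k01 x) => k0 k1; rewrite gee0_abs// [leRHS]gee0_abs//=.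
  - apply: (integrableS measurableT) => //.
    by apply: finite_measure_integrable_cst.
have H n : exists h : {nnsfun T >-> R}, (forall x, (h x)%:E <= q x) /\
    \int[mu]_x k x - (n.+1%:R^-1)%:E <= \int[mu]_x (h x)%:E.
  rewrite -qk// ge0_integralTE//.
  set S := [set _ | _ in _].
  have Sfin : ereal_sup S \is a fin_num.
    by rewrite -ge0_integralTE// qk// integrable_fin_num//; exact: intk.
  have [_ [h hq <-] ltS] := @ub_ereal_sup_adherent _ S (n.+1%:R^-1)%R
    ltac:(by rewrite invr_gt0) Sfin.
  by exists h; split => //; rewrite integralT_nnsfun ltW.
have [h Hh] := choice H.
have h_le_k n : \forall x \ae mu, (h n x)%:E <= k x.
  have mhn : measurable_fun setT (fun x => (h n x)%:E).
    by apply/measurable_EFinP.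
  have mA : measurable [set x | k x < (h n x)%:E].
    by rewrite -[X in measurable X]setTI; exact: emeasurable_fun_lt.
  suff : mu [set x | k x < (h n x)%:E] = 0.
    move=> /(ae_not_null mA); apply: filterS => x /= /negP.
    by rewrite -leNgt.
  apply: (@measure0_integral_lt _ k (fun x => (h n x)%:E)) => //.
  - exact: intk.
  - apply: (integrableS measurableT) => //.
    apply/integrableP; split => //.
    under eq_integral do rewrite gee0_abs ?lee_fin//.
    apply: (@le_lt_trans _ _ (\int[mu]_x k x)); last first.
      by rewrite ltey_eq integrable_fin_num//; exact: intk.
    rewrite -qk// !ge0_integralTE// => [|x]; last by rewrite lee_fin.
    apply: ub_ereal_sup => _ [g gh <-]; apply: ereal_sup_ubound.
    exists g => // x; apply: le_trans (gh x) _; exact: (Hh n).1.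
  - rewrite -qk// integral_mkcond [leRHS]integral_mkcond !ge0_integralTE.
    + apply: ub_ereal_sup => _ [g gh <-]; apply: ereal_sup_ubound.
      exists g => // x; apply: le_trans (gh x) _; rewrite !patchE.
      by case: ifP => // _; exact: (Hh n).1.
    + by move=> x; rewrite patchE; case: ifP.
    + by move=> x; rewrite patchE; case: ifP => //; rewrite lee_fin.
pose hs x := esups (fun n => (h n x)%:E) 0%N.
have mhs : measurable_fun setT hs.
  by apply: measurable_fun_esups => //= n; exact/measurable_EFinP.
have h_hs n x : (h n x)%:E <= hs x.
  by apply: ereal_sup_ubound; exists n.
have hs_q x : hs x <= q x.
  by apply: ub_ereal_sup => _ [n _ <-]; exact: (Hh n).1.
have hs0 x : 0 <= hs x.
  by apply: le_trans (h_hs 0%N x); rewrite lee_fin.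
have hs_k : \forall x \ae mu, hs x <= k x.
  have := ae_foralln h_le_k; apply: filterS => x hk.
  by apply: ub_ereal_sup => _ [n _ <-].
have le_khs : \int[mu]_x k x <= \int[mu]_x hs x.
  apply/lee_addgt0Pr => e e0.
  have [n] := ltr_add_invr e0; rewrite add0r => /ltW ne.
  have [_ le1] := Hh n.
  rewrite leeBlDr// in le1; apply: (le_trans le1).
  apply: leeD; last by rewrite lee_fin.
  apply: ge0_le_integral => //; first by move=> x _; rewrite lee_fin.
  exact/measurable_EFinP.
have ihs : mu.-integrable setT hs.
  apply/integrableP; split => //.
  under eq_integral do rewrite gee0_abs//.
  apply: (@le_lt_trans _ _ (\int[mu]_x k x)).
    apply: ae_ge0_le_integral => //; first by move=> x _; case/andP: (k01 x).
    by apply: filterS hs_k.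
  by rewrite ltey_eq integrable_fin_num//; exact: intk.
have := ae_eq_le_integral ihs (intk _ measurableT) hs_k le_khs.
by apply: filterS => x <-.
Qed.

End IntegralComparison.

(** * Separable complete metrics and uniqueness of kernels *)

Record separable_metric (R : realType) (W : ptopologicalType)
    (dist : W -> W -> R) (dd : nat -> W) : Prop := {
  distxx : forall x, dist x x = 0;
  dist_sym : forall x y, dist x y = dist y x;
  dist_triangle : forall x y z, dist x z <= dist x y + dist y z;
  dist_nbhs : forall x (A : set W),
    nbhs x A <-> exists2 e : R, 0 < e & forall y, dist x y < e -> A y;
  dist_complete : forall s : nat -> W,
    (forall e : R, 0 < e -> exists n0, forall m n, (n0 <= m)%N -> (n0 <= n)%N ->
       dist (s m) (s n) < e) ->
    exists l : W, s @ \oo --> l;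
  dist_dense : forall y (e : R), 0 < e -> exists n, dist (dd n) y < e
}.

Lemma polish_separable_metric (R : realType) (W : ptopologicalType) :
  polish R W -> exists (dist : W -> W -> R) dd, separable_metric dist dd.
Proof.
move=> [[D /countable_injP[f finj] dD] [dist [d0 dsym dtri dn dc]]].
(* [dd] inverts the injection [f] of [D] into the naturals; indices outside its range get the
   default [point], which does not harm density. *)
pose dd n := xget point [set z | D z /\ f z = n].
exists dist, dd; split => // [x|y e e0]; first exact/d0.
have [z [yz Dz]] : [set z | dist y z < e] `&` D !=set0.
  apply: dD; first by exists y; rewrite /= (d0 y y).2.
  rewrite openE => z /= yz; apply/dn; exists (e - dist y z).
    by rewrite subr_gt0.
  by move=> t zt; rewrite /= (le_lt_trans (dtri _ z _))// -ltrBrDl.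
exists (f z); rewrite dsym (_ : dd (f z) = z)//.
rewrite /dd; case: xgetP => [t _ [Dt ft]|/(_ z)[]//].
by apply: finj => //; rewrite inE.
Qed.

Section SeparableMetric.
Context (R : realType) (W : ptopologicalType) (dist : W -> W -> R)
  (dd : nat -> W) (mW : separable_metric dist dd).

Definition dball (c : W) (e : R) : set W := [set y | dist c y < e].

Lemma open_dball c e : open (dball c e).
Proof.
rewrite openE => z /= yz; apply/(dist_nbhs mW); exists (e - dist c z).
  by rewrite subr_gt0.
move=> t zt; rewrite /dball/= (le_lt_trans (dist_triangle mW _ z _))//.
by rewrite -ltrBrDl.
Qed.

Lemma measurable_open (U : set W) : open U -> measurable (U : set (borel W)).
Proof. by move=> oU; exact: sub_sigma_algebra. Qed.

Lemma measurable_closed (C : set W) :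
  closed C -> measurable (C : set (borel W)).
Proof.
by move=> cC; rewrite -[C]setCK; apply: measurableC; apply: measurable_open;
  exact: closed_openC.
Qed.

Lemma dball_cover e : 0 < e -> \bigcup_n dball (dd n) e = setT.
Proof.
move=> e0; apply/seteqP; split => // y _.
by have [n yn] := dist_dense mW y e0; exists n.
Qed.

Lemma closed_distP (C : set W) y : closed C ->
  (forall e, 0 < e -> exists2 c, C c & dist c y < e) -> C y.
Proof.
move=> cC H; apply: contrapT => nCy.
have /(dist_nbhs mW)[e e0 He] : nbhs y (~` C).
  by apply: open_nbhs_nbhs; split => //; exact: closed_openC.
have [c Cc yc] := H e e0; apply: (He c) => //.
by rewrite (dist_sym mW).
Qed.

Lemma open_bigcup_dball (U : set W) : open U ->
  U = \bigcup_(p in [set p : nat * nat | dball (dd p.1) p.2.+1%:R^-1 `<=` U])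
        dball (dd p.1) p.2.+1%:R^-1.
Proof.
move=> oU; apply/seteqP; split => [y Uy|y [p /= pU /pU]//].
have /(dist_nbhs mW)[e e0 He] : nbhs y U by exact: open_nbhs_nbhs.
have [n] : exists n, n.+1%:R^-1 + n.+1%:R^-1 < e :> R.
  have [n] := ltr_add_invr (divr_gt0 e0 (ltr0Sn R 1)).
  by rewrite add0r => ne; exists n; rewrite [ltRHS]splitr ltrD.
move=> ne; have r0 : 0 < n.+1%:R^-1 :> R by rewrite invr_gt0.
have [i yi] := dist_dense mW y r0.
exists (i, n) => //= z zi; apply: He.
rewrite (le_lt_trans (dist_triangle mW _ (dd i) _))//.
by rewrite (lt_trans _ ne)// ltrD// (dist_sym mW).
Qed.

(** A generating family of Borel sets that is closed under intersection and countable: two kernels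
    agreeing on each member almost everywhere agree outside a single null set. *)
Definition dball_inter (s : seq (nat * nat)) : set W :=
  foldr (fun p A => dball (dd p.1) p.2.+1%:R^-1 `&` A) setT s.

Lemma measurable_dball_inter s : measurable (dball_inter s : set (borel W)).
Proof.
elim: s => [|p s IH] /=; first exact: measurableT.
by apply: measurableI => //; apply: measurable_open; exact: open_dball.
Qed.

Lemma dball_inter_cat s t :
  dball_inter (s ++ t) = dball_inter s `&` dball_inter t.
Proof. by elim: s => [|p s IH] /=; [rewrite setTI|rewrite IH setIA]. Qed.

Lemma borel_dball_inter :
  @measurable _ (borel W) = <<s range dball_inter >>.
Proof.
apply/seteqP; split; last first.
  apply: smallest_sub; first exact: sigma_algebra_measurable.
  by move=> _ [s _ <-]; exact: measurable_dball_inter.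
apply: smallest_sub; first exact: smallest_sigma_algebra.
move=> U oU; rewrite (open_bigcup_dball oU).
rewrite bigcup_mkcond.
apply: (@countable_bigcupT_measurable _
  (g_sigma_algebraType (range dball_inter))) => // p.
case: ifP => _; last exact: measurable0.
by apply: sub_sigma_algebra; exists [:: p] => //=; rewrite setIT.
Qed.

Lemma probability_eq_dball_inter (P P' : pprobability (borel W) R) :
  (forall s, P (dball_inter s) = P' (dball_inter s)) -> same_law P P'.
Proof.
move=> PP' B mB.
apply: (@g_sigma_algebra_measure_unique _ R (borel W) (range dball_inter) _
  (fun=> setT)) => //.
- by move=> _ [s _ <-]; exact: measurable_dball_inter.
- by move=> _; exists [::].
- by rewrite bigcup_const//; exists 0%N.
- move=> _ _ [s _ <-] [t _ <-]; exists (s ++ t) => //.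
  exact: dball_inter_cat.
- by move=> _ [s _ <-]; exact: PP'.
- by move=> _; rewrite (le_lt_trans (probability_le1 P _))// ltry.
- by rewrite -borel_dball_inter.
Qed.

(** The one-sided bound of [ae_le_lower_integral], applied to a set and to its complement, gives
    equality because both masses add up to 1. *)
Lemma kernel_ae_unique d (X : measurableType d) (mu : probability X R)
    (Q Q' : X -> pprobability (borel W) R) : measurable_fun setT Q' ->
  (forall A B, measurable A -> measurable B ->
     (\int[mu]_(x in A) Q x B = \int[mu]_(x in A) Q' x B)%E) ->
  \forall x \ae mu, same_law (Q x) (Q' x).
Proof.
move=> mQ' QQ'.
have le_ae B : measurable B -> \forall x \ae mu, (Q' x B <= Q x B)%E.
  move=> mB; apply: ae_le_lower_integral.
  - exact: measurable_kernel_eval.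
  - by move=> x; rewrite measure_ge0 probability_le1.
  - by move=> x; exact: measure_ge0.
  - by move=> A mA; exact: QQ'.
have eq_ae s : \forall x \ae mu, Q x (dball_inter s) = Q' x (dball_inter s).
  have mB := measurable_dball_inter s.
  have := le_ae _ (measurableC mB); apply: filterS2 (le_ae _ mB) => x le1.
  rewrite !probability_setC// => le2; apply/eqP; rewrite eq_le le1 andbT.
  move: le2; rewrite -[X in (_ <= X - _)%E]fineK; last by [].
  by rewrite leeBrDr ?fin_num_measure// addeAC leeBlDr ?fin_num_measure//;
    rewrite leeD2lE// ?fin_num_measure.
have := ae_forall_count eq_ae.
by apply: filterS => x Qx; exact: probability_eq_dball_inter.
Qed.

End SeparableMetric.

(** * Measurable selection of support points *)

Section InnerRegularity.
Context (R : realType) (W : ptopologicalType) (dist : W -> W -> R)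
  (dd : nat -> W) (mW : separable_metric dist dd).
Context d (X : measurableType d) (P : probability (X * borel W)%type R).
Local Open Scope ereal_scope.

Lemma measure_vanishing (E : (set (X * borel W))^nat) (e : R) :
  (forall n, measurable (E n)) -> nonincreasing_seq E ->
  \bigcap_n E n = set0 -> (0 < e)%R -> exists n, P (E n) <= e%:E.
Proof.
move=> mE niE E0 e0.
have := @nonincreasing_cvg_mu _ _ _ P E.
rewrite E0 measure0.
move=> /(_ (le_lt_trans (probability_le1 _ (mE 0%N)) (ltry _)) mE measurable0 niE).
move/fine_cvgP => [_ /cvgrPdist_lt/(_ _ e0)[n _ /(_ n (leqnn n))]].
rewrite /= sub0r normrN ger0_norm ?fine_ge0// => /ltW Pn; exists n.
by rewrite -[leLHS]fineK ?lee_fin// fin_num_measure.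
Qed.

(** Closed in the second variable only, [X] carrying no topology here; this is what keeps limits of
    points of a section inside it. *)
Definition closed_sections (G : set (X * borel W)) : Prop :=
  forall x, closed (xsection G x : set W).

Lemma closed_sectionsU G H : closed_sections G -> closed_sections H ->
  closed_sections (G `|` H).
Proof. by move=> cG cH x; rewrite xsectionE preimage_setU -!xsectionE;
  exact: closedU. Qed.

(* Sets which, together with their complement, are inner approximable by sets
   with closed sections: these form a sigma-algebra. *)
Definition section_regular (E : set (X * borel W)) : Prop :=
  forall e : R, (0 < e)%R -> exists G H, [/\ measurable G, measurable H,
    closed_sections G, closed_sections H &
    [/\ G `<=` E, H `<=` ~` E & P (~` (G `|` H)) <= e%:E]].

Lemma section_regularC E : section_regular E -> section_regular (~` E).
Proof.
move=> rE e e0; have [G [H [mG mH cG cH [GE HE PGH]]]] := rE e e0.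
by exists H, G; split => //; split; rewrite ?setCK// setUC.
Qed.

Lemma section_regular_rect (A : set X) : measurable A ->
  section_regular (A `*` setT).
Proof.
move=> mA e e0; exists (A `*` setT), ((~` A) `*` setT); split.
- exact: measurableX.
- by apply: measurableX => //; exact: measurableC.
- move=> x; have [xA|xA] := boolP (x \in A).
    by rewrite in_xsectionX//; exact: closedT.
  by rewrite notin_xsectionX//; exact: closed0.
- move=> x; have [xA|xA] := boolP (x \in ~` A).
    by rewrite in_xsectionX//; exact: closedT.
  by rewrite notin_xsectionX//; exact: closed0.
- split => //; first by move=> [x y] [/= nAx _] [].
  rewrite (_ : ~` _ = set0) ?measure0 ?lee_fin ?ltW//.
  by apply/seteqP; split => // -[x y]; apply => /=; have [Ax|nAx] := pselect (A x);
    [left|right].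
Qed.

Lemma section_regular_open (U : set W) : open U ->
  section_regular (setT `*` (U : set (borel W))).
Proof.
move=> oU e e0.
(* The points at distance at least [1/(n+1)] from the complement: closed sets exhausting [U]. *)
pose F n : set W := [set y | forall z, ~ U z -> (n.+1%:R^-1 <= dist z y)%R].
have cF n : closed (F n).
  rewrite (_ : F n = \bigcap_(z in ~` U) ~` dball dist z n.+1%:R^-1).
    by apply: closed_bigI => z _; apply: open_closedC; exact: (open_dball mW).
  apply/seteqP; split => y Fy z /Fy; rewrite /dball/=.
    by move=> le; apply/negP; rewrite -leNgt.
  by move=> /negP; rewrite -leNgt.
have FU n : F n `<=` U.
  move=> y Fy; apply: contrapT => nUy.
  by have := Fy y nUy; rewrite (distxx mW) leNgt invr_gt0 ltr0Sn.
have mF n : measurable (F n : set (borel W)) by exact: measurable_closed.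
have mU : measurable (U : set (borel W)) by exact: measurable_open.
have [] := @measure_vanishing (fun n => setT `*` (U `\` F n)) e => //.
- by move=> n; apply: measurableX => //; exact: measurableD.
- move=> m n mn; apply/subsetPset => -[x y] /= [_ [Uy nFy]]; split => //.
  split => // Fy; apply: nFy => z /Fy; apply: le_trans.
  by rewrite lef_pV2 ?posrE// ler_nat.
- apply/seteqP; split => // -[x y] /= H.
  have Uy : U y by have [_ []] := H 0%N I.
  have /(dist_nbhs mW)[r r0 Hr] : nbhs y U by exact: open_nbhs_nbhs.
  have [n] := ltr_add_invr r0; rewrite add0r => nr.
  have [_ [_]] := H n I; apply => z nUz; rewrite leNgt; apply/negP => zy.
  by apply: nUz; apply: Hr; rewrite (dist_sym mW) (lt_trans zy).
- move=> n Pn; exists (setT `*` F n), (setT `*` ~` U); split.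
  + exact: measurableX.
  + by apply: measurableX => //; exact: measurableC.
  + by move=> x; rewrite in_xsectionX ?inE//.
  + by move=> x; rewrite in_xsectionX ?inE//; exact: open_closedC.
  + split; first by move=> [x y] [_ /FU].
      by move=> [x y] [_ /= nUy] [].
    apply: le_trans Pn; apply: le_measure; rewrite ?inE.
    * apply: measurableC; apply: measurableU; apply: measurableX => //.
      exact: measurableC.
    * by apply: measurableX => //; exact: measurableD.
    * move=> [x y] /not_orP/= [nF nU]; split => //; split.
        by apply: contrapT => nUy; apply: nU.
      by move=> Fy; apply: nF.
Qed.

(** A countable union of closed sections need not be closed, so the inner approximation of the union
    stops at a finite stage, at the price of [e / 2]; for the complement the full intersection is
    available. The errors [e / 2 / 2 ^ n.+1] sum to the other half. *)
Lemma section_regular_bigcup (E : (set (X * borel W))^nat) :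
  (forall n, section_regular (E n)) -> section_regular (\bigcup_n E n).
Proof.
move=> rE e e0; have e20 : (0 < e / 2)%R by rewrite divr_gt0.
have H n : exists GH : set (X * borel W) * set (X * borel W),
    [/\ measurable GH.1, measurable GH.2,
    closed_sections GH.1, closed_sections GH.2 &
    [/\ GH.1 `<=` E n, GH.2 `<=` ~` E n &
      P (~` (GH.1 `|` GH.2)) <= (e / 2 / (2 ^ n.+1)%:R)%:E]].
  have [|G [H HGH]] := rE n (e / 2 / (2 ^ n.+1)%:R)%R.
    by rewrite divr_gt0// ltr0n expn_gt0.
  by exists (G, H).
have [GH HGH] := choice H.
pose G n := (GH n).1; pose K n := (GH n).2.
pose GN n := \big[setU/set0]_(i < n) G i.
pose Ginf := \bigcup_n G n.
have mG n : measurable (G n) by have [] := HGH n.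
have mK n : measurable (K n) by have [] := HGH n.
have mGN n : measurable (GN n) by exact: bigsetU_measurable.
have mGinf : measurable Ginf by exact: bigcup_measurable.
have mKinf : measurable (\bigcap_n K n) by exact: bigcap_measurable.
have [] := @measure_vanishing (fun n => Ginf `\` GN n) (e / 2)%R => //.
- by move=> n; exact: measurableD.
- move=> m n mn; apply/subsetPset => t [? nG]; split => //; apply: contra_not nG.
  by apply: subset_bigsetU.
- apply/seteqP; split => // t Ht; have [[n _ Gt] _] := Ht 0%N I.
  have [_] := Ht n.+1 I; apply; rewrite /GN -bigcup_mkord.
  by exists n => //=.
- move=> n Pn; exists (GN n), (\bigcap_n K n); split => //.
  + rewrite /GN; elim/big_ind: _ => //.
    * by move=> x; rewrite xsection0; exact: closed0.
    * by move=> ? ?; exact: closed_sectionsU.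
    * by move=> i _; have [] := HGH i.
  + move=> x; rewrite (_ : xsection _ x = \bigcap_n (xsection (K n) x : set W)).
      by apply: closed_bigI => i _; have [_ _ _] := HGH i.
    apply/seteqP; split => [y /xsectionP Ky i _|y Ky].
      by apply/xsectionP; exact: Ky.
    by apply/xsectionP => i _; apply/xsectionP; exact: Ky.
  + split.
    * rewrite /GN -bigcup_mkord => t [i _ Gt]; exists i => //.
      by have [_ _ _ _ [GE _ _]] := HGH i; exact: GE.
    * move=> t Kt [i _ Et]; have [_ _ _ _ [_ KE _]] := HGH i.
      by apply: (KE t) => //; exact: Kt.
    * pose B i := ~` (G i `|` K i).
      have mB i : measurable (B i) by apply: measurableC; exact: measurableU.
      apply: (@le_trans _ _ (P ((Ginf `\` GN n) `|` \bigcup_i B i))).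
        apply: le_measure; rewrite ?inE.
        - by apply: measurableC; exact: measurableU.
        - by apply: measurableU; [exact: measurableD|exact: bigcup_measurable].
        move=> t /not_orP[nG nK].
        have [Gt|nGt] := pselect (Ginf t); [by left|right].
        have [i [_ nKt]] : exists i, True /\ ~ K i t.
          by apply: contrapT => /forallNP nn; apply: nK => i _;
            apply: contrapT => nKi; apply: (nn i).
        by exists i => //; move=> [Gt|//]; apply: nGt; exists i.
      apply: (le_trans (measureU2 _ _ _)) => //.
      - exact: measurableD.
      - exact: bigcup_measurable.
      rewrite [e]splitr EFinD leeD//.
      apply: (@le_trans _ _ (\sum_(i <oo) P (B i))).
        by apply: measure_sigma_subadditive => //; exact: bigcup_measurable.
      apply: le_trans (epsilon_trick0 xpredT (ltW e20)).
      apply: lee_nneseries => [//|i _]; have [_ _ _ _ [_ _ Pi]] := HGH i.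
      exact: Pi.
Qed.

Lemma section_regularI E F : section_regular E -> section_regular F ->
  section_regular (E `&` F).
Proof.
move=> rE rF; rewrite -[E `&` F]setCK setCI -bigcup2E.
apply: section_regularC; apply: section_regular_bigcup => n.
rewrite /bigcup2; case: n => [|[|n]]; [exact: section_regularC..|].
rewrite (_ : set0 = ~` (setT `*` setT)); last by rewrite setXTT setCT.
by apply: section_regularC; exact: section_regular_rect.
Qed.

Lemma section_regularT : section_regular setT.
Proof. by rewrite -setXTT; exact: section_regular_rect. Qed.

Lemma measurable_section_regular E : measurable E -> section_regular E.
Proof.
rewrite measurable_prod_measurableType; move: E; apply: smallest_sub.
  split.
  - rewrite -setCT; apply: section_regularC; exact: section_regularT.
  - by move=> A rA; rewrite setTD; exact: section_regularC.
  - exact: section_regular_bigcup.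
move=> _ [A mA [B mB <-]].
rewrite -[A]setIT -[B]setTI setXI; apply: section_regularI.
  exact: section_regular_rect.
move: B mB; apply: smallest_sub; last exact: section_regular_open.
split.
- rewrite setX0 -setCT; apply: section_regularC; exact: section_regularT.
- move=> B rB; rewrite setTD (_ : _ `*` _ = ~` (setT `*` B)).
    exact: section_regularC.
  apply/seteqP; split => [[x y] [_ nB] [_ //]|[x y] nB]; split => // By.
  exact: nB.
- by move=> B rB; rewrite setX_bigcupr; exact: section_regular_bigcup.
Qed.

Lemma inner_closed_sections E (e : R) : measurable E -> (0 < e)%R ->
  exists G, [/\ measurable G, closed_sections G, G `<=` E & P (E `\` G) <= e%:E].
Proof.
move=> mE e0; have [G [H [mG mH cG cH [GE HE PGH]]]] :=
  measurable_section_regular mE e0.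
exists G; split => //; apply: le_trans PGH; apply: le_measure; rewrite ?inE.
- exact: measurableD.
- by apply: measurableC; exact: measurableU.
- by move=> t [Et nG] [//|/HE].
Qed.

End InnerRegularity.

Section Selection.
Context (R : realType) (W : ptopologicalType) (dist : W -> W -> R)
  (dd : nat -> W) (mW : separable_metric dist dd).
Context d (X : measurableType d) (Q : X -> pprobability (borel W) R).
Hypothesis mQ : measurable_fun setT Q.
Local Open Scope ereal_scope.
Implicit Types E G : set (X * borel W).

(* At each [x] the section of [E] is cut down to the first ball of radius
   [1/(n+1)], centred in the dense sequence, in which it keeps positive mass.
   Iterating over [n], the sections shrink to a point of the support of [Q x],
   which depends measurably on [x]. *)
Definition charged_ball E n i : set X :=
  [set x | 0 < Q x (xsection E x `&` dball dist (dd i) n.+1%:R^-1)].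

Definition first_charged_ball E n i : set X :=
  charged_ball E n i `\` \bigcup_(j < i) charged_ball E n j.

Definition shrink E n : set (X * borel W) :=
  E `&` \bigcup_i (first_charged_ball E n i `*` dball dist (dd i) n.+1%:R^-1).

Fixpoint shrinks G n : set (X * borel W) :=
  if n is m.+1 then shrink (shrinks G m) m else G.

Lemma measurable_charged_ball E n i : measurable E ->
  measurable (charged_ball E n i).
Proof.
move=> mE; rewrite -[X in measurable X]setTI.
have mE' : measurable (E `&` (setT `*` dball dist (dd i) n.+1%:R^-1)).
  apply: measurableI => //; apply: measurableX => //.
  by apply: measurable_open; exact: (open_dball mW).
rewrite (_ : charged_ball E n i = [set x | 0 < Q x (xsection
    (E `&` (setT `*` dball dist (dd i) n.+1%:R^-1)) x)]).
  by apply: emeasurable_fun_o_infty => //; exact: measurable_kernel_xsection.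
by apply/seteqP; split => x; rewrite /charged_ball/= xsectionI in_xsectionX ?inE.
Qed.

Lemma measurable_first_charged_ball E n i : measurable E ->
  measurable (first_charged_ball E n i).
Proof.
move=> mE; apply: measurableD; first exact: measurable_charged_ball.
by apply: bigcup_measurable => j _; exact: measurable_charged_ball.
Qed.

Lemma measurable_shrink E n : measurable E -> measurable (shrink E n).
Proof.
move=> mE; apply: measurableI => //; apply: bigcup_measurable => i _.
apply: measurableX; first exact: measurable_first_charged_ball.
by apply: measurable_open; exact: (open_dball mW).
Qed.

Lemma measurable_shrinks G n : measurable G -> measurable (shrinks G n).
Proof. by move=> mG; elim: n => //= n IH; exact: measurable_shrink. Qed.

Lemma first_charged_ball_inj E n i j x : first_charged_ball E n i x ->
  first_charged_ball E n j x -> i = j.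
Proof.
move=> [ci ni] [cj nj]; have [ij|ji|//] := ltngtP i j.
- by exfalso; apply: nj; exists i.
- by exfalso; apply: ni; exists j.
Qed.

Lemma first_charged_ball_ex E n x : measurable E ->
  0 < Q x (xsection E x) -> exists i, first_charged_ball E n i x.
Proof.
move=> mE E0.
have [i Hi] : exists i, charged_ball E n i x.
  apply: contrapT => /forallNP H.
  have mb i : measurable (dball dist (dd i) n.+1%:R^-1 : set (borel W)).
    by apply: measurable_open; exact: (open_dball mW).
  have mE' := measurable_xsection x mE.
  suff : Q x (xsection E x) = 0 by move=> E00; rewrite E00 ltxx in E0.
  rewrite -[xsection E x]setIT -(@dball_cover _ _ _ _ mW n.+1%:R^-1)%R//.
  rewrite setI_bigcupr; apply/eqP; rewrite eq_le measure_ge0 andbT.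
  apply: le_trans (measure_sigma_subadditive _ _ _ (@subset_refl _ _)) _.
  - by move=> i; exact: measurableI.
  - by apply: bigcup_measurable => i _; exact: measurableI.
  - rewrite eseries0// => i _ _; apply/eqP; rewrite eq_le measure_ge0 andbT.
    by rewrite leNgt; apply/negP; exact: (H i).
have [m Hm min] := ex_minnP (ex_intro (fun i => `[< charged_ball E n i x >]) i
  (asboolT Hi)).
exists m; split; first exact/asboolP.
by move=> [j /= jm /asboolP/min]; rewrite leqNgt jm.
Qed.

Lemma shrink_xsection E n i x : first_charged_ball E n i x ->
  xsection (shrink E n) x = xsection E x `&` dball dist (dd i) n.+1%:R^-1.
Proof.
move=> Hi; apply/seteqP; split => y.
  move=> /xsectionP[/= Exy [j _ [/= Hj yj]]]; split; first exact/xsectionP.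
  by rewrite (first_charged_ball_inj Hi Hj).
by move=> [/xsectionP Exy yi]; apply/xsectionP; split => //; exists i.
Qed.

Lemma shrinks_gt0 G n x : measurable G -> 0 < Q x (xsection G x) ->
  0 < Q x (xsection (shrinks G n) x).
Proof.
move=> mG G0; elim: n => //= n IH.
have [i Hi] := first_charged_ball_ex n (measurable_shrinks n mG) IH.
by rewrite (shrink_xsection Hi); case: Hi.
Qed.

Lemma shrinks_sub G m n : (n <= m)%N -> shrinks G m `<=` shrinks G n.
Proof.
elim: m => [|m IH]; first by rewrite leqn0 => /eqP ->.
by rewrite leq_eqVlt => /predU1P[->//|/IH nm] t [/nm].
Qed.

(** Points picked in the successive sections form a Cauchy sequence, whose limit stays in the closed
    section of [G]. Every neighbourhood of the limit contains one of the shrunk sections, which has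
    positive mass, so the limit is in the support. The distance bounds locate the limit through the
    indices of the balls, on which measurability of the selection rests. *)
Lemma shrinks_point G x : measurable G -> closed_sections G ->
  0 < Q x (xsection G x) ->
  exists y, [/\ G (x, y), topological_support (Q x) y &
    forall n i, first_charged_ball (shrinks G n) n i x ->
      (dist (dd i) y <= n.+1%:R^-1)%R].
Proof.
move=> mG cG G0.
have ne n : exists y, shrinks G n.+1 (x, y).
  have := shrinks_gt0 n.+1 mG G0; apply: contraPP => /forallNP H.
  rewrite (_ : xsection _ _ = set0) ?measure0 ?ltxx//.
  by apply/seteqP; split => // y /xsectionP/H.
have [s Hs] := choice ne.
have ball n i m : first_charged_ball (shrinks G n) n i x -> (n <= m)%N ->
    (dist (dd i) (s m) < n.+1%:R^-1)%R.
  move=> Hi nm; have : xsection (shrinks G n.+1) x (s m).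
    by apply/xsectionP; exact: shrinks_sub (Hs m).
  by rewrite /= (shrink_xsection Hi) => -[].
have exi n : exists i, first_charged_ball (shrinks G n) n i x.
  by apply: first_charged_ball_ex; [exact: measurable_shrinks|exact: shrinks_gt0].
have inv2 e : (0 < e)%R -> exists n, (n.+1%:R^-1 + n.+1%:R^-1 < e :> R)%R.
  move=> e0; have [n] := ltr_add_invr (divr_gt0 e0 (ltr0Sn R 1)).
  by rewrite add0r => ne'; exists n; rewrite [ltRHS]splitr ltrD.
have [|y sy] := @dist_complete _ _ _ _ mW s.
  move=> e /inv2[n ne2]; have [i Hi] := exi n; exists n => m m' nm nm'.
  rewrite (le_lt_trans (dist_triangle mW _ (dd i) _))// (lt_trans _ ne2)//.
  by rewrite ltrD// ?(dist_sym mW (s m)) ball.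
have sy' e : (0 < e)%R -> exists N, forall m, (N <= m)%N -> (dist y (s m) < e)%R.
  move=> e0; have : nbhs y (dball dist y e).
    by apply/(dist_nbhs mW); exists e.
  by move=> /sy[N _ HN]; exists N => m Nm; exact: HN.
have yball n i : first_charged_ball (shrinks G n) n i x ->
      (dist (dd i) y <= n.+1%:R^-1)%R.
  move=> Hi; apply/ler_addgt0Pr => e e0.
  have [N HN] := sy' e e0.
  rewrite (le_trans (dist_triangle mW _ (s (maxn N n)) _))// lerD//.
    by apply: ltW; apply: ball Hi _; rewrite leq_maxr.
  by rewrite (dist_sym mW) ltW// HN// leq_maxl.
exists y; split => //.
- suff : xsection G x y by move=> /xsectionP.
  apply: (closed_distP mW) => // e e0; have [N HN] := sy' e e0.
  exists (s N); last by rewrite (dist_sym mW) HN.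
  by apply/xsectionP; exact: shrinks_sub (leq0n _) _ (Hs N).
- move=> U oU Uy.
  have /(dist_nbhs mW)[e e0 He] : nbhs y U by exact: open_nbhs_nbhs.
  have [n ne'] := inv2 e e0; have [i Hi] := exi n.
  apply: lt_le_trans (shrinks_gt0 n.+1 mG G0) _.
  apply: le_measure; rewrite ?inE.
  + by apply: measurable_xsection; exact: measurable_shrinks.
  + exact: measurable_open.
  + rewrite /= (shrink_xsection Hi) => z [_ iz]; apply: He.
    rewrite (le_lt_trans (dist_triangle mW _ (dd i) _))// (lt_trans _ ne')//.
    by rewrite ler_ltD// (dist_sym mW) yball.
Qed.

Lemma closed_sections_selection G : measurable G -> closed_sections G ->
  exists y : X -> borel W, measurable_fun setT y /\
    forall x, 0 < Q x (xsection G x) ->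
      G (x, y x) /\ topological_support (Q x) (y x).
Proof.
move=> mG cG; pose A := [set x | 0 < Q x (xsection G x)].
have mA : measurable A.
  rewrite -[A]setTI; apply: emeasurable_fun_o_infty => //.
  exact: measurable_kernel_xsection.
have /choice[y Hy] : forall x, exists y, (A x -> [/\ G (x, y), topological_support (Q x) y &
    forall n i, first_charged_ball (shrinks G n) n i x ->
      (dist (dd i) y <= n.+1%:R^-1)%R]) /\ (~ A x -> y = point).
  move=> x; have [Ax|nAx] := pselect (A x); last by exists point; split.
  by have [y Hy] := shrinks_point mG cG Ax; exists y; split.
exists y; split; last by move=> x /(Hy x).1[].
have mC (C : set W) : closed C -> measurable (A `&` y @^-1` C).
  move=> cC.
  (* The selected point lies within [1/(n+1)] of the centre chosen at stage [n]. It is therefore in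
     the closed set [C] exactly when every chosen centre is that close to [C], a condition on
     measurable sets of [x]. *)
  pose near_ball n := [set i | exists2 c, C c & (dist (dd i) c <= n.+1%:R^-1)%R].
  rewrite (_ : _ `&` _ = A `&` \bigcap_n \bigcup_(i in near_ball n)
      first_charged_ball (shrinks G n) n i).
    apply: measurableI => //; apply: bigcap_measurable => // n _.
    apply: bigcup_measurable => i _.
    by apply: measurable_first_charged_ball; exact: measurable_shrinks.
  apply/seteqP; split => x [Ax].
    have [_ _ yb] := (Hy x).1 Ax; move=> Cy; split => // n _.
    have [i Hi] := first_charged_ball_ex n (measurable_shrinks n mG)
      (shrinks_gt0 n mG Ax).
    by exists i => //; exists (y x) => //; exact: yb.
  have [_ _ yb] := (Hy x).1 Ax; move=> H; split => //=.
  apply: (closed_distP mW) => // e e0.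
  have [n] := ltr_add_invr (divr_gt0 e0 (ltr0Sn R 1)).
  rewrite add0r => ne; have [i [c Cc ci] Hi] := H n I.
  exists c => //; rewrite (le_lt_trans (dist_triangle mW _ (dd i) _))//.
  rewrite [ltRHS]splitr ltrD//.
    by rewrite (dist_sym mW) (le_lt_trans ci).
  by rewrite (le_lt_trans (yb _ _ Hi)).
apply: (@measurability _ _ X (borel W) setT y (@open W)) => // _ [U oU <-]; rewrite setTI.
rewrite (_ : y @^-1` U = (A `\` (A `&` y @^-1` (~` U))) `|`
    ([set x | U point] `\` A)).
  apply: measurableU; apply: measurableD => //.
    by apply: mC; exact: open_closedC.
  have [Up|nUp] := pselect (U point).
    by rewrite (_ : [set _ | _] = setT)//; apply/seteqP; split.
  by rewrite (_ : [set _ | _] = set0)//; apply/seteqP; split.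
apply/seteqP; split => x.
  move=> Uy; have [Ax|nAx] := pselect (A x).
    by left; split => // -[_]; apply.
  by right; split => //=; rewrite -((Hy x).2 nAx).
case=> [[Ax nAU]|[/= Up nAx]]; last by rewrite /= (Hy x).2.
by apply: contrapT => nU; apply: nAU.
Qed.

End Selection.

(** * Selectors of essential values of a random vector *)

Section EssentialSelectors.
Context (R : realType) (J : finType).
Implicit Types (a v : J -> R) (p : {ffun J -> rat} * nat).

Definition pairing a v : R := \sum_j a j * v j.

(** A countable base of the topology of [J -> R], through which uncountably many functionals are
    tested at once. *)
Definition rational_box p : set (J -> R) :=
  [set v | forall j, `|v j - ratr (p.1 j)| < p.2.+1%:R^-1].

Lemma rational_box_small v (e : R) : 0 < e ->
  exists p, rational_box p v /\
    forall v', rational_box p v' -> forall j, `|v' j - v j| < e.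
Proof.
move=> e0; have [n] := ltr_add_invr (divr_gt0 e0 (ltr0Sn R 1)).
rewrite add0r => ne.
have /choice[q Hq] : forall j, exists q : rat, `|v j - ratr q| < n.+1%:R^-1.
  move=> j; have [] := @rat_in_itvoo R (v j - n.+1%:R^-1) (v j + n.+1%:R^-1).
    by rewrite ltrBlDr -addrA ltrDl addr_gt0// invr_gt0.
  by move=> q; rewrite in_itv/= => qj; exists q; rewrite distrC ltr_distl.
exists ([ffun j => q j], n); split => [j|v' Hv' j]; first by rewrite /= ffunE.
have := Hv' j; rewrite /= ffunE => Hj.
rewrite -(subrKA (ratr (q j))) (le_lt_trans (ler_normD _ _))// [ltRHS]splitr.
by rewrite ltrD// (lt_trans _ ne)// distrC.
Qed.

Lemma rational_box_pairing a v (e : R) : 0 < e ->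
  exists p, rational_box p v /\
    forall v', rational_box p v' -> `|pairing a v' - pairing a v| < e.
Proof.
move=> e0; pose M := \sum_j `|a j| + 1.
have M0 : 0 < M by rewrite ltr_wpDl// sumr_ge0.
have [p [pv Hp]] := rational_box_small v (divr_gt0 e0 M0).
exists p; split => // v' /Hp Hv'; rewrite /pairing -sumrB.
apply: (@le_lt_trans _ _ (\sum_j `|a j| * (e / M))).
  rewrite (le_trans (ler_norm_sum _ _ _))// ler_sum// => j _.
  by rewrite -mulrBr normrM ler_wpM2l// ltW.
rewrite -mulr_suml mulrA ltr_pdivrMr// mulrC ltr_pM2l//.
by rewrite /M ltrDl.
Qed.

Context (W : ptopologicalType) (dist : W -> W -> R)
  (dd : nat -> W) (mW : separable_metric dist dd).
Context d (X : measurableType d) (mu : probability X R)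
  (Q : X -> pprobability (borel W) R) (mQ : measurable_fun setT Q).
Context (P : probability (X * borel W)%type R)
  (HP : forall A B, measurable A -> measurable B ->
    (P (A `*` B) = \int[mu]_(x in A) Q x B)%E).
Context (Z : X * borel W -> J -> R)
  (mZ : forall j, measurable_fun setT (fun t => Z t j)).

Let BU p := [set t | rational_box p (Z t)].

Let mBU p : measurable (BU p).
Proof.
rewrite (_ : BU p = \bigcap_(j in [set: J])
    [set t | `|Z t j - ratr (p.1 j)| < p.2.+1%:R^-1]); last first.
  by apply/seteqP; split => t Ht j; [move=> _; exact: Ht|exact: Ht].
apply: fin_bigcap_measurable => // j _.
apply: measurable_set_ltr => //.
by apply: measurableT_comp => //; apply: measurable_funB.
Qed.

(** Above each [x], the points where [Z] leaves its essential range: its value lies in a box that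
    [Q x] does not charge. *)
Let N := \bigcup_p (BU p `&` ([set x | Q x (xsection (BU p) x) = 0%E] `*` setT)).

Let mN : measurable N.
Proof.
apply: countable_bigcupT_measurable => // p; apply: measurableI.
  exact: mBU.
apply: measurableX; last exact: measurableT.
rewrite -[X in measurable X]setTI.
exact: (measurable_kernel_xsection mQ (mBU p) measurableT
  (emeasurable_set1 0%E)).
Qed.

Let Qnull (x : X) (I : countType) (B : I -> set (borel W)) :
  (forall i, measurable (B i)) -> (forall i, Q x (B i) = 0%E) ->
  Q x (\bigcup_i B i) = 0%E.
Proof.
move=> mB B0; apply/(@negligibleP _ _ _ (Q x)).
  exact: countable_bigcupT_measurable.
have := @ae_forall_count _ _ _ (Q x) I (fun i y => ~ B i y).
move=> /(_ (fun i => ae_not_null (mB i) (B0 i))).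
by apply: negligibleS => y [i _ Biy] /= /(_ i); apply.
Qed.

Let QN x : Q x (xsection N x) = 0%E.
Proof.
rewrite (_ : xsection N x = \bigcup_p (xsection (BU p) x `&`
    [set y | Q x (xsection (BU p) x) = 0%E])); last first.
  apply/seteqP; split => [y /xsectionP[p _ [By [/= Q0 _]]]|y [p _ [/xsectionP By Q0]]].
    by exists p => //; split => //; exact/xsectionP.
  by apply/xsectionP; exists p.
apply: Qnull => p.
  apply: measurableI; first by apply: measurable_xsection; exact: mBU.
  have [Q0|nQ0] := pselect (Q x (xsection (BU p) x) = 0%E).
    by rewrite (_ : [set _ | _] = setT)//; apply/seteqP; split.
  by rewrite (_ : [set _ | _] = set0)//; apply/seteqP; split.
have [Q0|nQ0] := pselect (Q x (xsection (BU p) x) = 0%E).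
  by rewrite (_ : [set _ | _] = setT) ?setIT//; apply/seteqP; split.
by rewrite (_ : [set _ | _] = set0) ?setI0 ?measure0//; apply/seteqP; split.
Qed.

(** A box together with the level [k] of an inner approximation with error [1/(k+1)]. *)
Let selector_index := ({ffun J -> rat} * nat * nat)%type.

(* [G] exhausts from inside, up to a null set, the values of [Z] falling in
   each rational box; [N] is discarded so that every selected value is an
   essential value of [Z (x, _)] under [Q x]. *)
Lemma essential_selectors : exists (A : selector_index -> set X)
    (y : selector_index -> X -> borel W),
  [/\ forall i, measurable (A i),
      forall i, measurable_fun setT (y i),
      forall i x, A i x -> topological_support (Q x) (y i x),
      forall i x a, A i x ->
        (\forall y \ae Q x, pairing a (Z (x, y)) = 0) ->
        pairing a (Z (x, y i x)) = 0 &
      \forall x \ae mu, forall a,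
        (forall i, A i x -> 0 <= pairing a (Z (x, y i x))) ->
        \forall y \ae Q x, 0 <= pairing a (Z (x, y))].
Proof.
pose E p := BU p `\` N.
have mE p : measurable (E p) by apply: measurableD; [exact: mBU|exact: mN].
have /choice[G HG] : forall i : selector_index, exists G,
    [/\ measurable G, closed_sections G, G `<=` E i.1 &
      (P (E i.1 `\` G) <= (i.2.+1%:R^-1)%:E)%E].
  by move=> i; apply: (inner_closed_sections mW P (mE i.1)).
have mG i : measurable (G i) by have [] := HG i.
have /choice[y Hy] : forall i : selector_index, exists y : X -> borel W,
    measurable_fun setT y /\ forall x, (0 < Q x (xsection (G i) x))%E ->
      G i (x, y x) /\ topological_support (Q x) (y x).
  move=> i; apply: (closed_sections_selection mW mQ (mG i)).
  by have [] := HG i.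
pose A i := [set x | (0 < Q x (xsection (G i) x))%E].
exists A, y; split.
- move=> i; rewrite -[A i]setTI; apply: emeasurable_fun_o_infty => //.
  exact: measurable_kernel_xsection.
- by move=> i; have [] := Hy i.
- by move=> i x /((Hy i).2 x)[].
- move=> i x a Aix ae0; apply: contrapT => /eqP n0.
  have [Gxy _] := (Hy i).2 x Aix.
  have [_ _ GE _] := HG i; have [_ nN] := GE _ Gxy.
  (* A nonzero pairing stays nonzero on a whole box around the selected value. That box would be
     null by hypothesis, which puts the selected point in [N]. *)
  have [|p [Bp Hp]] := @rational_box_pairing a (Z (x, y i x))
    `|pairing a (Z (x, y i x))|; first by rewrite normr_gt0.
  apply: nN; exists p => //; split => //; split => //=.
  apply/(@negligibleP _ _ _ (Q x)).
    by apply: measurable_xsection; exact: mBU.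
  apply: negligibleS ae0 => z /xsectionP/= /Hp.
  by move=> + /= z0; rewrite z0 sub0r normrN ltxx.
(* The sets [G (p, k)] exhaust [E p] up to a null set of [P], hence of [Q x] for almost every
   [x]. *)
- have EG p : \forall x \ae mu,
      Q x (xsection (E p `\` \bigcup_k G (p, k)) x) = 0%E.
    have mU : measurable (\bigcup_k G (p, k)).
      by apply: bigcup_measurable => k _; exact: mG.
    have mD : measurable (E p `\` \bigcup_k G (p, k)) by exact: measurableD.
    have PD : P (E p `\` \bigcup_k G (p, k)) = 0%E.
      apply/eqP; rewrite eq_le measure_ge0 andbT; apply/lee_addgt0Pr => e e0.
      rewrite add0e; have [k] := ltr_add_invr e0; rewrite add0r => ke.
      apply: (@le_trans _ _ (P (E p `\` G (p, k)))).
        apply: le_measure; rewrite ?inE//; first exact: measurableD.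
        by move=> t [Et nG]; split => // Gt; apply: nG; exists k.
      by have [_ _ _ /le_trans] := HG (p, k); apply; rewrite lee_fin ltW.
    move: PD; rewrite (disintegration_xsection mQ HP mD) => int0.
    have mk := measurable_kernel_xsection mQ mD.
    have [+ _] := ae_eq_integral_abs mu measurableT mk.
    under eq_integral do rewrite gee0_abs//.
    by move=> /(_ int0); apply: filterS => x; apply.
  (* The exceptional set of [x] is fixed before [a]: it only depends on the countably many boxes. *)
  have := ae_forall_count EG; apply: filterS => x EGx a Ha.
  (* No selected value lies in such a box, so none of its inner approximations has mass above [x].
     The half-space where [a] is negative is covered by such boxes. *)
  have null p : (forall v, rational_box p v -> pairing a v < 0) ->
      Q x (xsection (BU p) x) = 0%E.
    move=> Hp.
    have G0 k : Q x (xsection (G (p, k)) x) = 0%E.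
      apply/eqP; rewrite eq_le measure_ge0 andbT leNgt; apply/negP => Gk.
      have [Gxy _] := (Hy (p, k)).2 x Gk.
      have [_ _ GE _] := HG (p, k); have [/= /Hp + _] := GE _ Gxy.
      by rewrite ltNge Ha.
    have mx (F : set (X * borel W)) : measurable F -> measurable (xsection F x).
      by exact: measurable_xsection.
    have nP F : measurable F -> Q x F = 0%E -> (Q x).-negligible F.
      by move=> mF F0; apply/(@negligibleP _ _ _ (Q x)).
    apply/(@negligibleP _ _ _ (Q x)); first by apply: mx; exact: mBU.
    apply: (@negligibleS _ _ _ _ (xsection N x `|`
        (xsection (E p `\` \bigcup_k G (p, k)) x `|`
         \bigcup_k xsection (G (p, k)) x))).
      move=> z /xsectionP Bz; have [Nz|nNz] := pselect (N (x, z)).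
        by left; exact/xsectionP.
      right; have [[k _ Gz]|nGz] := pselect ((\bigcup_k G (p, k)) (x, z)).
        by right; exists k => //; exact/xsectionP.
      by left; apply/xsectionP.
    apply: negligibleU; last apply: negligibleU.
    + by apply: nP; [exact: mx mN|exact: QN].
    + apply: nP; last exact: EGx.
      apply: mx; apply: measurableD => //.
      by apply: bigcup_measurable => k _; exact: mG.
    + apply: nP; first by apply: bigcup_measurable => k _; exact: (mx _ (mG _)).
      by apply: Qnull => k; [exact: (mx _ (mG _))|exact: G0].
  pose good p := forall v, rational_box p v -> pairing a v < 0.
  have ngood p : \forall z \ae Q x, good p -> ~ (xsection (BU p) x) z.
    have [gp|ngp] := pselect (good p); last exact: aeW.
    have := ae_not_null (measurable_xsection x (mBU p)) (null _ gp).
    by apply: filterS.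
  have := ae_forall_count ngood; apply: filterS => z Hz.
  rewrite leNgt; apply/negP => z0.
  have [|p [Bp Hp]] := @rational_box_pairing a (Z (x, z)) (- pairing a (Z (x, z))).
    by rewrite oppr_gt0.
  apply: (Hz p); last exact/xsectionP.
  by move=> v /Hp; rewrite ltr_norml => /andP[_]; rewrite ltrBlDr addNr.
Qed.

End EssentialSelectors.

(** * Fourier-Motzkin elimination over a measurable field *)

Section FourierMotzkin.
Context (R : realType) (J : finType).
Implicit Types (a : option J -> R) (k : J).

Lemma pairing_comb a (v v' : option J -> R) (c c' : R) :
  pairing a (fun o => c * v o + c' * v' o) =
  c * pairing a v + c' * pairing a v'.
Proof.
rewrite /pairing !mulr_sumr -big_split/=; apply: eq_bigr => o _.
by rewrite mulrDr !mulrA ![a o * _]mulrC.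
Qed.

Lemma pairing_option a v :
  pairing a v = a None * v None + \sum_k a (Some k) * v (Some k).
Proof.
rewrite /pairing (bigD1 None)//=; congr (_ + _).
rewrite (reindex_omap Some id) => [|[k|]//].
by apply: eq_bigl => k; rewrite eqxx.
Qed.

(** Eliminated vectors have no coordinate [Some k], so a functional on them is free in that
    coordinate; [l] is what must be found to return to the original vectors. *)
Definition shift a k (l : R) : option J -> R :=
  fun o => a o + (if o == Some k then l else 0).

Lemma pairing_shift a k l v :
  pairing (shift a k l) v = pairing a v + l * v (Some k).
Proof.
rewrite /pairing /shift (bigD1 (Some k))//= [in RHS](bigD1 (Some k))//= eqxx.
rewrite mulrDl addrAC; congr (_ + _ + _); apply: eq_bigr => o /negbTE ->.
by rewrite addr0.
Qed.

(* No linear functional is an arbitrage: the cone spanned by the [z i] is a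
   linear space. *)
Definition noarb (I : Type) (z : I -> option J -> R) : Prop :=
  forall a, (forall i, 0 <= pairing a (z i)) -> forall i, pairing a (z i) = 0.

(* One step of Fourier-Motzkin elimination of the coordinate [Some k]. *)
Definition eliminate (I : Type) k (z : I -> option J -> R)
    (e : I * I + I) : option J -> R :=
  match e with
  | inl (i, j) => fun o =>
      (if (z j (Some k) < 0) && (0 < z i (Some k)) then z i (Some k) else 0)
        * z j o +
      (if (z j (Some k) < 0) && (0 < z i (Some k)) then - z j (Some k) else 0)
        * z i o
  | inr i => fun o =>
      (if z i (Some k) == 0 then 1 else 0) * z i o + 0 * z i o
  end.

Section Elimination.
Context (I : Type) (k : J) (z : I -> option J -> R).
Let t i := z i (Some k).

(** The signs of the coordinates will depend on [x] while the index type must not, so indices with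
    the wrong signs yield the zero vector. The term [0 * z i o] of the [inr] case makes every case a
    combination of two vectors. *)
Lemma eliminate_coord e : eliminate k z e (Some k) = 0.
Proof.
case: e => [[i j]|i] /=; last by case: eqP => [->|_]; rewrite !mul0r ?mulr0 addr0.
by case: ifP => _; rewrite ?mul0r ?addr0// mulNr mulrC subrr.
Qed.

Lemma eliminate_coord0 e k' : (forall i, z i (Some k') = 0) ->
  eliminate k z e (Some k') = 0.
Proof. by move=> z0; case: e => [[i j]|i] /=; rewrite !z0 !mulr0 addr0. Qed.

Lemma pairing_eliminate_inl a i j : t j < 0 -> 0 < t i ->
  pairing a (eliminate k z (inl (i, j))) =
  t i * pairing a (z j) - t j * pairing a (z i).
Proof. by move=> tj ti; rewrite /= pairing_comb -!/(t _) tj ti/= mulNr. Qed.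

Lemma pairing_eliminate_inr a i : t i = 0 ->
  pairing a (eliminate k z (inr i)) = pairing a (z i).
Proof.
by move=> ti; rewrite /= pairing_comb -/(t _) ti eqxx mul1r mul0r addr0.
Qed.

(** A coordinate of constant sign would make plus or minus the coordinate functional an arbitrage,
    unless it vanishes identically. *)
Lemma noarb_signs : noarb z ->
  (forall i, t i = 0) \/ (exists i, 0 < t i) /\ (exists j, t j < 0).
Proof.
move=> na.
have tE l i : pairing (shift (fun=> 0) k l) (z i) = l * t i.
  rewrite pairing_shift (_ : pairing _ _ = 0) ?add0r// /pairing big1// => o _.
  exact: mul0r.
have [[i ti]|/forallNP np] := pselect (exists i, 0 < t i); last first.
  left => i; have := na (shift (fun=> 0) k (- 1)) _ i; rewrite tE mulN1r.
  move=> H; apply/eqP; rewrite -oppr_eq0; apply/eqP/H => j.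
  by rewrite tE mulN1r oppr_ge0 leNgt; apply/negP.
have [[j tj]|/forallNP nn] := pselect (exists j, t j < 0).
  by right; split; [exists i|exists j].
left => j; have := na (shift (fun=> 0) k 1) _ j; rewrite tE mul1r; apply => i'.
by rewrite tE mul1r leNgt; apply/negP.
Qed.

(** Nonnegativity on the eliminated vectors says that each lower bound on [l] imposed by a positive
    coordinate is below each upper bound imposed by a negative one. Some [l] thus makes the shifted
    functional nonnegative on all [z i], hence zero there, and the combinations vanish as well. *)
Lemma noarb_eliminate : noarb z -> noarb (eliminate k z).
Proof.
move=> na a Ha; pose L i := pairing a (z i).
have [l Hl] : exists l, forall i, 0 <= L i + l * t i.
  have [t0|[[i0 ti0] [j0 tj0]]] := noarb_signs na.
    exists 0 => i; rewrite mul0r addr0.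
    by have := Ha (inr i); rewrite pairing_eliminate_inr.
  (* The lower bounds on [l]. The family may be infinite, so [l] is their supremum and not a
     maximum. *)
  pose A := [set r : R | exists2 i, 0 < t i & r = - (L i / t i)].
  have Aub j : t j < 0 -> ubound A (- (L j / t j)).
    move=> tj _ [i ti ->]; rewrite lerN2.
    have := Ha (inl (i, j)); rewrite pairing_eliminate_inl// -/(L _) -/(L _).
    rewrite subr_ge0 => H.
    by rewrite ler_ndivrMr// mulrAC ler_pdivrMr// mulrC [L j * _]mulrC.
  have supA : has_sup A.
    split; first by exists (- (L i0 / t i0)), i0.
    by exists (- (L j0 / t j0)); exact: Aub.
  exists (sup A) => i; have [ti|ti|ti] := ltgtP 0 (t i).
  - have Ai : A (- (L i / t i)) by exists i.
    have := ub_le_sup supA.2 Ai; rewrite -(ler_pM2r ti) mulNr divfK ?gt_eqF//.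
    by rewrite -subr_ge0 opprK addrC.
  - have := ge_sup supA.1 (Aub i ti); rewrite -(ler_nM2r ti) mulNr divfK ?lt_eqF//.
    by rewrite -subr_ge0 opprK addrC.
  - rewrite -ti mulr0 addr0.
    by have := Ha (inr i); rewrite pairing_eliminate_inr.
have := na (shift a k l); have H i : pairing (shift a k l) (z i) = L i + l * t i.
  exact: pairing_shift.
have Hl' i : 0 <= pairing (shift a k l) (z i) by rewrite H.
move=> /(_ Hl') L0.
have {}L0 i : L i = - (l * t i) by apply/eqP; rewrite -addr_eq0 -H L0.
case => [[i j]|i].
  have [/andP[tj ti]|nc] := boolP ((t j < 0) && (0 < t i)).
    by rewrite pairing_eliminate_inl// -!/(L _) !L0; ring.
  by rewrite /= pairing_comb -!/(t _) (negbTE nc) !mul0r addr0.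
have [ti|ti] := eqVneq (t i) 0.
  by rewrite pairing_eliminate_inr// -/(L _) L0 ti mulr0 oppr0.
by rewrite /= pairing_comb -/(t _) (negbTE ti) !mul0r addr0.
Qed.

(** Vanishing on the mixed pairs means that the ratio [L i / t i] is the same for any positive and
    any negative coordinate, hence common to all nonzero ones; its opposite is the missing
    coefficient. *)
Lemma eliminate_back a : noarb z ->
  (forall e, pairing a (eliminate k z e) = 0) ->
  exists l, forall i, pairing (shift a k l) (z i) = 0.
Proof.
move=> na Ha; have [t0|[[i0 ti0] [j0 tj0]]] := noarb_signs na.
  exists 0 => i; rewrite pairing_shift mul0r addr0.
  by have := Ha (inr i); rewrite pairing_eliminate_inr.
pose L i := pairing a (z i).
have LL i j : 0 < t i -> t j < 0 -> t i * L j = t j * L i.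
  by move=> ti tj; have := Ha (inl (i, j)); rewrite pairing_eliminate_inl// =>
    /eqP; rewrite subr_eq0 => /eqP.
exists (- (L i0 / t i0)) => i; rewrite pairing_shift -/(L i) -/(t i).
have ti0n : t i0 != 0 by rewrite gt_eqF.
have tj0n : t j0 != 0 by rewrite lt_eqF.
have [ti|ti|ti] := ltgtP 0 (t i).
- have E1 := LL _ _ ti tj0; have E2 := LL _ _ ti0 tj0.
  have -> : L i = t i * L j0 / t j0 by rewrite E1 mulrAC divff// mul1r.
  have -> : L j0 = t j0 * L i0 / t i0 by rewrite -E2 mulrAC divff// mul1r.
  by field; apply/andP.
- have E := LL _ _ ti0 ti.
  have -> : L i = t i * L i0 / t i0 by rewrite -E mulrAC divff// mul1r.
  by field.
- rewrite -ti mulr0 addr0.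
  by have := Ha (inr i); rewrite pairing_eliminate_inr.
Qed.

End Elimination.

Context d (X : measurableType d) (mu : {measure set X -> \bar R}).
Context (C : (X -> option J -> R) -> Prop).
Hypothesis C_measurable : forall v, C v ->
  forall o, measurable_fun setT (fun x => v x o).
Hypothesis C_comb : forall v v' (c c' : X -> R), C v -> C v' ->
  measurable_fun setT c -> measurable_fun setT c' ->
  (forall x, 0 <= c x) -> (forall x, 0 <= c' x) ->
  C (fun x o => c x * v x o + c' x * v' x o).
Hypothesis C_zero : forall v, C v -> (forall x k, v x (Some k) = 0) ->
  \forall x \ae mu, v x None = 0.

(* Elimination only takes nonnegative combinations of the given vectors with
   measurable coefficients, hence stays in the cone [C] of vector fields; once
   all coordinates [Some k] are gone, [C_zero] applies. *)
Lemma cone_hyperplane (s : seq J) (I : countType)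
    (z : I -> X -> option J -> R) :
  (forall i, C (z i)) -> (forall i x k, k \notin s -> z i x (Some k) = 0) ->
  (\forall x \ae mu, noarb (fun i => z i x)) ->
  \forall x \ae mu, exists2 a, a None = 1 & forall i, pairing a (z i x) = 0.
Proof.
elim: s I z => [|k s IH] I z Cz z0 na.
  (* With every other coordinate gone, the coordinate functional of [None] itself is the required
     [a]. *)
  have H i : \forall x \ae mu, z i x None = 0.
    by apply: C_zero => // x k; exact: z0.
  have := ae_forall_count H; apply: filterS => x zx.
  exists (fun o => if o is None then 1 else 0) => // i.
  by rewrite /pairing big1// => -[k|] _; rewrite ?mul0r// mul1r.
pose z' e x := eliminate k (fun i => z i x) e.
have mt i : measurable_fun setT (fun x => z i x (Some k)) by exact: C_measurable.
have Cz' e : C (z' e).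
  case: e => [[i j]|i]; rewrite /z' /=.
    have mc : measurable_fun setT
        (fun x => (z j x (Some k) < 0) && (0 < z i x (Some k))).
      by apply: measurable_and; apply: measurable_fun_ltr.
    apply: (C_comb (c := fun x => if _ then _ else _)
      (c' := fun x => if _ then _ else _)) => //.
    - exact: measurable_fun_ifT.
    - by apply: measurable_fun_ifT => //; exact: measurable_funN.
    - by move=> x; case: ifP => // /andP[_ /ltW].
    - by move=> x; case: ifP => // /andP[/ltW]; rewrite oppr_ge0.
  apply: (C_comb (c := fun x => if _ then _ else _) (c' := fun=> 0)) => //.
    by apply: measurable_fun_ifT => //; exact: measurable_fun_eqr.
  by move=> x; case: ifP.
have := IH _ z' Cz'.
move=> H; have : \forall x \ae mu, exists2 a, a None = 1 & forall e, pairing a (z' e x) = 0.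
  apply: H; last by apply: filterS na => x; exact: noarb_eliminate.
  move=> e x k' k's; have [->|k'k] := eqVneq k' k; first exact: eliminate_coord.
  by apply: eliminate_coord0 => i; apply: z0; rewrite inE negb_or k'k.
apply: filterS2 na => x nax [a a1 Ha].
have [l Hl] := eliminate_back nax Ha.
by exists (shift a k l) => //; rewrite /shift/= addr0.
Qed.

End FourierMotzkin.

(** * Finite mixtures and integrability *)

Section Mixture.
Context d (T : measurableType d) (R : realType).
Local Open Scope ereal_scope.
Import HBNNSimple.

Fixpoint mixture (c : nat -> {nonneg R}) (m : nat -> probability T R) n :
    {measure set T -> \bar R} :=
  match n with
  | 0%N => mzero
  | k.+1 => measure_add (mscale (c k) (m k)) (mixture c m k)
  end.

Lemma mixtureE c m n A :
  mixture c m n A = \sum_(i < n) (c i)%:num%:E * m i A.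
Proof.
elim: n => [|n IH]; first by rewrite big_ord0.
by rewrite big_ord_recr /= -IH addeC; exact: measure_addE.
Qed.

Lemma integrable_mscale (c : {nonneg R}) (m : {measure set T -> \bar R}) g :
  m.-integrable setT g -> (mscale c m).-integrable setT g /\
  \int[mscale c m]_x g x = c%:num%:E * \int[m]_x g x.
Proof.
move=> ig; have mg := measurable_int _ ig; split.
  have /integrableP[_ gfin] := ig; apply/integrableP; split => //.
  rewrite ge0_integral_mscale//; last exact: measurableT_comp.
  by rewrite lte_mul_pinfty.
have gp : \int[m]_x g^\+ x \is a fin_num.
  by apply: integrable_fin_num => //; exact: integrable_funepos.
have gn : \int[m]_x g^\- x \is a fin_num.
  by apply: integrable_fin_num => //; exact: integrable_funeneg.
rewrite [LHS]integralE.
rewrite (ge0_integral_mscale m measurableT c (measurable_funepos mg))//.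
rewrite (ge0_integral_mscale m measurableT c (measurable_funeneg mg))//.
by rewrite [in RHS]integralE -(fineK gp) -(fineK gn) -EFinB -!EFinM mulrBr.
Qed.

Lemma integrable_mixture c (m : nat -> probability T R) n (g : T -> \bar R) : measurable_fun setT g ->
  (forall i, (i < n)%N -> (m i).-integrable setT g) ->
  (mixture c m n).-integrable setT g /\
  \int[mixture c m n]_x g x = \sum_(i < n) (c i)%:num%:E * \int[m i]_x g x.
Proof.
move=> mg; elim: n => [|n IH] Hn.
  rewrite big_ord0 /= integral_measure_zero; split => //.
  by apply/integrableP; split => //; rewrite integral_measure_zero ltry.
have [|il El] := IH; first by move=> i /ltnW; exact: Hn.
have [ic Ec] := integrable_mscale (c n) (Hn n (ltnSn n)).
rewrite big_ord_recr /= integral_measure_add// Ec El addeC; split => //.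
apply/integrableP; split => //.
rewrite ge0_integral_measure_add//; last exact: measurableT_comp.
have /integrableP[_ fl] := il; have /integrableP[_ fc] := ic.
exact: lte_add_pinfty.
Qed.

Lemma finite_mixture (n : nat) (p : 'I_n -> R) (m : 'I_n -> probability T R) :
  (forall i, 0 <= p i)%R -> (\sum_i p i = 1)%R ->
  exists nu : probability T R, (forall A, nu A = \sum_i (p i)%:E * m i A) /\
    forall g, measurable_fun setT g -> (forall i, (m i).-integrable setT g) ->
      nu.-integrable setT g /\
      \int[nu]_x g x = \sum_i (p i)%:E * \int[m i]_x g x.
Proof.
move=> p0 p1.
pose c k : {nonneg R} := if insub k is Some i then NngNum (p0 i) else NngNum (lexx (0%R : R)).
pose m' k : probability T R := if insub k is Some i then m i else dirac point.
have cE (i : 'I_n) : (c i)%:num = p i by rewrite /c valK.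
have mE (i : 'I_n) : m' i = m i by rewrite /m' valK.
have lE A : mixture c m' n A = \sum_i (p i)%:E * m i A.
  by rewrite mixtureE; apply: eq_bigr => i _; rewrite cE mE.
have lT : mixture c m' n setT = 1.
  rewrite lE; under eq_bigr do rewrite probability_setT mule1.
  by rewrite sumEFin p1.
(* The total mass is already 1: normalizing only packages the mixture as a probability. *)
pose nu : probability T R := mnormalize (mixture c m' n) (dirac point).
have nuE A : nu A = mixture c m' n A.
  by rewrite /nu/= /mnormalize lT onee_eq0/= invr1 mule1.
exists nu; split => [A|g mg ig]; first by rewrite nuE lE.
have E (h : T -> \bar R) : \int[nu]_x h x = \int[mixture c m' n]_x h x.
  by apply: eq_measure_integral => A _ _; exact: nuE.
have [|il El] := @integrable_mixture c m' n g mg.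
  by move=> i il; rewrite (mE (Ordinal il)).
split; last first.
  by rewrite E El; apply: eq_bigr => i _; rewrite cE mE.
have /integrableP[_ gfin] := il; apply/integrableP; split => //.
by rewrite E.
Qed.

Lemma integrable_lincomb (I : Type) (s : seq I) (m : probability T R)
    (a r : I -> R) (F : I -> T -> R) :
  (forall i, m.-integrable setT (fun x => (F i x)%:E) /\
    \int[m]_x (F i x)%:E = (r i)%:E) ->
  m.-integrable setT (fun x => (\sum_(i <- s) a i * F i x)%:E) /\
  \int[m]_x (\sum_(i <- s) a i * F i x)%:E = (\sum_(i <- s) a i * r i)%:E.
Proof.
move=> H; elim: s => [|i s [IH1 IH2]].
  under eq_fun do rewrite big_nil.
  by rewrite big_nil; split; [exact: integrable0|rewrite integral0].
have [Hi Ei] := H i.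
have iF : m.-integrable setT (fun x => (a i)%:E * (F i x)%:E).
  exact: integrableZl.
under eq_fun do rewrite big_cons EFinD EFinM.
split; first exact: integrableD.
by rewrite integralD// IH2 integralZl// Ei big_cons EFinD EFinM.
Qed.

(** A difference of infinite parts is [-oo] by convention, so a finite integral forces both parts to
    be finite. This extracts integrability from conditions that only state the value of a mean. *)
Lemma integral_fin_integrable (m : {measure set T -> \bar R}) (f : T -> R) r :
  measurable_fun setT f -> \int[m]_x (f x)%:E = r%:E ->
  m.-integrable setT (EFin \o f).
Proof.
move=> mf; have mf' : measurable_fun setT (EFin \o f) by exact/measurable_EFinP.
have ip : 0 <= \int[m]_x (EFin \o f)^\+ x by exact: integral_ge0.
have inn : 0 <= \int[m]_x (EFin \o f)^\- x by exact: integral_ge0.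
rewrite integralE => E.
have [pfin nfin] : \int[m]_x (EFin \o f)^\+ x < +oo /\
    \int[m]_x (EFin \o f)^\- x < +oo.
  move: ip inn E; rewrite -/(EFin \o f).
  case: (\int[m]_x (EFin \o f)^\+ x) => [p||]//;
  case: (\int[m]_x (EFin \o f)^\- x) => [q||]//= _ _ _.
  by split; exact: ltry.
rewrite (funeposneg (EFin \o f)).
apply: integrableB => //; apply/integrableP; split.
- exact: measurable_funepos.
- by under eq_integral do rewrite gee0_abs//.
- exact: measurable_funeneg.
- by under eq_integral do rewrite gee0_abs//.
Qed.

Lemma ae_dominated (m1 m2 : {measure set T -> \bar R}) (p : T -> Prop) :
  m1 `<< m2 -> (\forall x \ae m2, p x) -> \forall x \ae m1, p x.
Proof.
move=> m12 [N [mN N0 pN]]; exists N; split => //.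
by apply/(measure0_null_setP m1 mN)/m12/measure0_null_setP.
Qed.

Lemma integrable_dirac (a : T) (g : T -> R) : measurable_fun setT g ->
  (\d_a : {measure set T -> \bar R}).-integrable setT (EFin \o g) /\
  \int[\d_a]_x (g x)%:E = (g a)%:E.
Proof.
move=> mg; have mg' : measurable_fun setT (EFin \o g) by exact/measurable_EFinP.
split; last by rewrite integral_dirac// diracT mul1e.
apply/integrableP; split => //; rewrite integral_dirac//.
  by rewrite diracT mul1e /= ltry.
exact: measurableT_comp.
Qed.

Lemma measurable_pprobability d' (X : measurableType d')
    (Q : X -> pprobability T R) :
  (forall U, measurable U -> measurable_fun setT (fun x => Q x U)) ->
  measurable_fun setT Q.
Proof.
move=> H; apply: (measurability (@pset _ _ _ : set (set (pprobability T R)))) => //.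
move=> _ -[_ [r r01] [U mU <-]] <-.
rewrite setTI; have := emeasurable_fun_infty_o measurableT (H U mU) r%:E.
by rewrite setTI.
Qed.

Lemma integral_probability_cst (m : probability T R) (r : R) :
  \int[m]_x r%:E = r%:E.
Proof. by have := expectation_cst m r; rewrite unlock. Qed.

Lemma measurable_universally d' (X : measurableType d') d2
    (U : measurableType d2) (f : X -> U) :
  measurable_fun setT f -> universally_measurable R f.
Proof.
move=> mf mu B mB; exists (f @^-1` B).
  by rewrite -[X in measurable X]setTI; exact: mf.
by rewrite setYK; exact: negligible_set0.
Qed.

End Mixture.

Lemma continuous_measurable_borel (R : realType) (T : ptopologicalType)
    (c : T -> R) : continuous c -> measurable_fun setT (c : borel T -> R).
Proof.
move=> cc; apply: (measurability _ (RGenOInfty.measurableE R)).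
move=> _ [_ [x ->] <-]; rewrite setTI; apply: sub_sigma_algebra.
by apply: open_comp => // y _; exact: cc.
Qed.

Lemma measurable_coord (R : realType) n d (X : measurableType d)
    (v : X -> borel 'cV[R]_n.+1) (k : 'I_n.+1) : measurable_fun setT v ->
  measurable_fun setT (fun x => v x k 0).
Proof.
move=> mv; have mc : measurable_fun setT
    ((fun a : 'cV[R]_n.+1 => a k 0) : borel 'cV[R]_n.+1 -> R).
  by apply: continuous_measurable_borel; exact: coord_continuous.
exact: measurableT_comp mc mv.
Qed.

Lemma integrable_same_law (R : realType) (W : ptopologicalType)
    (Q Q' : pprobability (borel W) R) (g : borel W -> \bar R) :
  same_law Q Q' -> Q'.-integrable setT g ->
  Q.-integrable setT g /\ (\int[Q]_y g y = \int[Q']_y g y)%E.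
Proof.
move=> QQ' ig; have E (h : borel W -> \bar R) : (\int[Q]_y h y = \int[Q']_y h y)%E.
  by apply: eq_measure_integral => A mA _; exact: QQ'.
split => //; have /integrableP[mg gfin] := ig.
by apply/integrableP; split => //; rewrite E.
Qed.

Lemma ae_integrable_eq d (T : measurableType d) (R : realType)
    (mu : {measure set T -> \bar R}) (f g : T -> \bar R) :
  measurable_fun setT g -> mu.-integrable setT f ->
  (\forall x \ae mu, f x = g x) ->
  mu.-integrable setT g /\ (\int[mu]_x g x = \int[mu]_x f x)%E.
Proof.
move=> mg intf fg; have mf := measurable_int _ intf.
split; last first.
  by apply: ae_eq_integral => //; apply: filterS fg => x ->.
have /integrableP[_ ffin] := intf; apply/integrableP; split => //.
rewrite (ae_eq_integral (fun x => `|f x|%E))//.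
- exact: measurableT_comp.
- exact: measurableT_comp.
- by apply: filterS fg => x ->.
Qed.

(** * Localization and expectations of scores under other laws *)

Section FrameworkLemmas.
Context (R : realType) (F : framework R) (L : local_model F)
  (S : min_linear F).
Hypothesis framework_ok : framework_conditions F.
Hypothesis standing_ok : standing_conditions L.
Hypothesis min_linear_ok : min_linear_conditions S L.
Local Notation law := (probability (borel (Xsp F) * borel (Wsp F))%type R).
Local Notation BX := (borel (Xsp F)).
Local Notation BW := (borel (Wsp F)).
Implicit Types (P : law) (A B : set BX).

Lemma marginalE P B : marginal P B = P (B `*` setT).
Proof.
rewrite /marginal /distribution /pushforward/=; congr (P _).
by apply/seteqP; split => [[x y]|[x y] []].
Qed.

Lemma is_law_of_marginal mu (Q : BX -> pprobability BW R) P B :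
  is_law_of mu Q P -> measurable B -> marginal P B = mu B.
Proof.
move=> HP mB; rewrite marginalE HP//.
under eq_integral do rewrite probability_setT.
by rewrite integral_cst// mul1e.
Qed.

Lemma ae_eq_marginal P P' (p : BX -> Prop) :
  (forall B, measurable B -> marginal P B = marginal P' B) ->
  (\forall x \ae marginal P', p x) -> \forall x \ae marginal P, p x.
Proof. by move=> PP' [N [mN N0 pN]]; exists N; split => //; rewrite PP'. Qed.

Lemma ae_marginal_fst P (p : BX -> Prop) :
  (\forall x \ae marginal P, p x) -> \forall t \ae P, p t.1.
Proof.
move=> [N [mN N0 pN]]; exists (N `*` setT); split.
- exact: measurableX.
- by rewrite -marginalE.
- by move=> [x y] /= npx; split => //; exact: pN.
Qed.

Lemma ae_nontrivial d (T : measurableType d) (mu : probability T R) (p : Prop) :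
  (\forall x \ae mu, p) -> p.
Proof.
move=> [N [mN N0 pN]]; apply: contrapT => np.
have NT : N = setT by apply/seteqP; split => // x _; exact: pN.
by move: N0; rewrite NT probability_setT => /eqP; rewrite onee_eq0.
Qed.

Lemma eta_measurableT P : laws P -> measurable_fun setT (eta P).
Proof.
move=> lP; apply: (@measurability _ _ _ (pborel (@Nsp R F)) setT (eta P)
  (@cylinders _ (@Nsp R F))) => // _ [_ [j [B [mB ->]]] <-].
have := eta_measurable framework_ok lP (j := j) measurableT mB.
by rewrite !setTI.
Qed.

Lemma score_at_measurable (f : score_space F -> R) n k w :
  measurable_fun setT f -> measurable_fun setT n -> measurable_fun setT k ->
  measurable_fun setT w -> measurable_fun setT (score_at f n k w).
Proof.
move=> mf mn mk mw; apply: measurableT_comp => //.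
apply: measurable_fun_pair; last exact: measurableT_comp.
apply: measurable_fun_pair; last exact: measurableT_comp.
apply: measurable_fun_pair; last exact: measurableT_comp.
exact: measurable_fun_pair.
Qed.

Lemma score_measurable (f : score_space F -> R) P w :
  laws P -> FB f -> measurable_fun setT w -> measurable_fun setT (score f P w).
Proof.
move=> lP [mf _] mw; apply: score_at_measurable => //.
  exact: eta_measurableT.
exact: kappa_measurable.
Qed.

(** A law supplied by the model conditions is known only through its masses on rectangles; its
    prescribed kernel has to be matched with the chosen version [condlaw]. *)
Lemma condlaw_unique P (mu : probability BX R) Q : laws P ->
  (forall B, measurable B -> marginal P B = mu B) ->
  is_law_of mu Q P -> \forall x \ae mu, same_law (Q x) (condlaw P x).
Proof.
move=> lP Pmu HQ.
have [dist [dd mW]] := polish_separable_metric (Wsp_polish framework_ok).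
apply: (kernel_ae_unique mW); first exact: condlaw_measurable.
move=> A B mA mB; rewrite -HQ// (condlawP framework_ok lP)//.
by apply: eq_measure_integral => C mC _; exact: Pmu.
Qed.

Lemma localize P A : laws P -> measurable A -> (0 < marginal P A)%E ->
  exists P', laws P' /\
    [/\ is_law_of (marginal P') (condlaw P) P',
      \forall x \ae marginal P', A x,
      forall p : BX -> Prop, (\forall x \ae marginal P, p x) ->
        \forall x \ae marginal P', p x,
      \forall x \ae marginal P', eta P' x = eta P x &
      \forall x \ae marginal P', kappa P' x = kappa P x].
Proof.
move=> lP mA A0.
have [P' lP' [PA HP' etaE kappaE]] := localization standing_ok lP mA A0.
have null0 B : measurable B -> marginal P (B `&` A) = 0%E -> marginal P' B = 0%E.
  move=> mB BA0; have := PA B mB; rewrite BA0 => /eqP.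
  by rewrite mule_eq0 gt_eqF//= => /eqP.
have aeA : \forall x \ae marginal P', A x.
  exists (~` A); split => //; first exact: measurableC.
  by apply: null0; [exact: measurableC|rewrite setICl measure0].
have aeP p : (\forall x \ae marginal P, p x) -> \forall x \ae marginal P', p x.
  move=> [N [mN N0 pN]]; exists N; split => //; apply: null0 => //.
  by apply/eqP; rewrite eq_le measure_ge0 andbT -N0 le_measure// ?inE//;
    exact: measurableI.
exists P'; split => //; split => //.
- by have := aeP _ etaE; apply: filterS2 aeA => x Ax; apply.
- by have := aeP _ kappaE; apply: filterS2 aeA => x Ax; apply.
Qed.

(** [Hjo] reads the mean vector off the component [jo]. The law [m] is any one whose marginal
    inherits the null sets of both marginals. *)
Lemma u_of_eta P P' (m : law) : laws P -> laws P' ->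
  (forall p : BX -> Prop, (\forall x \ae marginal P, p x) ->
     \forall x \ae marginal m, p x) ->
  (forall p : BX -> Prop, (\forall x \ae marginal P', p x) ->
     \forall x \ae marginal m, p x) ->
  (\forall x \ae marginal m, eta P' x (jo S) = eta P x (jo S)) ->
  \forall x \ae marginal m, u P' x = u P x.
Proof.
move=> lP lP' aeP aeP' E.
have H1 := aeP _ (Hjo_eta min_linear_ok lP).
have H2 := aeP' _ (Hjo_eta min_linear_ok lP').
by apply: filterS3 E H1 H2 => x E <- <-; rewrite E.
Qed.

(** [FB] is used with [P'] as the sampling law and [P] as the source of the nuisance values; they
    may differ in the one component [jo]. *)
Lemma cross_expectation f w P P' : FB f -> measurable_fun setT w ->
  laws P -> laws P' ->
  (forall l, l != jo S -> \forall x \ae marginal P', eta P' x l = eta P x l) ->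
  (\forall x \ae marginal P', kappa P' x = kappa P x) ->
  P'.-integrable setT (EFin \o score f P w) /\
  (\int[P']_t (score f P w t)%:E = \int[marginal P']_x (psi (x, u P' x))%:E)%E.
Proof.
move=> fFB mw lP lP' etaE kappaE.
have [_ /(_ P' P w lP' lP mw)[]] := fFB.
  exists (jo S) => l ljo; have := etaE l ljo.
  by apply: filterS => x ->.
move=> int E.
have aeE : \forall t \ae P', (EFin \o score_at f (eta P) (kappa P') w) t =
    (EFin \o score f P w) t.
  have /ae_marginal_fst := kappaE; apply: filterS => t.
  by rewrite /= /score /score_at => ->.
have mg : measurable_fun setT (EFin \o score f P w).
  by apply/measurable_EFinP; exact: score_measurable.
have [intg Eg] := ae_integrable_eq mg int aeE; split => //.
by rewrite Eg; move: E; rewrite /Psi unlock.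
Qed.

(** Localizing to the set where one function is strictly below the other would make the integrals
    differ; [main] is one half, the other is symmetric. *)
Lemma localized_eq P (f1 f2 : BX -> \bar R) : laws P ->
  measurable_fun setT f1 -> measurable_fun setT f2 ->
  (forall P', laws P' -> is_law_of (marginal P') (condlaw P) P' ->
    (forall p : BX -> Prop, (\forall x \ae marginal P, p x) ->
        \forall x \ae marginal P', p x) ->
    (\forall x \ae marginal P', eta P' x = eta P x) ->
    (\forall x \ae marginal P', kappa P' x = kappa P x) ->
    [/\ (marginal P').-integrable setT f1, (marginal P').-integrable setT f2 &
      (\int[marginal P']_x f1 x = \int[marginal P']_x f2 x)%E]) ->
  \forall x \ae marginal P, f1 x = f2 x.
Proof.
move=> lP mf1 mf2 H.
have main (g1 g2 : BX -> \bar R) : measurable_fun setT g1 ->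
    measurable_fun setT g2 ->
    (forall P', laws P' -> is_law_of (marginal P') (condlaw P) P' ->
    (forall p : BX -> Prop, (\forall x \ae marginal P, p x) ->
        \forall x \ae marginal P', p x) ->
    (\forall x \ae marginal P', eta P' x = eta P x) ->
    (\forall x \ae marginal P', kappa P' x = kappa P x) ->
    [/\ (marginal P').-integrable setT g1, (marginal P').-integrable setT g2 &
      (\int[marginal P']_x g1 x = \int[marginal P']_x g2 x)%E]) ->
    \forall x \ae marginal P, (g2 x <= g1 x)%E.
  move=> mg1 mg2 Hg; pose D := [set x | (g1 x < g2 x)%E].
  have mD : measurable D.
    by rewrite -[D]setTI; exact: emeasurable_fun_lt.
  have [D0|Dn0] := eqVneq (marginal P D) 0%E.
    have := ae_not_null mD D0; apply: filterS => x /negP.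
    by rewrite /= -leNgt.
  have [|P' [lP' [HP' aeD aeP etaE kappaE]]] := localize lP mD.
    by rewrite lt0e Dn0 measure_ge0.
  have [i1 i2 E12] := Hg _ lP' HP' aeP etaE kappaE.
  have ae12 : \forall x \ae marginal P', g1 x = g2 x.
    apply: ae_eq_le_integral => //; last by rewrite E12.
    by apply: filterS aeD => x /ltW.
  suff [] : False by [].
  apply: (@ae_nontrivial _ _ (marginal P')).
  by apply: filterS2 aeD ae12 => x; rewrite /D/= => + E; rewrite E ltxx.
have le1 := main _ _ mf1 mf2 H.
have le2 : \forall x \ae marginal P, (f1 x <= f2 x)%E.
  apply: main => // P' l1 l2 l3 l4 l5.
  by have [? ? ?] := H _ l1 l2 l3 l4 l5; split.
by apply: filterS2 le1 le2 => x l1 l2; apply/eqP; rewrite eq_le l1 l2.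
Qed.

(** Every localization of [P'] keeps its kernel and nuisances, so [cross_expectation] applies to all
    of them and the identity of means localizes to an identity at almost every [x]. *)
Lemma cross_cond_expectation f w P P' : FB f -> measurable_fun setT w ->
  laws P -> laws P' ->
  (forall l, l != jo S -> \forall x \ae marginal P', eta P' x l = eta P x l) ->
  (\forall x \ae marginal P', kappa P' x = kappa P x) ->
  \forall x \ae marginal P',
    (condlaw P' x).-integrable setT (fun y => (score f P w (x, y))%:E) /\
    (\int[condlaw P' x]_y (score f P w (x, y))%:E = (psi (x, u P' x))%:E)%E.
Proof.
move=> fFB mw lP lP' etaE kappaE.
have mQ' := condlaw_measurable framework_ok lP'.
have HP' := condlawP framework_ok lP'.
have [intg _] := cross_expectation fFB mw lP lP' etaE kappaE.
have [mF _ _] := disintegration_integral mQ' HP' intg.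
have mpsi : measurable_fun setT (fun x => (psi (x, u P' x))%:E).
  exact: measurable_int (psi_u_integrable framework_ok lP').
have eqF : \forall x \ae marginal P',
    (\int[condlaw P' x]_y (score f P w (x, y))%:E = (psi (x, u P' x))%:E)%E.
  apply: localized_eq => // P'' lP'' HP'' aeP etaE'' kappaE''.
  have [||intg'' Eg''] := @cross_expectation f w P P'' fFB mw lP lP''.
  - move=> l ljo; have := aeP _ (etaE l ljo).
    by apply: filterS2 etaE'' => x ->.
  - by have := aeP _ kappaE; apply: filterS2 kappaE'' => x ->.
  have [_ intF EF] := disintegration_integral mQ' HP'' intg''.
  have uE : \forall x \ae marginal P'', u P'' x = u P' x.
    apply: (u_of_eta lP' lP'' aeP) => //.
    by apply: filterS etaE'' => x ->.
  have [] := @ae_integrable_eq _ _ _ (marginal P'') _ (fun x => (psi (x, u P' x))%:E)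
    mpsi (psi_u_integrable framework_ok lP'').
    by apply: filterS uE => x /= ->.
  move=> intpsi Epsi; split => //.
  by rewrite -EF Eg'' Epsi.
by apply: filterS2 (disintegration_integrable mQ' HP' intg) eqF.
Qed.

Lemma defined_law_expectation f w P Q
    (e : BX -> borel (@Nsp R F (jo S))) : FB f -> measurable_fun setT w ->
  laws P -> defines_law P Q e ->
  \forall x \ae marginal P,
    (Q x).-integrable setT (fun y => (score f P w (x, y))%:E) /\
    (\int[Q x]_y (score f P w (x, y))%:E = (psi (x, Hjo (e x)))%:E)%E.
Proof.
move=> fFB mw lP [P' lP' [HP' eE etaE kappaE]].
have mPP' B : measurable B -> marginal P' B = marginal P B.
  by move=> mB; exact: is_law_of_marginal HP' mB.
have mP'P B : measurable B -> marginal P B = marginal P' B.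
  by move=> mB; rewrite mPP'.
have H : \forall x \ae marginal P,
    (condlaw P' x).-integrable setT (fun y => (score f P w (x, y))%:E) /\
    (\int[condlaw P' x]_y (score f P w (x, y))%:E = (psi (x, u P' x))%:E)%E.
  apply: (ae_eq_marginal mP'P); apply: cross_cond_expectation => //.
  - by move=> l ljo; apply: (ae_eq_marginal mPP'); exact: etaE.
  - exact: (ae_eq_marginal mPP').
have HQ := condlaw_unique lP' mPP' HP'.
have Hu : \forall x \ae marginal P, Hjo (eta P' x (jo S)) = u P' x.
  exact: (ae_eq_marginal mP'P) (Hjo_eta min_linear_ok lP').
apply: filterS2 (filterI H HQ) (filterI eE Hu) => x [[int E] sQ] [eE' uE].
by have [? ->] := integrable_same_law sQ int; split; rewrite // E -uE eE'.
Qed.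

(** When the cost is not integrable, the truncated selections at all integer levels define laws.
    Each [x] has finite cost, so some level leaves its kernel value untouched, and countably many
    levels cost one null set. *)
Lemma selection_expectation f w P Q
    (e : BX -> borel (@Nsp R F (jo S))) : FB f -> measurable_fun setT w ->
  laws P -> selection_requirement L P Q e ->
  \forall x \ae marginal P,
    (Q x).-integrable setT (fun y => (score f P w (x, y))%:E) /\
    (\int[Q x]_y (score f P w (x, y))%:E = (psi (x, Hjo (e x)))%:E)%E.
Proof.
move=> fFB mw lP [Hfin Hinf].
have [|] := ltP (integrated_cost L P Q) +oo%E.
  by move=> /Hfin; exact: defined_law_expectation.
rewrite leye_eq => /eqP /Hinf HM.
have := ae_foralln (fun n => defined_law_expectation fFB mw lP (HM n%:R)).
apply: filterS => x /(_ (Num.truncn (cost L (x, Q x))).+1).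
by rewrite (ltW (truncnS_gt _)).
Qed.

End FrameworkLemmas.

Lemma half_mixture d (T : measurableType d) (R : realType)
    (m1 m2 : probability T R) :
  exists q : probability T R,
    (forall A, q A = (2^-1)%:E * m1 A + (2^-1)%:E * m2 A)%E /\
    forall g, m1.-integrable setT g -> m2.-integrable setT g ->
      q.-integrable setT g /\
      (\int[q]_x g x = (2^-1)%:E * \int[m1]_x g x + (2^-1)%:E * \int[m2]_x g x)%E.
Proof.
have [||q [qA qg]] := @finite_mixture _ T R 2 (fun=> 2^-1)
  (fun i => if i == ord0 then m1 else m2).
- by [].
- by rewrite sumr_const card_ord -[RHS](@mulfV R 2)// mulr_natl.
exists q; split => [A|g i1 i2].
  by rewrite qA !big_ord_recl big_ord0 addr0.
have [] := qg g (measurable_int _ i1) (fun i => if i == ord0 as b return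
  ((if b then m1 else m2).-integrable setT g) then i1 else i2).
by rewrite !big_ord_recl big_ord0 addr0.
Qed.

Lemma weighted_sum_sub (R : realType) n (p g : 'I_n -> R) (c : R) :
  \sum_i p i = 1 -> \sum_i p i * (g i - c) = \sum_i p i * g i - c.
Proof.
move=> p1; under eq_bigr do rewrite mulrBr.
by rewrite sumrB -mulr_suml p1 mul1r.
Qed.

(** * Scores are affine in [h] *)

Section Affine.
Context (R : realType) (F : framework R) (L : local_model F)
  (S : min_linear F).
Hypothesis framework_ok : framework_conditions F.
Hypothesis standing_ok : standing_conditions L.
Hypothesis min_linear_ok : min_linear_conditions S L.
Hypothesis cov1 : COV1 L S.
Local Notation law := (probability (borel (Xsp F) * borel (Wsp F))%type R).
Local Notation BX := (borel (Xsp F)).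
Local Notation BW := (borel (Wsp F)).
Context (P : law) (lP : laws P).

Lemma h_moments : \forall x \ae marginal P, forall k,
  [/\ (condlaw P x).-integrable setT (fun y => (h S k (x, y))%:E),
      (condlaw P x).-integrable setT (fun y => (h S k (x, y) ^+ 2)%:E) &
      (\int[condlaw P x]_y (h S k (x, y))%:E = (u P x k 0)%:E)%E].
Proof.
have := u_mean min_linear_ok lP; have := h_square_integrable min_linear_ok lP.
apply: filterS2 => x h2 hm k; split; [|exact: h2|]; last first.
  by have := hm k; rewrite unlock.
have mh : measurable_fun setT (fun y => h S k (x, y)).
  exact: measurable_fun_pair2 (h_measurable min_linear_ok k).
(* Under a probability, second moments control first ones through [r <= 1 + r ^ 2]. *)
apply: (@le_integrable _ _ _ (condlaw P x) _ measurableT _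
  (fun y => 1 + (h S k (x, y) ^+ 2)%:E)%E).
- exact/measurable_EFinP.
- move=> y _; rewrite -EFinD/= lee_fin [leRHS]ger0_norm ?addr_ge0 ?sqr_ge0//.
  rewrite -real_normK ?num_real//; set r := `|_|.
  have : 0 <= (r - 1) ^+ 2 by exact: sqr_ge0.
  have : 0 <= r by exact: normr_ge0.
  by nra.
- apply: integrableD => //; last exact: h2.
  exact: finite_measure_integrable_cst.
Qed.

Context (f : score_space F -> R) (fFB : FB f).
Context (w : BX -> borel (Auxsp F)) (mw : measurable_fun setT w).

(** The index [None] adjoins the score to the coordinates of [h]. A functional with coefficient 1 at
    [None] that vanishes on this vector almost surely is an affine formula for the score. *)
Definition centered (t : BX * BW) (o : option 'I_(nK F).+1) : R :=
  match o with
  | Some k => h S k t - u P t.1 k 0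
  | None => score f P w t - psi (t.1, u P t.1)
  end.

Lemma measurable_centered o : measurable_fun setT (fun t => centered t o).
Proof.
case: o => [k|] /=.
  apply: measurable_funB; first exact: h_measurable min_linear_ok _.
  have mu := u_measurable framework_ok lP.
  exact: measurableT_comp (measurable_coord k mu) _.
apply: measurable_funB; first exact: (score_measurable framework_ok).
apply: (measurableT_comp (psi_measurable framework_ok)).
apply: measurable_fun_pair => //.
exact: measurableT_comp (u_measurable framework_ok lP) _.
Qed.

Lemma cross_self : \forall x \ae marginal P,
    (condlaw P x).-integrable setT (fun y => (score f P w (x, y))%:E) /\
    (\int[condlaw P x]_y (score f P w (x, y))%:E = (psi (x, u P x))%:E)%E.
Proof.
apply: (cross_cond_expectation framework_ok standing_ok min_linear_ok) => //.
  by move=> l _; exact: aeW.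
exact: aeW.
Qed.

Lemma centered_mean : \forall x \ae marginal P, forall a,
  (condlaw P x).-integrable setT (fun y => (pairing a (centered (x, y)))%:E) /\
  (\int[condlaw P x]_y (pairing a (centered (x, y)))%:E = 0)%E.
Proof.
apply: filterS2 h_moments cross_self => x hm [ig Eg] a.
have H o : (condlaw P x).-integrable setT (fun y => (centered (x, y) o)%:E) /\
    (\int[condlaw P x]_y (centered (x, y) o)%:E = 0)%E.
  case: o => [k|] /=.
    have [ih _ Eh] := hm k; under eq_fun do rewrite EFinB.
    have ic := finite_measure_integrable_cst (condlaw P x) (u P x k 0) measurableT.
    split; first exact: integrableB.
    by rewrite integralB// Eh (integral_probability_cst (condlaw P x)) subee.
  under eq_fun do rewrite EFinB.
  have ic := finite_measure_integrable_cst (condlaw P x) (psi (x, u P x)) measurableT.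
  split; first exact: integrableB.
  by rewrite integralB// Eg (integral_probability_cst (condlaw P x)) subee.
have [iS ES] := integrable_lincomb (index_enum _) a (r := fun=> 0) H.
by split => //; rewrite ES big1// => o _; rewrite mulr0.
Qed.

(** Support membership is asked only where the coefficient is positive: a selector is meaningful
    only on its own set [A i], and coefficients vanish elsewhere. *)
Definition support_cone (v : BX -> option 'I_(nK F).+1 -> R) : Prop :=
  exists n (c : 'I_n -> BX -> R) (y : 'I_n -> BX -> BW),
  [/\ forall i, measurable_fun setT (c i), forall i x, 0 <= c i x,
      forall i, measurable_fun setT (y i),
      forall i x, 0 < c i x -> topological_support (condlaw P x) (y i x) &
      v = fun x o => \sum_i c i x * centered (x, y i x) o].

Lemma support_cone_measurable v : support_cone v ->
  forall o, measurable_fun setT (fun x => v x o).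
Proof.
move=> [n [c [y [mc _ my _ ->]]]] o.
apply: measurable_sum => i; apply: measurable_funM => //.
apply: (measurableT_comp (measurable_centered o)).
exact: measurable_fun_pair.
Qed.

Lemma support_cone_comb v v' (a a' : BX -> R) :
  support_cone v -> support_cone v' ->
  measurable_fun setT a -> measurable_fun setT a' ->
  (forall x, 0 <= a x) -> (forall x, 0 <= a' x) ->
  support_cone (fun x o => a x * v x o + a' x * v' x o).
Proof.
move=> [n [c [y [mc c0 my sy ->]]]] [n' [c' [y' [mc' c'0 my' sy' ->]]]]
  ma ma' a0 a'0.
exists (n + n')%N.
exists (fun i x => match fintype.split i with inl j => a x * c j x
                                    | inr j => a' x * c' j x end).
exists (fun i => match fintype.split i with inl j => y j | inr j => y' j end).
split.
- by move=> i; case: (fintype.split i) => j; exact: measurable_funM.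
- by move=> i x; case: (fintype.split i) => j; rewrite mulr_ge0.
- by move=> i; case: (fintype.split i).
- move=> i x; case: (fintype.split i) => j.
    have := c0 j x; rewrite le_eqVlt => /predU1P[<-|/sy//].
    by rewrite mulr0 ltxx.
  have := c'0 j x; rewrite le_eqVlt => /predU1P[<-|/sy'//].
  by rewrite mulr0 ltxx.
- apply/funext => x; apply/funext => o; rewrite big_split_ord/=.
  congr (_ + _); rewrite mulr_sumr; apply: eq_bigr => j _.
    by rewrite (unsplitK (inl j)) mulrA.
  by rewrite (unsplitK (inr j)) mulrA.
Qed.

Lemma support_cone_sum_gt0 n (c : 'I_n -> R) (i : 'I_n) :
  (forall i, 0 <= c i) -> ~~ (0 < \sum_j c j) -> c i = 0.
Proof.
move=> c0; rewrite -leNgt => le0; apply/eqP; rewrite eq_le c0 andbT.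
apply: le_trans le0; by rewrite (bigD1 i)//= lerDl; apply: sumr_ge0 => j _; exact: c0.
Qed.

(* If [v x None] did not vanish, one could localize [P] where it does not and
   mix it, as (COV1) allows, with the finitely supported laws given by the
   normalized coefficients of [v]. The nuisances are unchanged and so is the
   target, whereas the score has another conditional mean under the mixture. *)
Lemma support_cone_zero v : support_cone v -> (forall x k, v x (Some k) = 0) ->
  \forall x \ae marginal P, v x None = 0.
Proof.
move=> Cv v0; have mv := support_cone_measurable Cv None.
have [n [c [y [mc c0 my sy vE]]]] := Cv.
pose T x := \sum_i c i x.
have mT : measurable_fun setT T by exact: measurable_sum.
pose D := [set x | v x None != 0].
have mb : measurable_fun setT (fun x => v x None != 0).
  by apply: measurable_neg; exact: measurable_fun_eqr.
have mD : measurable D by exact: measurable_set_bool.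
have DT x : D x -> 0 < T x.
  apply: contraTT => nT; rewrite negbK vE big1// => i _.
  by rewrite (support_cone_sum_gt0 i (c0^~ x) nT) mul0r.
have [D0|Dn0] := eqVneq (marginal P D) 0%E.
  have := ae_not_null mD D0; apply: filterS => x /negP.
  by rewrite negbK => /eqP.
exfalso.
have [|P1 [lP1 [HP1 aeD aeP etaE kappaE]]] :=
  localize standing_ok lP mD.
  by rewrite lt0e Dn0 measure_ge0.
pose p i x := c i x / T x.
have mp i : measurable_fun setT (p i).
  rewrite (_ : p i = fun x => c i x * (T x `^ (-1))).
    apply: measurable_funM => //.
    apply: (measurableT_comp (f := @powR R ^~ (-1)) _ mT).
    exact: measurable_powR.
  apply/funext => x; rewrite powR_inv1//; apply: sumr_ge0 => j _; exact: c0.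
have p0 i x : D x -> 0 <= p i x by move=> /DT Tx; rewrite divr_ge0// ltW.
have p1 x : D x -> \sum_i p i x = 1.
  by move=> /DT Tx; rewrite -mulr_suml divff// gt_eqF.
have pv x o : D x -> \sum_i p i x * centered (x, y i x) o = v x o / T x.
  by move=> Dx; rewrite vE mulr_suml; apply: eq_bigr => i _; rewrite mulrAC.
have nu_ex x : exists nu : pprobability BW R, D x ->
    (forall A, nu A = \sum_i (p i x)%:E * \d_(y i x) A)%E /\
    forall g : BW -> R, measurable_fun setT g ->
      nu.-integrable setT (EFin \o g) /\
      (\int[nu]_z (g z)%:E = (\sum_i p i x * g (y i x))%:E)%E.
  have [Dx|nDx] := pselect (D x); last by exists (condlaw P x).
  have [nu [nuA nug]] := @finite_mixture _ BW R n (p ^~ x)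
    (fun i => \d_(y i x)) (p0^~ x ^~ Dx) (p1 x Dx).
  exists nu => _; split => // g mg.
  have [||ig Eg] := nug (EFin \o g).
  - exact/measurable_EFinP.
  - by move=> i; have [] := integrable_dirac (y i x) mg.
  split => //; rewrite Eg -sumEFin; apply: eq_bigr => i _.
  by have [_ ->] := integrable_dirac (y i x) mg.
have [nu Hnu] := choice nu_ex.
(* The weight [1/2] stands for any [eps] in [(0, 1)]. *)
have Q_ex x : exists q : pprobability BW R,
    (D x -> (forall A, q A = (2^-1)%:E * condlaw P x A + (2^-1)%:E * nu x A)%E /\
    forall g, (condlaw P x).-integrable setT g -> (nu x).-integrable setT g ->
      q.-integrable setT g /\
      (\int[q]_z g z = (2^-1)%:E * \int[condlaw P x]_z g z +
         (2^-1)%:E * \int[nu x]_z g z)%E) /\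
    (~ D x -> q = condlaw P x).
  have [Dx|nDx] := pselect (D x); last by exists (condlaw P x).
  by have [q Hq] := half_mixture (condlaw P x) (nu x); exists q.
have [Q HQ] := choice Q_ex.
have mQ : measurable_fun setT Q.
  apply: measurable_pprobability => U mU.
  rewrite (_ : (fun x => Q x U) = fun x => if v x None != 0 then
    ((2^-1)%:E * condlaw P x U +
     (2^-1)%:E * (\sum_i p i x * \1_U (y i x))%:E)%E else condlaw P x U).
    have mcl := measurable_kernel_eval (condlaw_measurable framework_ok lP) mU.
    apply: measurable_fun_ifT => //; apply: emeasurable_funD.
      exact: measurable_funeM.
    apply: measurable_funeM; apply/measurable_EFinP.
    apply: measurable_sum => i; apply: measurable_funM => //.
    by apply: measurableT_comp => //; exact: measurable_indic.
  apply/funext => x; case: ifPn => [Dx|nDx]; last by rewrite (HQ x).2//; exact/negP.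
  have [[qA _] _] := (HQ x, Dx); rewrite ((HQ x).1 Dx).1 ((Hnu x Dx).1).
  by congr (_ + _ * _)%E; rewrite -sumEFin; apply: eq_bigr => i _; rewrite EFinM diracE indicE.
have clE := condlaw_unique framework_ok lP1 (fun _ _ => erefl) HP1.
have uE : \forall x \ae marginal P1, u P1 x = u P x.
  apply: (u_of_eta min_linear_ok lP lP1 aeP) => //.
  by apply: filterS etaE => x ->.
(* (COV1) is applied to the localized law [P1], for which [D] has full measure: off [D] no mixture
   has been built. The support and the means must therefore be those of [P1]. *)
have mixQ : \forall x \ae marginal P1, mean_preserving_mixture S P1 x (Q x).
  apply: filterS3 aeD clE uE => x Dx clx ux.
  have [nuA nug] := Hnu x Dx.
  have [QA _] := (HQ x).1 Dx.
  exists 2^-1, (nu x); split.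
  - by rewrite invr_gt0 ltr0n/= invf_lt1// ltr1n.
  - exists [set z | exists2 i, 0 < p i x & z = y i x]; split.
    + apply: (@sub_finite_set _ _ ((fun i => y i x) @` setT)).
        by move=> _ [i _ ->]; exists i.
      by apply: finite_image; exact: finite_finset.
    + move=> _ [i pi ->] U oU Uy; rewrite -clx; last exact: measurable_open.
      apply: sy oU Uy; move: pi; rewrite /p.
      by rewrite pmulr_lgt0// invr_gt0 DT.
    + rewrite nuA (_ : 1%E = (\sum_i p i x)%:E); last by rewrite p1.
      rewrite -sumEFin; apply: eq_bigr => i _.
      have := p0 i x Dx; rewrite le_eqVlt => /predU1P[<-|pi].
        by rewrite mul0e.
      by rewrite diracE mem_set ?mule1//; exists i.
  - move=> k; rewrite unlock.
    have mhx : measurable_fun setT (fun z => h S k (x, z)).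
      exact: measurable_fun_pair2 (h_measurable min_linear_ok k).
    have [_ ->] := nug _ mhx; congr EFin; rewrite ux.
    have := pv x (Some k) Dx; rewrite v0 mul0r /=.
    rewrite weighted_sum_sub ?p1// => /eqP; rewrite subr_eq0 => /eqP.
    exact.
  - move=> B mB; rewrite QA// clx// (_ : 1 - 2^-1 = 2^-1)//.
    by lra.
have sel := selection_expectation framework_ok standing_ok min_linear_ok fFB mw
  lP1 ((cov1 lP1).2 Q (measurable_universally mQ) mixQ).
have cross := aeP _ cross_self.
apply: (@ae_nontrivial R _ _ (marginal P1)).
apply: filterS2 (filterI sel cross) (filterI (filterI etaE kappaE)
  (filterI aeD (filterI uE (Hjo_eta min_linear_ok lP1)))) =>
  x [[_ Esel] [icond Econd]] [[ex kx] [Dx [ux Hx]]].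
have gE : (fun z => (score f P1 w (x, z))%:E) = fun z => (score f P w (x, z))%:E.
  by apply/funext => z; rewrite /score /score_at /= ex kx.
have mg : measurable_fun setT (fun z => score f P w (x, z)).
  exact: measurable_fun_pair2 (score_measurable framework_ok lP fFB mw).
have [_ nug] := Hnu x Dx; have [inu Enu] := nug _ mg.
have [_ Qg] := (HQ x).1 Dx; have [_ EQ] := Qg _ icond inu.
(* The mixture and the baseline both give the score the mean [psi (x, u P x)], so [nu x] does too;
   hence [v x None / T x] is 0, against [D x]. *)
move: Esel; rewrite gE EQ Econd Enu Hx ux -!EFinM -EFinD => -[E].
have := Dx; rewrite /D/= => /eqP; apply.
have : \sum_i p i x * centered (x, y i x) None = 0.
  rewrite /= weighted_sum_sub ?p1//; move: E.
  by move: (\sum_i _) (psi _) => r q; lra.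
rewrite pv// => /eqP; rewrite mulf_eq0 invr_eq0 [T x == 0]gt_eqF ?DT// orbF.
by move/eqP.
Qed.

Lemma score_affine : \forall x \ae marginal P, exists a : 'I_(nK F).+1 -> R,
  \forall y \ae condlaw P x,
    score f P w (x, y) = psi (x, u P x) + \sum_k a k * (h S k (x, y) - u P x k 0).
Proof.
have [dist [dd mW]] := polish_separable_metric (Wsp_polish framework_ok).
have [A [y [mA my sy ess gen]]] := essential_selectors mW
  (condlaw_measurable framework_ok lP) (condlawP framework_ok lP)
  measurable_centered.
(* The indicator turns the selectors, meaningful only on [A i], into vector fields defined
   everywhere. *)
pose z i x o : R := \1_(A i) x * centered (x, y i x) o.
have Cz i : support_cone (z i).
  exists 1%N, (fun=> \1_(A i)), (fun=> y i); split => //.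
  - move=> _ x; rewrite indicE.
    by case: (boolP (x \in A i)) => [/set_mem Ax _|_]; [exact: sy|rewrite ltxx].
  - by apply/funext => x; apply/funext => o; rewrite big_ord1.
have pz a i x : pairing a (z i x) = \1_(A i) x * pairing a (centered (x, y i x)).
  by rewrite /pairing mulr_sumr; apply: eq_bigr => o _; rewrite mulrCA.
have := @cone_hyperplane R _ _ BX (marginal P) support_cone
  support_cone_measurable support_cone_comb support_cone_zero
  (enum 'I_(nK F).+1) _ z Cz.
move=> H; have {}H : \forall x \ae marginal P,
    exists2 a : option 'I_(nK F).+1 -> R, a None = 1 &
      forall i, pairing a (z i x) = 0.
  apply: H => [i x k|]; first by rewrite mem_enum.
  (* A functional nonnegative at the selected points is almost surely nonnegative by [gen]; having
     mean 0 it vanishes almost surely, hence at the selected points by [ess]. *)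
  apply: filterS2 centered_mean gen => x cm gx a Ha i.
  rewrite pz indicE.
  case: (boolP (x \in A i)) => [/set_mem Ax|_]; last by rewrite mul0r.
  rewrite mul1r; apply: ess => //.
  have ge0 : \forall t \ae condlaw P x, 0 <= pairing a (centered (x, t)).
    apply: gx => j Aj; have := Ha j; rewrite pz indicE mem_set// mul1r.
    exact.
  have [ia Ea] := cm a.
  have := @ae_eq_le_integral _ _ _ (condlaw P x) (cst 0%E) _ _ ia.
  move=> H'; have : \forall t \ae condlaw P x, cst 0%E t = (pairing a (centered (x, t)))%:E.
    apply: H'; first exact: integrable0.
      by apply: filterS ge0 => t; rewrite lee_fin.
    by rewrite Ea integral0.
  by apply: filterS => t /= [].
apply: filterS2 gen H => x gx [a a1 Ha].
exists (fun k => - a (Some k)).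
(* [gen] only yields inequalities, so it is applied to both [a] and its opposite. *)
have nonneg b : (forall i, pairing b (z i x) = 0) ->
    \forall t \ae condlaw P x, 0 <= pairing b (centered (x, t)).
  by move=> Hb; apply: gx => i Ai; have := Hb i; rewrite pz indicE mem_set// mul1r => ->.
have pN t : pairing (fun o => - a o) t = - pairing a t.
  by rewrite /pairing -sumrN; apply: eq_bigr => o _; rewrite mulNr.
have := nonneg (fun o => - a o) (fun i => _).
move=> H; have {}H : \forall t \ae condlaw P x, 0 <= pairing (fun o => - a o) (centered (x, t)).
  by apply: H => i; rewrite pN Ha oppr0.
apply: filterS2 (nonneg a Ha) H => t ge; rewrite pN oppr_ge0 => le.
have /eqP : pairing a (centered (x, t)) == 0 by rewrite eq_le le ge.
rewrite pairing_option/= a1 mul1r => /eqP; rewrite addr_eq0 subr_eq addrC => /eqP ->.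
by rewrite -sumrN; congr (_ + _); apply: eq_bigr => k _; rewrite mulNr.
Qed.

End Affine.

(** * Minimal-variance weights *)

Section MinVarWeights.
Context (R : realType) (n : nat) (A : {set 'I_n}) (M : 'M[R]_n).
Hypothesis A_neq0 : (0 < #|A|)%N.
Hypothesis posA : posdefmx (principal_submx A M).
Local Notation MA := (principal_submx A M).
Local Notation one := (const_mx 1 : 'cV[R]_#|A|).
Local Notation q := (ones_inv_ones A M).

Lemma posdefmx_unit : MA \in unitmx.
Proof.
rewrite unitmxE unitfE; apply/negP => /det0P[v vn0 vMA].
have [_ /(_ v^T)] := posA; rewrite trmx_eq0 => /(_ vn0).
by rewrite trmxK vMA mul0mx mxE ltxx.
Qed.

Let z := invmx MA *m one.

Let MAz : MA *m z = one.
Proof. by rewrite /z mulmxA mulmxV ?mul1mx// posdefmx_unit. Qed.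

Let qE : q = \sum_i z i 0.
Proof.
rewrite /ones_inv_ones -mulmxA -/z mxE; apply: eq_bigr => i _.
by rewrite mxE mul1r.
Qed.

(** [q] is the value of the quadratic form at the solution [z] of [MA *m z = one], which is nonzero
    because [A] is nonempty. *)
Lemma ones_inv_ones_gt0 : 0 < q.
Proof.
have zn0 : z != 0.
  apply: contraTneq A_neq0 => z0; rewrite -leqNgt leqn0; apply/eqP.
  have := MAz; rewrite z0 mulmx0 => /matrixP H.
  case: (posnP #|A|) => // A0; have := H (Ordinal A0) 0.
  by rewrite !mxE => /eqP; rewrite eq_sym oner_eq0.
have [_ /(_ z zn0)] := posA; rewrite -mulmxA MAz mxE qE.
by rewrite (eq_bigr (fun i => z i 0)) => // i _; rewrite !mxE mulr1.
Qed.

Lemma min_var_weights_sum (G : 'I_n -> R) :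
  \sum_l G l * min_var_weights A M l 0 = \sum_i G (enum_val i) * (z i 0 / q).
Proof.
transitivity (\sum_l \sum_(i < #|A| | enum_val i == l) G l * (z i 0 / q)).
  by apply: eq_bigr => l _; rewrite mxE mulr_sumr.
rewrite (exchange_big_dep xpredT)//=; apply: eq_bigr => i _.
by rewrite (big_pred1 (enum_val i))// => l; rewrite /= eq_sym.
Qed.

Lemma min_var_weights0 k : k \notin A -> min_var_weights A M k 0 = 0.
Proof.
move=> kA; rewrite mxE big1// => i /eqP ik.
by move: (enum_valP i); rewrite ik (negbTE kA).
Qed.

(** The Lagrange condition for minimal variance among weights of sum 1: on [A], all covariances with
    the optimum coincide. *)
Lemma min_var_weights_mul k : k \in A ->
  (M *m min_var_weights A M) k 0 = q^-1.
Proof.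
move=> kA; rewrite mxE (min_var_weights_sum (M k)).
have := congr1 (fun N : 'cV[R]_#|A| => N (enum_rank_in kA k) 0) MAz.
rewrite !mxE => E; rewrite -[RHS]mul1r -E mulr_suml; apply: eq_bigr => j _.
by rewrite !mxE enum_rankK_in// mulrA.
Qed.

Lemma min_var_weights_total : \sum_k min_var_weights A M k 0 = 1.
Proof.
have := min_var_weights_sum (fun=> 1); under eq_bigr do rewrite mul1r.
move=> ->; under eq_bigr do rewrite mul1r.
by rewrite -mulr_suml -qE divff// gt_eqF// ones_inv_ones_gt0.
Qed.

Lemma min_var_weights_supp (G : 'I_n -> R) (c : R) :
  (forall k, k \in A -> G k = c) -> \sum_k G k * min_var_weights A M k 0 = c.
Proof.
move=> Gc; rewrite -[RHS]mulr1 -min_var_weights_total mulr_sumr.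
apply: eq_bigr => k _; have [kA|kA] := boolP (k \in A); first by rewrite Gc.
by rewrite min_var_weights0// !mulr0.
Qed.

End MinVarWeights.

Lemma min_coord_ex (R : realType) n (v : 'cV[R]_n.+1) :
  exists k, v k 0 = min_coord v.
Proof.
rewrite /min_coord; elim/big_ind: _ => [|r s [k <-] [l <-]|k _].
- by exists ord0.
- by case: leP => _; [exists k|exists l].
- by exists k.
Qed.

Lemma argmin_card_gt0 (R : realType) n (v : 'cV[R]_n.+1) : (0 < #|argmin v|)%N.
Proof.
apply/card_gt0P; have [k kE] := min_coord_ex v; exists k.
by rewrite inE kE.
Qed.

(** * Measurability of matrix-valued functions *)

Section MatrixMeasurability.
Context (R : realType) d (X : measurableType d).

Lemma measurable_inv (f : X -> R) : measurable_fun setT f ->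
  measurable_fun setT (fun x => (f x)^-1).
Proof.
move=> mf; (* [x / x ^ 2] agrees with the inverse also at [0], by [0^-1 = 0]. *)
rewrite (_ : (fun x => _) = fun x => f x * ((f x ^+ 2) `^ (-1))).
  apply: measurable_funM => //.
  apply: (measurableT_comp (f := @powR R ^~ (-1))); first exact: measurable_powR.
  exact: measurable_funX.
apply/funext => x; rewrite powR_inv1 ?sqr_ge0//.
have [->|fn0] := eqVneq (f x) 0; first by rewrite invr0 mul0r.
by field.
Qed.

Lemma measurable_prod_fun I (s : seq I) (F : I -> X -> R) :
  (forall i, measurable_fun setT (F i)) ->
  measurable_fun setT (fun x => \prod_(i <- s) F i x).
Proof.
move=> mF; elim: s => [|i s IH].
  by under eq_fun do rewrite big_nil; exact: measurable_cst.
by under eq_fun do rewrite big_cons; exact: measurable_funM.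
Qed.

Definition measurable_mx m n (M : X -> 'M[R]_(m, n)) : Prop :=
  forall i j, measurable_fun setT (fun x => M x i j).

Lemma measurable_det n (M : X -> 'M[R]_n) : measurable_mx M ->
  measurable_fun setT (fun x => \det (M x)).
Proof.
move=> mM; apply: measurable_sum => s; apply: measurable_funM.
  exact: measurable_cst.
by apply: measurable_prod_fun => i; exact: mM.
Qed.

Lemma measurable_mulmx m n p (M : X -> 'M[R]_(m, n)) (N : X -> 'M[R]_(n, p)) :
  measurable_mx M -> measurable_mx N -> measurable_mx (fun x => M x *m N x).
Proof.
move=> mM mN i j; under eq_fun do rewrite mxE.
by apply: measurable_sum => k; apply: measurable_funM; [exact: mM|exact: mN].
Qed.

Lemma measurable_cst_mx m n (M : 'M[R]_(m, n)) : measurable_mx (fun=> M).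
Proof. by move=> i j; exact: measurable_cst. Qed.

Lemma measurable_invmx n (M : X -> 'M[R]_n) : measurable_mx M ->
  measurable_mx (fun x => invmx (M x)).
Proof.
move=> mM i j; have mdet := measurable_det mM.
(* The cofactor formula; [invmx] returns a singular matrix unchanged, whence the last branch. *)
rewrite (_ : (fun x => _) = fun x => if \det (M x) != 0 then
  (\det (M x))^-1 * ((-1) ^+ (j + i) * \det (row' j (col' i (M x)))) else M x i j).
  apply: measurable_fun_ifT.
  - by apply: measurable_neg; exact: measurable_fun_eqr.
  - apply: measurable_funM; first exact: measurable_inv.
    apply: measurable_funM; first exact: measurable_cst.
    apply: measurable_det => k l; under eq_fun do rewrite !mxE.
    exact: mM.
  - exact: mM.
apply/funext => x; rewrite /invmx unitmxE unitfE.
by case: ifPn => // _; rewrite !mxE.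
Qed.

Lemma measurable_principal_submx n (A : {set 'I_n}) (M : X -> 'M[R]_n) :
  measurable_mx M -> measurable_mx (fun x => principal_submx A (M x)).
Proof. by move=> mM i j; under eq_fun do rewrite mxE; exact: mM. Qed.

Lemma measurable_ones_inv_ones n (A : {set 'I_n}) (M : X -> 'M[R]_n) :
  measurable_mx M -> measurable_fun setT (fun x => ones_inv_ones A (M x)).
Proof.
move=> mM; apply: measurable_mulmx; last exact: measurable_cst_mx.
apply: measurable_mulmx; first exact: measurable_cst_mx.
by apply: measurable_invmx; exact: measurable_principal_submx.
Qed.

Lemma measurable_min_var_weights n (A : {set 'I_n}) (M : X -> 'M[R]_n) :
  measurable_mx M -> measurable_mx (fun x => min_var_weights A (M x)).
Proof.
move=> mM k j; under eq_fun do rewrite mxE.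
under eq_fun do rewrite big_mkcond.
apply: measurable_sum => i /=.
case: (enum_val i == k); last exact: measurable_cst.
apply: measurable_funM; last first.
  by apply: measurable_inv; exact: measurable_ones_inv_ones.
apply: measurable_mulmx; last exact: measurable_cst_mx.
by apply: measurable_invmx; exact: measurable_principal_submx.
Qed.

(** The active set varies with [x], and with it the size of the submatrix; freezing it on finitely
    many measurable pieces leaves matrices of fixed size. *)
Lemma measurable_finite_parameter (I : finType) (s : X -> I) (G : I -> X -> R) :
  (forall i, measurable [set x | s x = i]) ->
  (forall i, measurable_fun setT (G i)) ->
  measurable_fun setT (fun x => G (s x) x).
Proof.
move=> ms mG.
rewrite (_ : (fun x => _) = fun x => \sum_i \1_[set x | s x = i] x * G i x).
  apply: measurable_sum => i; exact: measurable_funM.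
apply/funext => x; rewrite (bigD1 (s x))//= big1 => [|i si].
  by rewrite indicE mem_set// mul1r addr0.
by rewrite indicE memNset ?mul0r//= => E; rewrite E eqxx in si.
Qed.

Lemma measurable_borel_cV n (v : X -> 'cV[R]_n.+1) : measurable_mx v ->
  measurable_fun setT (v : X -> borel 'cV[R]_n.+1).
Proof.
move=> mv.
pose box (p : {ffun 'I_n.+1 -> rat} * nat) : set 'cV[R]_n.+1 :=
  [set a | rational_box p (fun k => a k 0)].
apply: (@measurability _ _ X (borel 'cV[R]_n.+1) setT v
  (@open 'cV[R]_n.+1)) => // _ [U oU <-]; rewrite setTI.
rewrite (_ : v @^-1` U =
  \bigcup_(p in [set p | box p `<=` U]) (v @^-1` (box p))).
  rewrite bigcup_mkcond; apply: countable_bigcupT_measurable => // p.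
  case: ifP => _; last exact: measurable0.
  rewrite (_ : v @^-1` box p = \bigcap_(k in [set: 'I_n.+1])
    [set x | `|v x k 0 - ratr (p.1 k)| < p.2.+1%:R^-1]); last first.
    by apply/seteqP; split => x Hx k; [move=> _; exact: Hx|exact: Hx].
  apply: fin_bigcap_measurable => // k _; apply: measurable_set_ltr => //.
  by apply: measurableT_comp => //; apply: measurable_funB => //; exact: mv.
apply/seteqP; split => [x Ux|x [p /= pU px]]; last exact: pU.
have : nbhs (v x) U by exact: open_nbhs_nbhs.
move=> /nbhs_ballP[e /= e0 eU].
have [p [pv Hp]] := rational_box_small (fun k => v x k 0) e0.
exists p => // y py; apply: eU; split => // i j; rewrite ord1.
by rewrite /ball/= distrC; exact: (Hp _ py).
Qed.

End MatrixMeasurability.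

(** * The variance floor *)

Section Moments.
Context (R : realType) (F : framework R) (S : min_linear F).
Context (L : local_model F).
Hypothesis min_linear_ok : min_linear_conditions S L.
Local Notation law := (probability (borel (Xsp F) * borel (Wsp F))%type R).
Local Notation BX := (borel (Xsp F)).
Local Notation BW := (borel (Wsp F)).
Local Notation K := (nK F).+1.
Context (P : law) (lP : laws P).

Definition noise x k (y : BW) : R := h S k (x, y) - u P x k 0.

Lemma measurable_noise x k : measurable_fun setT (noise x k).
Proof.
apply: measurable_funB => //.
exact: measurable_fun_pair2 (h_measurable min_linear_ok k).
Qed.

(** The bilinear form of [Sigma], written as a single sum over pairs so that [integrable_lincomb]
    applies to the products of noises. *)
Definition quadratic x (a b : 'I_K -> R) : R :=
  \sum_(kl : 'I_K * 'I_K) a kl.1 * b kl.2 * Sigma S P x kl.1 kl.2.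

(** [Sigma] is defined through [fine] and represents the covariances only where these are finite;
    here its entries are tied to actual integrals. *)
Definition regular_point x : Prop :=
  (forall k, (condlaw P x).-integrable setT (fun y => (noise x k y)%:E) /\
     (\int[condlaw P x]_y (noise x k y)%:E = 0)%E) /\
  (forall kl : 'I_K * 'I_K, (condlaw P x).-integrable setT
      (fun y => (noise x kl.1 y * noise x kl.2 y)%:E) /\
     (\int[condlaw P x]_y (noise x kl.1 y * noise x kl.2 y)%:E =
       (Sigma S P x kl.1 kl.2)%:E)%E).

Lemma ae_regular_point : \forall x \ae marginal P, regular_point x.
Proof.
have := h_moments min_linear_ok lP; apply: filterS => x hm.
have Hm k : (condlaw P x).-integrable setT (fun y => (noise x k y)%:E) /\
     (\int[condlaw P x]_y (noise x k y)%:E = 0)%E.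
  have [ih _ Eh] := hm k; rewrite /noise; under eq_fun do rewrite EFinB.
  have ic := finite_measure_integrable_cst (condlaw P x) (u P x k 0) measurableT.
  split; first exact: integrableB.
  by rewrite integralB// Eh (integral_probability_cst (condlaw P x)) subee.
split => // -[k l] /=.
have ikl : (condlaw P x).-integrable setT
    (fun y => (noise x k y * noise x l y)%:E).
  have isq j : (condlaw P x).-integrable setT
      (fun y => (h S j (x, y) ^+ 2 + (u P x j 0) ^+ 2)%:E).
    have [_ i2 _] := hm j; under eq_fun do rewrite EFinD.
    apply: integrableD => //.
    exact: finite_measure_integrable_cst.
  apply: (@le_integrable _ _ _ (condlaw P x) _ measurableT _
    (fun y => (2%:E * (h S k (x, y) ^+ 2 + (u P x k 0) ^+ 2)%:E +
               2%:E * (h S l (x, y) ^+ 2 + (u P x l 0) ^+ 2)%:E)%E)).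
  - by apply/measurable_EFinP; apply: measurable_funM; exact: measurable_noise.
  - move=> y _; rewrite -!EFinM -EFinD/= lee_fin.
    rewrite [leRHS]ger0_norm; last first.
      by rewrite addr_ge0// mulr_ge0// addr_ge0// sqr_ge0.
    rewrite ler_norml /noise.
    move: (h S k _) (h S l _) (u P x k 0) (u P x l 0) => a b c e.
    (* With [p = a - c] and [q = b - e], the first two squares bound [2 |p q|] by [p ^ 2 + q ^ 2];
       the next two bound [p ^ 2] by [2 (a ^ 2 + c ^ 2)] and [q ^ 2] likewise. *)
    have s1 := sqr_ge0 (a - c + (b - e)); have s2 := sqr_ge0 (a - c - (b - e)).
    have s3 := sqr_ge0 (a + c); have s4 := sqr_ge0 (b + e).
    by apply/andP; split; nra.
  - by apply: integrableD => //; exact: integrableZl.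
split => //; have E j : 'E_(condlaw P x)[fun y => h S j (x, y)]%E = (u P x j 0)%:E.
  by have [_ _] := hm j; rewrite unlock.
rewrite /Sigma mxE covariance.unlock !E/= unlock fineK//.
exact: integrable_fin_num ikl.
Qed.

Lemma sqr_affine (n a : 'I_K -> R) (b : R) :
  (b + \sum_k a k * n k) ^+ 2 = b ^+ 2 + (2 * b * \sum_k a k * n k +
    \sum_(kl : 'I_K * 'I_K) a kl.1 * a kl.2 * (n kl.1 * n kl.2)).
Proof.
rewrite sqrrD -addrA -mulr_natl mulrA; congr (_ + (_ + _)).
rewrite expr2 big_distrlr/= pair_big/=; apply: eq_bigr => -[k l] _ /=.
by rewrite mulrACA.
Qed.

Lemma affine_moments x (a : 'I_K -> R) (b : R) : regular_point x ->
  [/\ (condlaw P x).-integrable setT (fun y => (b + \sum_k a k * noise x k y)%:E),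
   (\int[condlaw P x]_y (b + \sum_k a k * noise x k y)%:E = b%:E)%E &
   (\int[condlaw P x]_y ((b + \sum_k a k * noise x k y) ^+ 2)%:E =
     (b ^+ 2 + quadratic x a a)%:E)%E].
Proof.
move=> [H1 H2].
have [i1 E1] := integrable_lincomb (index_enum 'I_K) a (r := fun=> 0) H1.
have [i2 E2] := integrable_lincomb (index_enum ('I_K * 'I_K)%type)
  (fun kl => a kl.1 * a kl.2) (r := fun kl => Sigma S P x kl.1 kl.2) H2.
have ic r := finite_measure_integrable_cst (condlaw P x) r measurableT.
have E0 : \sum_k a k * 0 = 0 by rewrite big1// => k _; rewrite mulr0.
split.
- under eq_fun do rewrite EFinD.
  by apply: integrableD => //; exact: ic.
- under eq_integral do rewrite EFinD.
  rewrite integralD//; last exact: ic.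
  by rewrite (integral_probability_cst (condlaw P x)) E1 E0 adde0.
- under eq_integral do rewrite sqr_affine EFinD EFinD [(2 * b * _)%:E]EFinM.
  have i3 : (condlaw P x).-integrable setT
      (fun y => ((2 * b)%:E * (\sum_k a k * noise x k y)%:E)%E).
    exact: integrableZl.
  rewrite integralD//; [|exact: ic|by apply: integrableD].
  rewrite integralD// integralZl// E1 E0 mule0 add0e E2.
  by rewrite (integral_probability_cst (condlaw P x)).
Qed.

Lemma affine_variance x (a : 'I_K -> R) (b : R) (g : BW -> R) :
  regular_point x -> measurable_fun setT g ->
  (\forall y \ae condlaw P x, g y = b + \sum_k a k * noise x k y) ->
  ('V_(condlaw P x)[g] = (quadratic x a a)%:E)%E.
Proof.
move=> reg mg gE; have [ig Eg _] := affine_moments a b reg.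
have [_ _ E2] := affine_moments a 0 reg.
have maff c : measurable_fun setT (fun y => c + \sum_k a k * noise x k y).
  apply: measurable_funD => //; apply: measurable_sum => k.
  by apply: measurable_funM => //; exact: measurable_noise.
have Em : ('E_(condlaw P x)[g] = b%:E)%E.
  rewrite unlock -Eg; apply: ae_eq_integral => //.
  - exact/measurable_EFinP.
  - exact/measurable_EFinP.
  - by apply: filterS gE => y -> _.
rewrite /variance covariance.unlock Em unlock.
rewrite expr0n/= add0r in E2; rewrite -E2; apply: ae_eq_integral => //.
- by apply/measurable_EFinP; apply: measurable_funM; apply: measurable_funB.
- by apply/measurable_EFinP; apply: measurable_funX.
- apply: filterS gE => y Ey _ /=; rewrite expr2 add0r.
  have -> : ((g \- cst b) * (g \- cst b))%R y = (g y - b) * (g y - b) by [].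
  by rewrite Ey addrAC subrr add0r.
Qed.

(** The form is the second moment of a linear combination of the noises. *)
Lemma quadratic_ge0 x a : regular_point x -> 0 <= quadratic x a a.
Proof.
move=> reg; have [_ _] := affine_moments a 0 reg.
rewrite expr0n/= add0r -lee_fin => <-; apply: integral_ge0 => y _.
by rewrite lee_fin sqr_ge0.
Qed.

Lemma SigmaC x k l : Sigma S P x k l = Sigma S P x l k.
Proof. by rewrite !mxE covarianceC. Qed.

Lemma quadraticE x a (b : 'cV[R]_K) :
  quadratic x a (fun l => b l 0) = \sum_k a k * (Sigma S P x *m b) k 0.
Proof.
rewrite /quadratic -(pair_bigA _ (fun k l => a k * b l 0 * Sigma S P x k l))/=.
apply: eq_bigr => k _; rewrite mxE mulr_sumr; apply: eq_bigr => l _.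
by rewrite -mulrA [b l 0 * _]mulrC.
Qed.

Lemma quadratic_sub x a b : quadratic x (fun k => a k - b k) (fun k => a k - b k) =
  quadratic x a a - 2 * quadratic x a b + quadratic x b b.
Proof.
have bC : quadratic x b a = quadratic x a b.
  rewrite /quadratic
    (reindex_inj (h := fun kl : 'I_K * 'I_K => (kl.2, kl.1))) /=; last first.
    by move=> [k l] [k' l'] [-> ->].
  by apply: eq_bigr => kl _; rewrite SigmaC [b _ * _]mulrC.
rewrite mulr_natl mulr2n -{2}bC /quadratic -big_split -sumrB -big_split/=.
by apply: eq_bigr => kl _; ring.
Qed.

End Moments.

Section Floor.
Context (R : realType) (F : framework R) (L : local_model F)
  (S : min_linear F).
Hypothesis framework_ok : framework_conditions F.
Hypothesis standing_ok : standing_conditions L.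
Hypothesis min_linear_ok : min_linear_conditions S L.
Local Notation law := (probability (borel (Xsp F) * borel (Wsp F))%type R).
Local Notation BX := (borel (Xsp F)).
Local Notation BW := (borel (Wsp F)).
Local Notation K := (nK F).+1.
Context (P : law) (lP : laws P).
Hypothesis posP : \forall x \ae marginal P,
  posdefmx (principal_submx (active P x) (Sigma S P x)).

Definition weights x : 'cV[R]_K := min_var_weights (active P x) (Sigma S P x).

Lemma floor_var_gt0 x :
  posdefmx (principal_submx (active P x) (Sigma S P x)) -> 0 < floor_var S P x.
Proof.
by move=> pos; rewrite invr_gt0 ones_inv_ones_gt0// argmin_card_gt0.
Qed.

Lemma Sigma_weights x k :
  posdefmx (principal_submx (active P x) (Sigma S P x)) -> k \in active P x ->
  (Sigma S P x *m weights x) k 0 = floor_var S P x.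
Proof. by move=> pos kA; rewrite min_var_weights_mul// argmin_card_gt0. Qed.

Lemma quadratic_weights x :
  posdefmx (principal_submx (active P x) (Sigma S P x)) ->
  quadratic S P x (fun k => weights x k 0) (fun k => weights x k 0) =
  floor_var S P x.
Proof.
move=> pos; rewrite quadraticE; under eq_bigr do rewrite mulrC.
apply: min_var_weights_supp => //; first exact: argmin_card_gt0.
by move=> k; exact: Sigma_weights.
Qed.

(* Cauchy-Schwarz against the optimal weights. *)
Lemma floor_le_quadratic x a : regular_point S P x ->
  posdefmx (principal_submx (active P x) (Sigma S P x)) ->
  quadratic S P x a (fun k => weights x k 0) = floor_var S P x ->
  floor_var S P x <= quadratic S P x a a.
Proof.
move=> reg pos E.
have := quadratic_ge0 (fun k => a k - weights x k 0) reg.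
by rewrite quadratic_sub E quadratic_weights//; lra.
Qed.

Lemma min_coord_u : measurable_fun setT (fun x => min_coord (u P x)).
Proof.
have -> : (fun x => min_coord (u P x)) = fun x => psi (x, u P x).
  by apply/funext => x; rewrite (psi_min min_linear_ok).
apply: (measurableT_comp (psi_measurable framework_ok)).
by apply: measurable_fun_pair => //; exact: u_measurable.
Qed.

Lemma measurable_active A : measurable [set x | active P x = A].
Proof.
rewrite (_ : [set _ | _] = \bigcap_(k in [set: 'I_K])
    [set x | (u P x k 0 == min_coord (u P x)) = (k \in A)]); last first.
  apply/seteqP; split => [x <- k _|x H]; first by rewrite /active /argmin/= inE.
  by apply/setP => k; rewrite /active inE; exact: H.
apply: fin_bigcap_measurable => // k _.
have mb : measurable_fun setT (fun x => u P x k 0 == min_coord (u P x)).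
  apply: measurable_fun_eqr; last exact: min_coord_u.
  exact: measurable_coord (u_measurable framework_ok lP).
by have := mb measurableT [set (k \in A)] I; rewrite setTI.
Qed.

Lemma measurable_Sigma : measurable_mx (Sigma S P).
Proof.
move=> k l; under eq_fun do rewrite mxE covariance.unlock unlock.
apply: measurableT_comp => //.
have mQ := condlaw_measurable framework_ok lP.
have mm j : measurable_fun setT
    (fun t : BX * BW => fine (\int[condlaw P t.1]_y (h S j (t.1, y))%:E)%E).
  apply: (measurableT_comp (f := fun x : BX =>
    fine (\int[condlaw P x]_y (h S j (x, y))%:E)%E)) => //.
  apply: measurableT_comp => //; apply: measurable_kernel_integral_real => //.
  exact: h_measurable min_linear_ok j.
apply: (measurable_kernel_integral_real
  (g := fun t => (h S k t - fine (\int[condlaw P t.1]_y (h S k (t.1, y))%:E)%E) *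
    (h S l t - fine (\int[condlaw P t.1]_y (h S l (t.1, y))%:E)%E))) => //.
by apply: measurable_funM; apply: measurable_funB => //;
  exact: h_measurable min_linear_ok _.
Qed.

Lemma measurable_weights : measurable_mx weights.
Proof.
move=> k j; apply: (measurable_finite_parameter (s := active P)
  (G := fun A x => min_var_weights A (Sigma S P x) k j)).
  exact: measurable_active.
by move=> A; apply: measurable_min_var_weights; exact: measurable_Sigma.
Qed.

Lemma measurable_floor_var : measurable_fun setT (floor_var S P).
Proof.
apply: measurable_inv; apply: (measurable_finite_parameter (s := active P)
  (G := fun A x => ones_inv_ones A (Sigma S P x))).
  exact: measurable_active.
by move=> A; apply: measurable_ones_inv_ones; exact: measurable_Sigma.
Qed.

Lemma phi_covE x y : phi_cov S P (x, y) =
  psi (x, u P x) + \sum_k weights x k 0 * noise S P x k y.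
Proof.
rewrite (psi_min min_linear_ok) /phi_cov/=; congr (_ + _); rewrite big_mkcond/=.
apply: eq_bigr => k _; case: ifPn => // kA.
by rewrite /weights min_var_weights0// mul0r.
Qed.

Lemma measurable_phi_cov : measurable_fun setT (phi_cov S P).
Proof.
have -> : phi_cov S P = fun t => psi (t.1, u P t.1) +
    \sum_k weights t.1 k 0 * (h S k t - u P t.1 k 0).
  by apply/funext => -[x y]; rewrite phi_covE.
have mu1 := u_measurable framework_ok lP.
apply: measurable_funD.
  apply: (measurableT_comp (psi_measurable framework_ok)).
  by apply: measurable_fun_pair => //; exact: measurableT_comp mu1 _.
apply: measurable_sum => k; apply: measurable_funM.
  exact: measurableT_comp (measurable_weights k 0) _.
apply: measurable_funB; first exact: h_measurable min_linear_ok k.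
exact: measurableT_comp (measurable_coord k mu1) _.
Qed.

(** Inactive coordinates stay strictly above the new minimum, so it is attained at an active one,
    and these all move by [r]. *)
Lemma min_coord_shift x (delta : 'cV[R]_K) (r : R) :
  (forall k, k \in active P x -> delta k 0 = r) ->
  inactive_stay_inactive P x delta ->
  min_coord (u P x + delta) = min_coord (u P x) + r.
Proof.
move=> dr stay; have [k kE] := min_coord_ex (u P x + delta).
have kA : k \in active P x.
  by apply/negPn/negP => /stay; rewrite kE ltxx.
rewrite -kE mxE dr//; congr (_ + _).
by move: kA; rewrite inE => /eqP.
Qed.

Hypothesis shared_ok : shared_score_conditions L S.

(* (COV3) in the direction [Sigma *m weights], whose active coordinates are all
   equal to [floor_var]: the target moves by [t * floor_var], the mean of the
   affine score by [t] times the quadratic form at [(a, weights)]. *)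
Lemma perturbation_identity (f : score_space F -> R) w :
  FB f -> measurable_fun setT w ->
  \forall x \ae marginal P, forall a : 'I_K -> R,
    (\forall y \ae condlaw P x,
      score f P w (x, y) = psi (x, u P x) + \sum_k a k * noise S P x k y) ->
    quadratic S P x a (fun k => weights x k 0) = floor_var S P x.
Proof.
move=> fFB mw.
have [D [[mD cov2] [Qd [e [_ cov3 cov30 sel]]]]] := shared_ok.2 P lP.
pose dir x : 'cV[R]_K := Sigma S P x *m weights x.
pose t n : R := n.+1%:R^-1.
(* The neighbourhood in (COV2) has no size uniform in [x]. Falling back on 0, which lies in [D_x],
   makes every [delta n] an admissible selection; each [x] then picks its own step [t N]. *)
pose delta n x : borel 'cV[R]_K :=
  if `[< D (x, t n *: dir x) >] then t n *: dir x else 0.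
have mdir : measurable_mx dir.
  apply: measurable_mulmx; [exact: measurable_Sigma|exact: measurable_weights].
have mdelta n : measurable_fun setT (delta n).
  have mt : measurable_fun setT (fun x => t n *: dir x : borel 'cV[R]_K).
    apply: measurable_borel_cV => k l; under eq_fun do rewrite mxE.
    by apply: measurable_funM => //; exact: mdir.
  have mDn : measurable [set x | D (x, t n *: dir x)].
    rewrite -[X in measurable X]setTI.
    have mp : measurable_fun setT (fun x => (x, t n *: dir x) : BX * borel 'cV[R]_K).
      exact: measurable_fun_pair.
    exact: mp.
  apply: measurable_fun_ifT => //.
  apply: (measurable_fun_bool true); rewrite setTI.
  by rewrite (_ : _ @^-1` _ = [set x | D (x, t n *: dir x)])//;
    apply/seteqP; split => x /asboolP.
have Ddelta n : \forall x \ae marginal P, D (x, delta n x).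
  apply: filterS cov2 => x [_ D0 _ _]; rewrite /delta.
  by case: ifPn => [/asboolP|].
have Hsel n := selection_expectation framework_ok standing_ok min_linear_ok fFB mw
  lP (sel (delta n) (measurable_universally (mdelta n)) (Ddelta n)).
have reg := ae_regular_point min_linear_ok lP.
apply: filterS3 (filterI (filterI posP reg) cov3) cov2 (ae_foralln Hsel) =>
  x [[pos rx] c3] [_ _ _ near0] Hx a aE.
have t0 n : 0 < t n by rewrite invr_gt0.
have cvgt : t n *: dir x @[n --> \oo] --> (0 : 'cV[R]_K).
  rewrite -[X in _ --> X](scale0r (dir x)); apply: cvgZr_tmp.
  exact: cvg_harmonic.
have dirA k : k \in active P x -> dir x k 0 = floor_var S P x.
  exact: Sigma_weights.
have [N _ HN] := cvgt _ near0.
have [|DN stay] := HN N (leqnn N).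
  split; first by exists (t N *: weights x); rewrite -scalemxAr.
  by move=> i j iA jA; rewrite [LHS]mxE [RHS]mxE !dirA.
have dE : delta N x = t N *: dir x by rewrite /delta asboolT.
have [ac hE HjE _] := c3 _ DN.
have [_] := Hx N; rewrite dE HjE (psi_min min_linear_ok).
rewrite (@min_coord_shift x _ (t N * floor_var S P x))//; last first.
  by move=> k kA; rewrite mxE dirA.
have nE k : (Qd (x, t N *: dir x)).-integrable setT
      (fun y => (noise S P x k y)%:E) /\
    (\int[Qd (x, t N *: dir x)]_y (noise S P x k y)%:E =
      (t N * dir x k 0)%:E)%E.
  have mh : measurable_fun setT (fun y => h S k (x, y)).
    exact: measurable_fun_pair2 (h_measurable min_linear_ok k).
  have := hE k; rewrite unlock => Eh.
  have ih := integral_fin_integrable mh Eh.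
  have ic := finite_measure_integrable_cst (Qd (x, t N *: dir x)) (u P x k 0)
    measurableT.
  rewrite /noise; under eq_fun do rewrite EFinB.
  split; first exact: integrableB.
  rewrite integralB// Eh (integral_probability_cst (Qd _)) -EFinB.
  by rewrite !mxE addrAC subrr add0r.
have [iS ES] := integrable_lincomb (index_enum 'I_K) a nE.
have mscore : measurable_fun setT (fun y => score f P w (x, y)).
  exact: measurable_fun_pair2 (score_measurable framework_ok lP fFB mw).
have -> : (\int[Qd (x, t N *: dir x)]_y (score f P w (x, y))%:E =
    \int[Qd (x, t N *: dir x)]_y
      ((psi (x, u P x))%:E + (\sum_k a k * noise S P x k y)%:E))%E.
  apply: ae_eq_integral => //.
  - exact/measurable_EFinP.
  - apply: emeasurable_funD; first exact: measurable_cst.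
    exact: measurable_int iS.
  (* The affine form is known only up to null sets of [condlaw P x]; absolute continuity carries it
     to the perturbed law. *)
  - have := ae_dominated ac aE; apply: filterS => y -> _.
    by rewrite EFinD.
have ic := finite_measure_integrable_cst (Qd (x, t N *: dir x)) (psi (x, u P x))
  measurableT.
rewrite integralD// (integral_probability_cst (Qd _)) ES -EFinD.
(* Along this direction the minimum is linear near 0, so the identity is exact at one step: [t N]
   cancels and no limit is taken. *)
rewrite (psi_min min_linear_ok) => -[/addrI].
under eq_bigr do rewrite mulrCA; rewrite -mulr_sumr => /mulfI.
by rewrite quadraticE; apply; rewrite gt_eqF.
Qed.

Lemma cond_var_ge_floor (f : score_space F -> R) w :
  FB f -> measurable_fun setT w ->
  \forall x \ae marginal P,
    ((floor_var S P x)%:E <= cond_var P (score f P w) x)%E.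
Proof.
move=> fFB mw.
have aff := score_affine framework_ok standing_ok min_linear_ok shared_ok.1 lP
  fFB mw.
have reg := ae_regular_point min_linear_ok lP.
(* The slope depends on [x], so the identity is needed for all slopes outside one null set. *)
apply: filterS3 (filterI reg posP) aff (perturbation_identity fFB mw) =>
  x [rx pos] [a aE] id.
have mscore : measurable_fun setT (fun y => score f P w (x, y)).
  exact: measurable_fun_pair2 (score_measurable framework_ok lP fFB mw).
rewrite /cond_var (affine_variance min_linear_ok rx mscore aE).
by rewrite lee_fin floor_le_quadratic// id.
Qed.

End Floor.

(** * The efficient score and the total variance *)

Section EfficientScore.
Context (R : realType) (F : framework R) (L : local_model F)
  (S : min_linear F).
Hypothesis framework_ok : framework_conditions F.
Hypothesis min_linear_ok : min_linear_conditions S L.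
Local Notation law := (probability (borel (Xsp F) * borel (Wsp F))%type R).
Local Notation BX := (borel (Xsp F)).
Local Notation BW := (borel (Wsp F)).
Context (P : law) (lP : laws P).
Hypothesis posP : \forall x \ae marginal P,
  posdefmx (principal_submx (active P x) (Sigma S P x)).

(** Stated for any version [g], to serve both for the given score and for [phi_cov] itself. *)
Lemma cond_var_efficient (g : BX * BW -> R) : measurable_fun setT g ->
  (\forall t \ae P, g t = phi_cov S P t) ->
  \forall x \ae marginal P, cond_var P g x = (floor_var S P x)%:E.
Proof.
move=> mg gE.
have gx := disintegration_ae (condlaw_measurable framework_ok lP)
  (condlawP framework_ok lP) gE.
apply: filterS3 (ae_regular_point min_linear_ok lP) posP gx => x rx pos gxE.
have mgx : measurable_fun setT (fun y => g (x, y)).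
  exact: measurable_fun_pair2 mg.
rewrite /cond_var.
rewrite (affine_variance min_linear_ok (a := fun k => weights S P x k 0)
  (b := psi (x, u P x)) rx mgx) ?quadratic_weights//.
by apply: filterS gxE => y ->; rewrite (phi_covE min_linear_ok).
Qed.

(** The law of total variance, written with second moments about the common mean [m]: given [x],
    that of [phi_cov] is [(psi - m) ^ 2] plus the floor. The integrands can be taken nonnegative, so
    infinite values are allowed. *)
Lemma variance_efficient (V : BX -> \bar R) : measurable_fun setT V ->
  (\forall x \ae marginal P, V x = (floor_var S P x)%:E) ->
  ('E_P[phi_cov S P] = Psi P)%E -> ('V_P[phi_cov S P] = Vlow P V)%E.
Proof.
move=> mV VE Em.
have mphi := measurable_phi_cov framework_ok min_linear_ok lP.
have mpsi : measurable_fun setT (fun x => psi (x, u P x)).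
  apply: (measurableT_comp (psi_measurable framework_ok)).
  by apply: measurable_fun_pair => //; exact: u_measurable.
have mfloor := measurable_floor_var framework_ok min_linear_ok lP.
rewrite /Vlow /variance covariance.unlock Em /Psi; set m := fine _.
have sq2 T (g : T -> R) t : ((g \- cst m) * (g \- cst m))%R t = (g t - m) ^+ 2.
  by rewrite expr2.
have mQ := condlaw_measurable framework_ok lP.
have mphi2 : measurable_fun setT (fun t => ((phi_cov S P t - m) ^+ 2)%:E).
  by apply/measurable_EFinP; apply: measurable_funX; exact: measurable_funB.
have mpsi2 : measurable_fun setT (fun x => ((psi (x, u P x) - m) ^+ 2)%:E).
  by apply/measurable_EFinP; apply: measurable_funX; exact: measurable_funB.
have mabs : measurable_fun setT (fun x => (`|floor_var S P x|)%:E).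
  by apply/measurable_EFinP; exact: measurableT_comp.
rewrite unlock.
under eq_integral do rewrite sq2.
under [in RHS]eq_integral do rewrite sq2.
rewrite (ge0_disintegration mQ (condlawP framework_ok lP) mphi2); last first.
  by move=> t; rewrite lee_fin sqr_ge0.
(* [floor_var] is only known to be nonnegative almost everywhere. *)
have -> : (\int[marginal P]_x V x = \int[marginal P]_x (`|floor_var S P x|)%:E)%E.
  apply: ae_eq_integral => //.
  by apply: filterS2 posP VE => x pos -> _; rewrite gtr0_norm// floor_var_gt0.
rewrite -ge0_integralD//; [|by move=> x _; rewrite lee_fin sqr_ge0].
apply: ae_eq_integral => //.
- by apply: (measurable_kernel_integral mQ mphi2) => t; rewrite lee_fin sqr_ge0.
- exact: emeasurable_funD.
- apply: filterS2 (ae_regular_point min_linear_ok lP) posP => x rx pos _ /=.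
  have [_ _] := affine_moments (fun k => weights S P x k 0)
    (psi (x, u P x) - m) rx.
  rewrite quadratic_weights// gtr0_norm ?floor_var_gt0// EFinD => <-.
  by apply: eq_integral => y _; rewrite (phi_covE min_linear_ok) addrAC.
Qed.

End EfficientScore.

Theorem theorem5p17 (R : realType) (F : framework R) (L : local_model F)
    (S : min_linear F) :
  framework_conditions F -> standing_conditions L ->
  min_linear_conditions S L -> shared_score_conditions L S ->
  forall P, laws P ->
  (\forall x \ae marginal P,
     posdefmx (principal_submx (active P x) (Sigma S P x))) ->
  forall (w : borel (Xsp F) -> borel (Auxsp F)) (V : borel (Xsp F) -> \bar R),
  measurable_fun setT w -> is_Vmin P w V ->
  (\forall x \ae marginal P, ((floor_var S P x)%:E <= V x)%E)
  /\
  (forall (f : score_space F -> R) (w' : borel (Xsp F) -> borel (Auxsp F)),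
     FB f -> measurable_fun setT w' ->
     (\forall t \ae P, score f P w' t = phi_cov S P t) ->
     ('V_P[score f P w'] < +oo)%E ->
     [/\ (\forall x \ae marginal P, V x = (floor_var S P x)%:E),
         (\forall x \ae marginal P, cond_var P (phi_cov S P) x = V x) &
         ('V_P[phi_cov S P] = Vlow P V)%E]).
Proof.
move=> framework_ok standing_ok min_linear_ok shared_ok P lP posP w V mw
  [mV V_lb V_glb].
have floor_le : \forall x \ae marginal P, ((floor_var S P x)%:E <= V x)%E.
  (* The floor is a measurable lower bound of all competitors, hence below the greatest one. *)
  apply: (V_glb (EFin \o floor_var S P)).
    apply/measurable_EFinP.
    exact: (measurable_floor_var framework_ok min_linear_ok lP).
  move=> _ [f [fFB _] <-].
  exact: (cond_var_ge_floor framework_ok standing_ok min_linear_ok lP posP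
    shared_ok fFB mw).
split=> // f w' fFB mw' fE fV.
have ms := score_measurable framework_ok lP fFB mw'.
have mphi := measurable_phi_cov framework_ok min_linear_ok lP.
(* Absorbing [w'] into the score makes it a competitor for every auxiliary
   map, in particular for the [w] used to compute [V]. *)
pose f' (t : score_space F) : R := f (t.1, w' t.1.1.1.1).
have f'FB : FB f'.
  split; last by move=> P1 P2 w1 lP1 lP2 _; exact: fFB.2.
  apply: (measurableT_comp fFB.1).
  apply: measurable_fun_pair => //; apply: (measurableT_comp mw').
  have m2 : measurable_fun setT (fun t : score_space F => t.1.1).
    exact: (measurableT_comp measurable_fst measurable_fst).
  have m3 : measurable_fun setT (fun t : score_space F => t.1.1.1).
    exact: (measurableT_comp measurable_fst m2).
  exact: (measurableT_comp measurable_fst m3).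
have floorE := cond_var_efficient framework_ok min_linear_ok lP posP ms fE.
have V_le : \forall x \ae marginal P, (V x <= cond_var P (score f P w') x)%E.
  by apply: V_lb; exists f'.
have VE : \forall x \ae marginal P, V x = (floor_var S P x)%:E.
  apply: filterS3 floor_le floorE V_le => x fV1 -> Vf.
  by apply/eqP; rewrite eq_le Vf fV1.
split => //.
  have phiE : \forall t \ae P, phi_cov S P t = phi_cov S P t.
    exact: aeW.
  apply: filterS2 VE
    (cond_var_efficient framework_ok min_linear_ok lP posP mphi phiE) => x -> ->.
  by [].
apply: (variance_efficient framework_ok min_linear_ok lP posP mV VE).
(* [FB] at the pair [(P, P)] gives the score, hence its version [phi_cov], the mean [Psi P]. *)
have [_ <-] := fFB.2 P P w' lP lP mw'
  (ex_intro _ (jo S) (fun l _ => aeW _ (fun x => erefl))).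
rewrite !unlock; apply: ae_eq_integral => //.
- exact/measurable_EFinP.
- exact/measurable_EFinP.
- by apply: filterS fE => t Et _; rewrite -Et.
Qed.
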